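(* Let $d\ge1$, let $s\in\mathbb{R}$ satisfy $d-4<s<d$, and let $\mathcal{L}\subset\mathbb{R}^d$ be a lattice whose Wigner–Seitz unit cell $Q$ has $|Q|=1$. Then the thermodynamic limit $e^{\mathcal{L}}_{\mathrm{Jel},s}$ of the Jellium energy per unit volume of the lattice configuration exists and $$e^{\mathcal{L}}_{\mathrm{Jel},s}=\begin{cases}\zeta_{\mathcal{L}}(s)&\text{if } s>0,\\ \zeta_{\mathcal{L}}'(0)&\text{if } s=0,\\ -\zeta_{\mathcal{L}}(s)&\text{if } s<0.\end{cases}$$
   Context: The Riesz potential on $\mathbb{R}^d$ is $V_s(x)=|x|^{-s}$ if $s>0$, $V_s(x)=-\log|x|$ if $s=0$, $V_s(x)=-|x|^{-s}$ if $s<0$. For $s<d$, set $D_{d,s}(f)=\frac12\iint f(x)f(y)V_s(x-y)\,dx\,dy$ and $$\mathcal{E}_{\mathrm{Jel},d,s}(\Omega_N,x_1,\dots,x_N)=\sum_{j<k}V_s(x_j-x_k)-\sum_{j=1}^N\int_{\Omega_N}V_s(x_j-y)\,dy+D_{d,s}(\mathbbm{1}_{\Omega_N}).$$ The lattice Jellium energy is $e^{\mathcal{L}}_{\mathrm{Jel},s}=\lim\mathcal{E}_{\mathrm{Jel},d,s}(\Omega_N,x_1,\dots,x_N)/|\Omega_N|$, where $\{x_1,\dots,x_N\}=\mathcal{L}\cap B_R$, $\Omega_N=\bigcup_{i=1}^N(Q+x_i)$, and the limit is taken as $R\to\infty$. The Epstein zeta function is $\zeta_{\mathcal{L}}(s)=\frac12\sum_{x\in\mathcal{L}\setminus\{0\}}|x|^{-s}$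 for $\mathrm{Re}(s)>d$, extended meromorphically to $\mathbb{C}$ (with a single simple pole at $s=d$); $\zeta_{\mathcal L}'$ denotes its derivative. *)

(* Defs.v *)
From mathcomp Require Import all_boot all_order all_algebra.
From mathcomp Require Import complex.
From mathcomp Require Import all_classical all_reals all_analysis.
Import Order.TTheory GRing.Theory Num.Theory.
Import numFieldNormedType.Exports.
Set Implicit Arguments. Unset Strict Implicit. Unset Printing Implicit Defensive.
Local Open Scope classical_set_scope.
Local Open Scope ring_scope.
Local Open Scope complex_scope.

Definition fderivable (K : numFieldType) (f : K -> K) (z : K) : Prop :=
  derivable f z 1.
Definition fderive (K : numFieldType) (f : K -> K) (z : K) : K := 'D_1 f z.
Definition cvg_pinfty (R : realType) (K : numFieldType) (u : R -> K) (l : K) : Prop :=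
  u @ +oo --> l.

Section JelliumDefs.
Variable R : realType.

Definition enorm (d : nat) (x : 'rV[R]_d) : R :=
  Num.sqrt (\sum_(i < d) x ord0 i ^+ 2).

(* Lebesgue integral on R^n, written as the iterated one-dimensional
   Lebesgue integral (integral over the first coordinate outermost). *)
Fixpoint lebint (n : nat) : ('rV[R]_n -> \bar R) -> \bar R :=
  match n return ('rV[R]_n -> \bar R) -> \bar R with
  | 0 => fun f => f 0
  | n'.+1 => fun f =>
      (\int[@lebesgue_measure R]_(t in [set: R])
         lebint (fun v : 'rV[R]_n' => f (row_mx (t%:M : 'rV[R]_1) v)))%E
  end.

Definition lebvol (d : nat) (A : set 'rV[R]_d) : \bar R :=
  lebint (fun x => (\1_A x : R)%:E).

Definition rieszV (s r : R) : R :=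
  if 0 < s then r `^ (- s)
  else if s == 0 then - ln r
  else - r `^ (- s).

Definition lattice (d : nat) (A : 'M[R]_d) : set 'rV[R]_d :=
  [set map_mx (fun z : int => z%:~R) k *m A | k in [set: 'rV[int]_d]].

Definition wigner_seitz (d : nat) (L : set 'rV[R]_d) : set 'rV[R]_d :=
  [set x | forall l, L l -> enorm x <= enorm (x - l)].

Definition lat_ball (d : nat) (L : set 'rV[R]_d) (r : R) : set 'rV[R]_d :=
  [set x | L x /\ enorm x < r].

Definition omegaN (d : nat) (Q S : set 'rV[R]_d) : set 'rV[R]_d :=
  [set y | exists2 x, S x & Q (y - x)].

Definition jellium_energy (d : nat) (s : R) (Om S : set 'rV[R]_d) : R :=
  2^-1 * (\sum_(x \in S) \sum_(y \in S `\ x) rieszV s (enorm (x - y)))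
  - (\sum_(x \in S)
       fine (lebint (fun y => (\1_Om y * rieszV s (enorm (x - y)))%:E)))
  + fine ((2^-1)%:E *
       lebint (fun x => lebint (fun y =>
         (\1_Om x * \1_Om y * rieszV s (enorm (x - y)))%:E)))%E.

Definition jellium_per_volume (d : nat) (s : R) (L : set 'rV[R]_d) (r : R) : R :=
  let S := lat_ball L r in
  let Om := omegaN (wigner_seitz L) S in
  jellium_energy s Om S / fine (lebvol Om).

(* complex power r^(-z) = exp(-z ln r) for r > 0 *)
Definition cpowN (r : R) (z : R[i]) : R[i] :=
  let: Complex a b := z in
  Complex (r `^ (- a) * cos (b * ln r)) (- (r `^ (- a) * sin (b * ln r))).

Definition zeta_partial (d : nat) (L : set 'rV[R]_d) (z : R[i]) (r : R) : R[i] :=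
  2^-1 * \sum_(x \in lat_ball L r `\ 0) cpowN (enorm x) z.

Definition cRe (z : R[i]) : R := let: Complex a _ := z in a.

Definition epstein_continuation (d : nat) (L : set 'rV[R]_d) (Z : R[i] -> R[i]) : Prop :=
  (forall z : R[i], z != (d%:R)%:C -> @fderivable R[i] Z z) /\
  (forall z : R[i], d%:R < cRe z ->
     @cvg_pinfty R R[i] (fun r : R => zeta_partial L z r) (Z z)).

End JelliumDefs.

(* Main.v *)
(* Let Q be the Wigner-Seitz cell, T f (x) the average of f over x - Q and D = 1 - T.
   The translates of Q tile space, so the energy of the points of S in their cells is
   1/2 sum_(x, y in S) (D^2 V)(x - y).  As Q is symmetric, D gains a factor |x|^-2 on
   functions of homogeneous type; hence D^2 V is summable over the lattice for
   s > d - 4, and the energy per volume tends to 1/2 sum_l (D^2 V)(l) by dominated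
   convergence.  For integrable h and k >= 1 the tiling also gives
   sum_l (D^k h)(l) = sum_l h(l) - int h.  Let h approximate |x|^-z on |x| >= c by
   Gaussian cut-offs: sum_l (D^k (|x|^-z 1_(|x| >= c)))(l) does not depend on k.  It is
   holomorphic for Re z > d - 2k and, if Re z > d, equals 2 zeta(z) minus the integral of
   |x|^-z over |x| >= c, which is meromorphic in z with one pole at d.  This is the
   continuation of zeta.  For Re z < d the polar term is minus the integral of |x|^-z over
   |x| < c, so 2 zeta(z) = sum_l (D^k |x|^-z)(l); take k = 2 and z = s, or differentiate at
   z = 0, where |x|^-z has derivative - log |x|. *)
Require Import Defs.
From HB Require Import structures.
From mathcomp Require Import all_boot all_order all_algebra.
From mathcomp Require Import complex.
From mathcomp Require Import all_classical all_reals all_analysis.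
From mathcomp Require Import measurable_realfun zify ring lra.
Import Order.TTheory GRing.Theory Num.Theory.
Import numFieldNormedType.Exports.
Set Implicit Arguments. Unset Strict Implicit. Unset Printing Implicit Defensive.
Local Open Scope classical_set_scope.
Local Open Scope ring_scope.

(** * Lebesgue measure on row vectors *)

(** For Re z <= d the function |x|^-z is not integrable at infinity, so the tiling identity cannot
    be applied to it. It is applied to cut-off functions, where its right-hand side does not mention
    k, and the limit is taken on the left. This needs bounds on D^k that are uniform over the
    cut-offs. They come from writing radial functions as g(ln |x|): if g and its derivatives in u =
    ln |x| are bounded by C e^(-a u + delta |u|), each derivative in x gains 1/|x|, with a constant
    linear in C. Powers, logarithms, Gaussian cut-offs and Taylor remainders in z all have this
    form, so one domination lemma yields summability, limits and holomorphy. The slack delta absorbs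
    factors ln |x| and small changes of the exponent. The cut at c may be sharp, since summability
    only depends on what happens far away; c is at most the length of the shortest nonzero lattice
    vector, so the cut loses no lattice point but 0. The factor |x|^-2 per D is that of the second
    difference 2 f(x) - f(x + y) - f(x - y), half of whose average over y in Q is D f(x). *)

Section RowMeasurable.
Variables (R : realType) (n : nat).

Let coors : 'I_n -> 'rV[R]_n -> measurableTypeR R := fun i x => x ord0 i.

Let row_set0 : g_sigma_preimage coors set0.
Proof. exact: sigma_algebra0. Qed.

Let row_setC A : g_sigma_preimage coors A -> g_sigma_preimage coors (~` A).
Proof. exact: sigma_algebraC. Qed.

Let row_bigcup (F : _^nat) : (forall i, g_sigma_preimage coors (F i)) ->
  g_sigma_preimage coors (\bigcup_i (F i)).
Proof. exact: sigma_algebra_bigcup. Qed.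

HB.instance Definition _ := @isMeasurable.Build default_measure_display
  'rV[R]_n (g_sigma_preimage coors) row_set0 row_setC row_bigcup.

Lemma measurable_coord (i : 'I_n) :
  measurable_fun [set: 'rV[R]_n] (fun x : 'rV[R]_n => x ord0 i : R).
Proof.
move=> _ Y mY; rewrite setTI; apply: sub_sigma_algebra => /=.
rewrite -bigcup_seq/=; exists i => /=; first by rewrite mem_index_enum.
by exists Y => //; rewrite setTI.
Qed.

End RowMeasurable.

(** The sigma-algebra on rows is generated by the coordinates, so preimages of generators
    suffice. *)
Lemma measurable_rowP (R : realType) d (T : measurableType d) n (f : T -> 'rV[R]_n) :
  (forall i, measurable_fun setT (fun x => f x ord0 i : R)) -> measurable_fun setT f.
Proof.
move=> mf _ A mA; rewrite setTI.
have : g_sigma_preimage (fun i x => f x ord0 i : measurableTypeR R) `<=` measurable.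
  apply: smallest_sub; first exact: sigma_algebra_measurable.
  case: n f mf {A mA} => [|m] f mf; first by rewrite big_ord0.
  rewrite -bigcup_mkord_ord; apply: bigcup_sub => i Ii.
  by move=> A [B mB <-]; exact: mf.
apply; rewrite (g_sigma_preimage_comp (fun (i : 'I_n) (x : 'rV[R]_n) => x ord0 i : measurableTypeR R) f).
by exists A => //; rewrite setTI.
Qed.

Section Leb.
Variable R : realType.
Local Notation leb1 := (@lebesgue_measure R).

(** The new coordinate goes in front, in the shape used by [lebint], so that integrals for [leb] and
    iterated integrals unfold in the same way. *)
Definition rcons0 n (p : measurableTypeR R * 'rV[R]_n) : 'rV[R]_n.+1 :=
  row_mx ((p.1 : R)%:M : 'rV_1) p.2.

Lemma rcons0_0 n p : @rcons0 n p ord0 ord0 = p.1.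
Proof.
rewrite /rcons0; have -> : ord0 = lshift n (ord0 : 'I_1) by apply/val_inj.
by rewrite [LHS](row_mxEl _ _ ord0 (ord0 : 'I_1)) mxE eqxx mulr1n.
Qed.

Lemma rcons0_S n p (i : 'I_n) : @rcons0 n p ord0 (lift ord0 i) = p.2 ord0 i.
Proof.
rewrite /rcons0; have -> : lift ord0 i = rshift 1 i by apply/val_inj.
by rewrite [LHS](row_mxEr _ _ ord0 i).
Qed.

Lemma measurable_rcons0 n : measurable_fun setT (@rcons0 n).
Proof.
apply: measurable_rowP => i; case: (unliftP ord0 i) => [j ->|->].
  under eq_fun do rewrite rcons0_S.
  apply: (measurableT_comp (measurable_coord j)); exact: measurable_snd.
under eq_fun do rewrite rcons0_0.
exact: measurable_fst.
Qed.

Definition runcons n (x : 'rV[R]_n.+1) : measurableTypeR R * 'rV[R]_n :=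
  (x ord0 ord0, \row_j x ord0 (lift ord0 j)).

Lemma rcons0K n : cancel (@rcons0 n) (@runcons n).
Proof.
move=> [t v]; rewrite /runcons rcons0_0; congr pair.
by apply/rowP => j; rewrite mxE rcons0_S.
Qed.

Lemma measurable_runcons n : measurable_fun setT (@runcons n).
Proof.
apply: measurable_fun_pair; first exact: (measurable_coord ord0).
apply: measurable_rowP => i; under eq_fun do rewrite mxE.
exact: measurable_coord.
Qed.

Section step.
Variables (n : nat) (m : {sigma_finite_measure set 'rV[R]_n -> \bar R}).

Definition leb_step : set 'rV[R]_n.+1 -> \bar R :=
  pushforward (leb1 \x m)%E (@rcons0 n).

Let mrc : measurable_fun setT (@rcons0 n) := @measurable_rcons0 n.
HB.instance Definition _ := isMeasurableFun.Build _ _ _ _ (@rcons0 n) mrc.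

Let leb_step0 : leb_step set0 = 0%E.
Proof. exact: (measure0 (pushforward (leb1 \x m)%E (@rcons0 n))). Qed.

Let leb_step_ge0 A : (0 <= leb_step A)%E.
Proof. exact: (measure_ge0 (pushforward (leb1 \x m)%E (@rcons0 n))). Qed.

Let leb_step_sigma_additive : semi_sigma_additive leb_step.
Proof.
exact: (@measure_semi_sigma_additive _ _ _ (pushforward (leb1 \x m)%E (@rcons0 n))).
Qed.

HB.instance Definition _ := isMeasure.Build _ _ _ leb_step
  leb_step0 leb_step_ge0 leb_step_sigma_additive.

Let leb_step_sigma_finite : sigma_finite setT leb_step.
Proof.
have /sigma_finiteP[F [TF ndF Foo]] := sigma_finiteT leb1.
have /sigma_finiteP[G [TG ndG Goo]] := sigma_finiteT m.
exists (fun k => @runcons n @^-1` (F k `*` G k)).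
  rewrite -preimage_bigcup (_ : \bigcup_i _ = setT) ?preimage_setT//.
  rewrite -subTset => -[x y] _.
  have [i _ Fx] : (\bigcup_i F i) x by rewrite -TF.
  have [j _ Gy] : (\bigcup_i G i) y by rewrite -TG.
  exists (maxn i j) => //; split.
    by move: x Fx; exact/subsetPset/ndF/leq_maxl.
  by move: y Gy; exact/subsetPset/ndG/leq_maxr.
move=> k; have [mF F1] := Foo k; have [mG G1] := Goo k.
have mFG : measurable (F k `*` G k) by exact: measurableX.
split.
  by rewrite -[X in measurable X]setTI; exact: (measurable_runcons measurableT).
rewrite /leb_step /pushforward.
have -> : @rcons0 n @^-1` (@runcons n @^-1` (F k `*` G k)) = F k `*` G k.
  by apply/funext => p; rewrite /preimage /mkset rcons0K.
by rewrite product_measure1E// lte_mul_pinfty// ge0_fin_numE.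
Qed.

HB.instance Definition _ := Measure_isSigmaFinite.Build _ _ _ leb_step leb_step_sigma_finite.
Definition leb_stepM : {sigma_finite_measure set 'rV[R]_n.+1 -> \bar R} := leb_step.
End step.

Definition dirac0 : {sigma_finite_measure set 'rV[R]_0 -> \bar R} := dirac (0 : 'rV[R]_0).

Fixpoint leb n : {sigma_finite_measure set 'rV[R]_n -> \bar R} :=
  match n with 0%N => dirac0 | n'.+1 => leb_stepM (leb n') end.

End Leb.

Section Lebint.
Variable R : realType.
Local Notation leb1 := (@lebesgue_measure R).
Local Open Scope ereal_scope.

Lemma ge0_integral_lebS n (f : 'rV[R]_n.+1 -> \bar R) :
  measurable_fun setT f -> (forall x, 0 <= f x) ->
  \int[leb R n.+1]_x f x = \int[leb1]_t \int[leb R n]_v f (rcons0 (t, v)).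
Proof.
move=> mf f0.
have -> : \int[leb R n.+1]_x f x = \int[pushforward (leb1 \x leb R n) (@rcons0 R n)]_x f x by [].
rewrite (ge0_integral_pushforward (@measurable_rcons0 R n))// preimage_setT.
by rewrite fubini_tonelli1// => [|x]; [exact: measurableT_comp mf (@measurable_rcons0 R n)|exact: f0].
Qed.

Lemma ge0_integral_lebS2 n (f : 'rV[R]_n.+1 -> \bar R) :
  measurable_fun setT f -> (forall x, 0 <= f x) ->
  \int[leb R n.+1]_x f x = \int[leb R n]_v \int[leb1]_t f (rcons0 (t, v)).
Proof.
move=> mf f0.
have -> : \int[leb R n.+1]_x f x = \int[pushforward (leb1 \x leb R n) (@rcons0 R n)]_x f x by [].
rewrite (ge0_integral_pushforward (@measurable_rcons0 R n))// preimage_setT.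
by rewrite fubini_tonelli2// => [|x]; [exact: measurableT_comp mf (@measurable_rcons0 R n)|exact: f0].
Qed.

Lemma lebintS n (f : 'rV[R]_n.+1 -> \bar R) :
  lebint f = \int[leb1]_t lebint (fun v => f (rcons0 (t, v))).
Proof. by []. Qed.

Lemma lebint_ge0E n (f : 'rV[R]_n -> \bar R) :
  measurable_fun setT f -> (forall x, 0 <= f x) ->
  lebint f = \int[leb R n]_x f x.
Proof.
elim: n f => [|n IH] f mf f0.
  rewrite [RHS](_ : _ = \int[dirac (0%R : 'rV[R]_0)]_x f x)//.
  by rewrite integral_dirac// diracT mul1e.
rewrite lebintS ge0_integral_lebS//; apply: eq_integral => t _.
apply: IH => //; apply: measurableT_comp => //.
apply: measurableT_comp; first exact: measurable_rcons0.
exact: measurable_pair1.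
Qed.

(** No sign or integrability is assumed of [F]: the integral is the difference of those of the
    positive and negative parts, each measurable by Tonelli. [lebint_integrable] needs this, as
    exceptional sections of an integrable function may fail to be integrable. *)
Lemma measurable_lebint d (T : measurableType d) n (F : T * 'rV[R]_n -> \bar R) :
  measurable_fun setT F -> measurable_fun setT (fun x => lebint (fun v => F (x, v))).
Proof.
elim: n d T F => [|n IH] d T F mF.
  apply: measurableT_comp mF _; exact: measurable_pair2.
pose G (p : (T * measurableTypeR R)%type) := lebint (fun v => F (p.1, rcons0 (p.2, v))).
have mG : measurable_fun setT G.
  apply: (IH _ _ (fun q : (T * measurableTypeR R) * 'rV[R]_n => F (q.1.1, rcons0 (q.1.2, q.2)))).
  apply: measurableT_comp mF _; apply: measurable_fun_pair.
    by apply: measurableT_comp; [exact: measurable_fst|exact: measurable_fst].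
  apply: measurableT_comp; first exact: measurable_rcons0.
  apply: measurable_fun_pair => //.
  by apply: measurableT_comp; [exact: measurable_snd|exact: measurable_fst].
rewrite (_ : (fun x => _) = (fun x => \int[leb1]_t (G^\+ (x, t)) - \int[leb1]_t (G^\- (x, t)))).
  apply: emeasurable_funB.
    apply: (measurable_fun_fubini_tonelli_F (m2 := leb1) (G^\+)) => //.
    exact: measurable_funepos.
  apply: (measurable_fun_fubini_tonelli_F (m2 := leb1) (G^\-)) => //.
  exact: measurable_funeneg.
apply/funext => x; rewrite lebintS integralE.
congr (_ - _); apply: eq_integral => t _.
  by rewrite /G /= !funeposE.
by rewrite /G /= !funenegE.
Qed.

Lemma lebint_integrable n (f : 'rV[R]_n -> \bar R) :
  (leb R n).-integrable setT f -> lebint f = \int[leb R n]_x f x.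
Proof.
elim: n f => [|n IH] f fi.
  rewrite [RHS](_ : _ = \int[dirac (0%R : 'rV[R]_0)]_x f x)//.
  by rewrite integral_dirac ?diracT ?mul1e//; exact: measurable_int fi.
have mf := measurable_int _ fi.
have mr := @measurable_rcons0 R n.
have mg : measurable_fun setT (f \o @rcons0 R n) by exact: measurableT_comp.
have gi : (leb1 \x leb R n).-integrable setT (f \o @rcons0 R n).
  apply/integrableP; split => //.
  move/integrableP : fi => [_].
  rewrite (_ : \int[_]_(x in setT) `|f x| = \int[pushforward (leb1 \x leb R n) (@rcons0 R n)]_x `|f x|)//.
  rewrite (ge0_integral_pushforward mr)// ?preimage_setT//.
  exact: measurableT_comp.
have -> : \int[leb R n.+1]_x f x = \int[pushforward (leb1 \x leb R n) (@rcons0 R n)]_x f x by [].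
rewrite (integral_pushforward mr)// ?preimage_setT//.
rewrite -integral12_prod_meas1// lebintS.
apply: ae_eq_integral => //.
- apply: (measurable_lebint (F := fun q : measurableTypeR R * 'rV[R]_n => f (rcons0 q))).
  exact: mg.
- exact: (measurable_fubini_F gi).
- have := ae_integrable1 gi; apply: filterS => t /= ti _.
  by rewrite IH.
Qed.

End Lebint.

(** * Affine changes of variables *)

Section Affine.
Variable R : realType.
Local Notation leb1 := (@lebesgue_measure R).

Section affine1.
Variables (r c : R).
Hypothesis r0 : 0 < r.

Let aff (t : measurableTypeR R) : measurableTypeR R := r * t + c.

Let maff : measurable_fun setT aff.
Proof. by apply: measurable_funD => //; apply: measurable_funM. Qed.

Let pm : {measure set (measurableTypeR R) -> \bar R} :=
  measure_function_pushforward__canonical__measure_function_Measure leb1 maff.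

(** The rescaled pushforward agrees with Lebesgue measure on half-open intervals, which determine
    it. *)
Let leb1_affine A : measurable A ->
  leb1 A = mscale (NngNum (ltW r0)) pm A.
Proof.
move=> mA; apply: lebesgue_measure_unique => //= _ [[a b]] _ <-.
rewrite /mscale/= /pushforward.
have -> : aff @^-1` `]a, b]%classic = `](a - c) / r, (b - c) / r]%classic.
  apply/seteqP; split => t /=; rewrite !in_itv/= /aff;
    by rewrite ltr_pdivrMr// ler_pdivlMr// ltrBlDr lerBrDr mulrC.
rewrite !lebesgue_measure_itv/= !lte_fin.
rewrite ltr_pM2r ?invr_gt0// ltrD2r; case: ifPn => _; last by rewrite mule0.
by rewrite -!EFinB -EFinM -mulrBl mulrCA divff ?gt_eqF// mulr1; congr EFin; lra.
Qed.

Lemma ge0_integral_affine1 (f : R -> \bar R) :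
  measurable_fun [set: measurableTypeR R] f -> (forall t, (0 <= f t)%E) ->
  (\int[leb1]_t f t = r%:E * \int[leb1]_t f (r * t + c)%R)%E.
Proof.
move=> mf f0.
rewrite (eq_measure_integral (mscale (NngNum (ltW r0)) pm)); last first.
  by move=> A mA _; exact: leb1_affine.
rewrite ge0_integral_mscale//=; congr *%E.
exact: (ge0_integral_pushforward maff).
Qed.
End affine1.

Lemma ge0_integral_opp1 (f : R -> \bar R) :
  measurable_fun [set: measurableTypeR R] f -> (forall t, (0 <= f t)%E) ->
  (\int[leb1]_t f t = \int[leb1]_t f (- t)%R)%E.
Proof.
move=> mf f0.
have mN : measurable_fun setT (-%R : measurableTypeR R -> measurableTypeR R).
  exact: oppr_measurable.
rewrite -[RHS](@ge0_integral_pushforward _ _ _ _ _ _ mN leb1 setT f)//.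
by apply: eq_measure_integral => //= A mA _; exact/esym/lebesgue_measureN.
Qed.

(** One induction serves dilations with translation ([k = r]) and reflections ([k = 1]): both act on
    each coordinate separately, with the same Jacobian factor for each. *)
Lemma ge0_integral_coordwise (k : R) n (phi : 'I_n -> measurableTypeR R -> measurableTypeR R)
    (f : 'rV[R]_n -> \bar R) :
  0 <= k -> (forall i, measurable_fun setT (phi i)) ->
  (forall i (g : R -> \bar R), measurable_fun [set: measurableTypeR R] g ->
     (forall t, (0 <= g t)%E) ->
     (\int[leb1]_t g t = k%:E * \int[leb1]_t g (phi i t))%E) ->
  measurable_fun setT f -> (forall x, (0 <= f x)%E) ->
  (\int[leb R n]_x f x =
   (k ^+ n)%:E * \int[leb R n]_x f (\row_i phi i (x ord0 i)))%E.
Proof.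
move=> k0; elim: n phi f => [|n IH] phi f mphi hphi mf f0.
  rewrite expr0 mul1e; apply: eq_integral => x _; congr f.
  by apply/rowP => -[].
have mrow m (ps : 'I_m -> measurableTypeR R -> measurableTypeR R) :
    (forall i, measurable_fun setT (ps i)) ->
    measurable_fun setT (fun x : 'rV[R]_m => \row_i (ps i (x ord0 i) : R)).
  move=> mps; apply: measurable_rowP => i.
  under eq_fun do rewrite mxE.
  apply: (measurableT_comp (mps i)); exact: measurable_coord.
rewrite ge0_integral_lebS// ge0_integral_lebS//; last first.
  by apply: (measurableT_comp mf); exact: mrow.
have mfr : measurable_fun setT (f \o @rcons0 R n).
  exact: measurableT_comp mf (@measurable_rcons0 R n).
pose G t := (\int[leb R n]_v f (rcons0 (t, v)))%E.
have mG : measurable_fun setT G.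
  apply: (measurable_fun_fubini_tonelli_F (m2 := leb R n) (f \o @rcons0 R n)) => // x.
  exact: f0.
have G0 t : (0 <= G t)%E by apply: integral_ge0.
rewrite (hphi ord0 G mG G0) exprS EFinM -muleA; congr (_ * _)%E.
rewrite -ge0_integralZl//; last 3 first.
- apply: (measurable_fun_fubini_tonelli_F (m2 := leb R n)
    (fun q => f (\row_i phi i ((@rcons0 R n q) ord0 i)))) => [|x]; last exact: f0.
  apply: (measurableT_comp mf); apply: (measurableT_comp (mrow _ _ mphi)).
  exact: measurable_rcons0.
- by move=> t _; apply: integral_ge0.
- by rewrite lee_fin exprn_ge0.
apply: eq_integral => t _; rewrite /G.
rewrite (IH _ (fun v => f (rcons0 (phi ord0 t, v))) (fun i => mphi (lift ord0 i))
  (fun i => hphi (lift ord0 i)))//; last first.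
  exact: measurableT_comp mfr (measurable_pair1 _).
congr (_ * _)%E; apply: eq_integral => v _; congr f.
apply/rowP => i; rewrite [RHS]mxE; case: (unliftP ord0 i) => [j ->|->].
  by rewrite !rcons0_S/= mxE.
by rewrite !rcons0_0.
Qed.

Lemma ge0_integral_affine n (r : R) (c : 'rV[R]_n) (f : 'rV[R]_n -> \bar R) : 0 < r ->
  measurable_fun setT f -> (forall x, (0 <= f x)%E) ->
  (\int[leb R n]_x f x = (r ^+ n)%:E * \int[leb R n]_x f (r *: x + c)%R)%E.
Proof.
move=> r0 mf f0.
rewrite (@ge0_integral_coordwise r _ (fun i t => r * t + c ord0 i))//; last 3 first.
- exact: ltW.
- by move=> i; apply: measurable_funD => //; apply: measurable_funM.
- by move=> i g mg g0; exact: ge0_integral_affine1.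
congr (_ * _)%E; apply: eq_integral => x _; congr f.
by apply/rowP => i; rewrite !mxE.
Qed.

Lemma ge0_integral_opp n (f : 'rV[R]_n -> \bar R) :
  measurable_fun setT f -> (forall x, (0 <= f x)%E) ->
  (\int[leb R n]_x f x = \int[leb R n]_x f (- x)%R)%E.
Proof.
move=> mf f0.
rewrite (@ge0_integral_coordwise 1 _ (fun i t => - t))//; last 2 first.
- by move=> i; exact: oppr_measurable.
- by move=> i g mg g0; rewrite mul1e; exact: ge0_integral_opp1.
rewrite expr1n mul1e; apply: eq_integral => x _; congr f.
by apply/rowP => i; rewrite !mxE.
Qed.

End Affine.

(** * Euclidean norm, lattices and Wigner-Seitz cells *)

Section Euclid.
Variables (R : realType) (n : nat).
Implicit Types x y z : 'rV[R]_n.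

Definition dot x y : R := \sum_i x ord0 i * y ord0 i.

Lemma dotC x y : dot x y = dot y x.
Proof. by apply: eq_bigr => i _; rewrite mulrC. Qed.

Lemma dotDl x y z : dot (x + y) z = dot x z + dot y z.
Proof. by rewrite -big_split/=; apply: eq_bigr => i _; rewrite mxE mulrDl. Qed.

Lemma dotZl a x y : dot (a *: x) y = a * dot x y.
Proof. by rewrite mulr_sumr; apply: eq_bigr => i _; rewrite mxE mulrA. Qed.

Lemma dotNl x y : dot (- x) y = - dot x y.
Proof. by rewrite -scaleN1r dotZl mulN1r. Qed.

Lemma dotDr x y z : dot x (y + z) = dot x y + dot x z.
Proof. by rewrite dotC dotDl !(dotC _ x). Qed.

Lemma dotZr a x y : dot x (a *: y) = a * dot x y.
Proof. by rewrite dotC dotZl dotC. Qed.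

Lemma dotNr x y : dot x (- y) = - dot x y.
Proof. by rewrite dotC dotNl dotC. Qed.

Lemma dot_ge0 x : 0 <= dot x x.
Proof. by apply: sumr_ge0 => i _; rewrite -expr2 sqr_ge0. Qed.

Lemma enormE x : enorm x = Num.sqrt (dot x x).
Proof. by congr Num.sqrt; apply: eq_bigr => i _; rewrite expr2. Qed.

Lemma sqr_enorm x : enorm x ^+ 2 = dot x x.
Proof. by rewrite enormE sqr_sqrtr// dot_ge0. Qed.

Lemma enorm_ge0 x : 0 <= enorm x. Proof. exact: sqrtr_ge0. Qed.

Lemma enorm0 : enorm (0 : 'rV[R]_n) = 0.
Proof. by rewrite /enorm big1 ?sqrtr0// => i _; rewrite mxE expr0n. Qed.

Lemma enorm_eq0 x : (enorm x == 0) = (x == 0).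
Proof.
apply/idP/eqP => [|->]; last by rewrite enorm0.
rewrite /enorm sqrtr_eq0 => h.
have h0 : \sum_(i < n) x ord0 i ^+ 2 == 0.
  by rewrite eq_le h/= sumr_ge0// => i _; rewrite sqr_ge0.
apply/rowP => i; rewrite mxE.
move: h0; rewrite psumr_eq0 => [/allP/(_ i)|j _]; last by rewrite sqr_ge0.
by rewrite mem_index_enum sqrf_eq0 => /(_ isT)/eqP.
Qed.

Lemma enorm_gt0 x : (0 < enorm x) = (x != 0).
Proof. by rewrite lt0r enorm_eq0 enorm_ge0 andbT. Qed.

Lemma enormN x : enorm (- x) = enorm x.
Proof. by rewrite !enormE dotNl dotNr opprK. Qed.

Lemma enormZ a x : enorm (a *: x) = `|a| * enorm x.
Proof.
rewrite !enormE dotZl dotZr mulrA -expr2 sqrtrM ?sqr_ge0//.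
by rewrite sqrtr_sqr.
Qed.

Lemma enorm_distC x y : enorm (x - y) = enorm (y - x).
Proof. by rewrite -enormN opprB. Qed.

(** Cauchy-Schwarz, by expanding the square of [(y.y) x - (x.y) y]. *)
Lemma sqr_dot_le x y : dot x y ^+ 2 <= dot x x * dot y y.
Proof.
have [->|y0] := eqVneq y 0.
  by rewrite -(scale0r (0 : 'rV[R]_n)) !dotZr !mul0r mulr0 expr0n.
have yy : 0 < dot y y by rewrite -sqr_enorm exprn_gt0// enorm_gt0.
have := dot_ge0 (dot y y *: x - dot x y *: y).
rewrite !(dotDl, dotDr, dotNl, dotNr, dotZl, dotZr) (dotC y x) => h.
rewrite -subr_ge0 -(pmulr_rge0 _ yy); apply: le_trans h _.
by rewrite le_eqVlt; apply/orP; left; apply/eqP; ring.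
Qed.

Lemma normr_dot_le x y : `|dot x y| <= enorm x * enorm y.
Proof.
rewrite !enormE -sqrtrM ?dot_ge0// -sqrtr_sqr ler_sqrt ?sqr_dot_le//.
by rewrite mulr_ge0// dot_ge0.
Qed.

Lemma enormD x y : enorm (x + y) <= enorm x + enorm y.
Proof.
rewrite -(ler_pXn2r (n := 2))// ?nnegrE ?addr_ge0 ?enorm_ge0//.
rewrite sqr_enorm dotDl !dotDr sqrrD !sqr_enorm (dotC y x).
have := le_trans (ler_norm _) (normr_dot_le x y); lra.
Qed.

Lemma enormB x y : enorm (x - y) <= enorm x + enorm y.
Proof. by rewrite -(enormN y) enormD. Qed.

Lemma enorm_tri x y z : enorm (x - z) <= enorm (x - y) + enorm (y - z).
Proof. by rewrite (_ : x - z = (x - y) + (y - z)) ?enormD// addrA subrK. Qed.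

Lemma ler_enormB x y : enorm x - enorm y <= enorm (x - y).
Proof. by rewrite lerBlDr -[X in enorm X <= _](subrK y) enormD. Qed.

Lemma coord_le_enorm x i : `|x ord0 i| <= enorm x.
Proof.
rewrite -sqrtr_sqr ler_sqrt ?sumr_ge0// => [|j _]; last by rewrite sqr_ge0.
by rewrite (bigD1 i)//= lerDl sumr_ge0// => j _; rewrite sqr_ge0.
Qed.

Lemma enorm_le_sum x : enorm x <= \sum_i `|x ord0 i|.
Proof.
rewrite -(ger0_norm (sumr_ge0 _ (fun i _ => normr_ge0 (x ord0 i)))) -sqrtr_sqr.
rewrite ler_sqrt ?sqr_ge0// expr2 mulr_sumr; apply: ler_sum => i _.
rewrite -real_normK ?num_real// expr2 ler_wpM2r//.
by rewrite (bigD1 i)//= lerDl sumr_ge0.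
Qed.

Lemma measurable_dot c : measurable_fun setT (fun x => dot c x).
Proof.
apply: measurable_sum => i; apply: measurable_funM => //.
exact: measurable_coord.
Qed.

Lemma measurable_enorm : measurable_fun setT (@enorm R n).
Proof.
apply: (@measurableT_comp _ _ _ _ _ _ (@Num.sqrt R)).
  by apply: continuous_measurable_fun => x; exact: sqrt_continuous.
apply: measurable_sum => i; apply: measurable_funX.
exact: measurable_coord.
Qed.

End Euclid.

Section Algebra.
Variables (R : realType).

Lemma measurable_rowD d (T : measurableType d) n (f g : T -> 'rV[R]_n) :
  measurable_fun setT f -> measurable_fun setT g ->
  measurable_fun setT (fun x => f x + g x).
Proof.
move=> mf mg; apply: measurable_rowP => i; under eq_fun do rewrite mxE.
by apply: measurable_funD; apply: (measurableT_comp (measurable_coord i)).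
Qed.

Lemma measurable_rowN d (T : measurableType d) n (f : T -> 'rV[R]_n) :
  measurable_fun setT f -> measurable_fun setT (fun x => - f x).
Proof.
move=> mf; apply: measurable_rowP => i; under eq_fun do rewrite mxE.
by apply: (@measurable_funN _ _ _ setT); apply: (measurableT_comp (measurable_coord i)).
Qed.

Lemma measurable_rowZ d (T : measurableType d) n (a : R) (f : T -> 'rV[R]_n) :
  measurable_fun setT f -> measurable_fun setT (fun x => a *: f x).
Proof.
move=> mf; apply: measurable_rowP => i; under eq_fun do rewrite mxE.
by apply: measurable_funM => //; apply: (measurableT_comp (measurable_coord i)).
Qed.

End Algebra.

Lemma indic_iff (R : realType) (T U : Type) (A : set T) (B : set U) x y :
  (A x <-> B y) -> \1_A x = \1_B y :> R.
Proof.
by move=> AB; rewrite !indicE; congr (_%:R); congr nat_of_bool; apply/idP/idP;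
  rewrite !in_setE; apply AB.
Qed.

Lemma measurable_EFin_indic (R : realType) d (T : measurableType d) (A : set T) :
  measurable A -> measurable_fun setT (fun x => (\1_A x : R)%:E).
Proof. by move=> mA; apply/measurable_EFinP; exact: measurable_indic. Qed.

Lemma measurable_set_lt (R : realType) d (T : measurableType d) (f : T -> R) r :
  measurable_fun setT f -> measurable [set x | f x < r].
Proof.
move=> mf; rewrite (_ : [set x | _] = setT `&` f @^-1` `]-oo, r[%classic).
  exact: mf.
by rewrite setTI; apply/seteqP; split => x /=; rewrite in_itv.
Qed.

Lemma measurable_set_le (R : realType) d (T : measurableType d) (f : T -> R) r :
  measurable_fun setT f -> measurable [set x | f x <= r].
Proof.
move=> mf; rewrite (_ : [set x | _] = setT `&` f @^-1` `]-oo, r]%classic).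
  exact: mf.
by rewrite setTI; apply/seteqP; split => x /=; rewrite in_itv.
Qed.

(** * Null hyperplanes and volumes of balls *)

Section NullSets.
Variable R : realType.
Local Notation leb1 := (@lebesgue_measure R).

Lemma measurable_hyperplane n (c : 'rV[R]_n) b : measurable [set x | dot c x = b].
Proof.
have := measurable_dot c measurableT (measurable_set1 b).
by rewrite setTI.
Qed.

Lemma dot_rcons0 n (c : 'rV[R]_n.+1) t v :
  dot c (rcons0 (t, v)) = c ord0 ord0 * t + dot (\row_j c ord0 (lift ord0 j)) v.
Proof.
rewrite /dot big_ord_recl rcons0_0; congr (_ + _).
by apply: eq_bigr => i _; rewrite rcons0_S mxE.
Qed.

(** Slice along the first coordinate: if its coefficient vanishes, the slice is a hyperplane of
    lower dimension; otherwise each line in that direction meets the hyperplane in one point. *)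
Lemma leb_hyperplane n (c : 'rV[R]_n) b : c != 0 -> leb R n [set x | dot c x = b] = 0%E.
Proof.
elim: n c b => [|n IH] c b c0; first by case/eqP: c0; apply/rowP => -[].
set A := [set x | _].
have mA : measurable A := measurable_hyperplane c b.
have m1 : measurable_fun setT (fun x => (\1_A x : R)%:E).
  exact: measurable_EFin_indic.

rewrite -(setIT A) -integral_indic//.
have [cz|cnz] := eqVneq (c ord0 ord0) 0.
  rewrite ge0_integral_lebS//; apply: integral0_eq => t _.
  pose c' := \row_j c ord0 (lift ord0 j).
  have c'0 : c' != 0.
    apply: contra c0 => /eqP/rowP c'0; apply/eqP/rowP => i; rewrite mxE.
    case: (unliftP ord0 i) => [j ->|->//].
    by have := c'0 j; rewrite !mxE.
  rewrite -[RHS](IH c' b c'0) -[in RHS](setIT [set x | _]) -integral_indic//; last exact: measurable_hyperplane.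
  apply: eq_integral => v _; congr EFin; apply: indic_iff.
  by rewrite /A /= dot_rcons0 cz mul0r add0r.
rewrite ge0_integral_lebS2//; apply: integral0_eq => v _.
pose k := (b - dot (\row_j c ord0 (lift ord0 j)) v) / c ord0 ord0.
rewrite -[RHS](lebesgue_measure_set1 k) -[in RHS](setIT [set k]) -integral_indic//.
apply: eq_integral => t _; congr EFin; apply: indic_iff.
rewrite /A /= dot_rcons0 /k; split=> [<-|->].
  by rewrite addrK mulrAC divff// mul1r.
by rewrite mulrC divfK// subrK.
Qed.

Definition cube n (r : R) : set 'rV[R]_n := [set x | forall i, `|x ord0 i| <= r].

Arguments cube n r : clear implicits.

Lemma measurable_cube n r : measurable (cube n r).
Proof.
have -> : cube n r = \bigcap_(i in [set: 'I_n]) [set x | `|x ord0 i| <= r].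
  by apply/seteqP; split=> x h i => [_|]; exact: h.
apply: fin_bigcap_measurable => // i _.
apply: measurable_set_le; apply: (measurableT_comp (@normr_measurable R setT)).
exact: measurable_coord.
Qed.

Lemma leb_cube_lty n r : (leb R n (cube n r) < +oo)%E.
Proof.
elim: n => [|n IH].
  have -> : leb R 0 (cube 0 r) = dirac (0 : 'rV[R]_0) (cube 0 r) by [].
  by rewrite diracE ltry.
rewrite -(setIT (cube _ _)) -integral_indic//; last exact: measurable_cube.
rewrite ge0_integral_lebS//; last first.
  by apply: measurable_EFin_indic; exact: measurable_cube.
have -> : (\int[leb1]_t \int[leb R n]_v (\1_(cube n.+1 r) (rcons0 (t, v)))%:E =
  \int[leb1]_t ((\1_(`[- r, r]%classic : set R) t)%:E * leb R n (cube n r)))%E.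
  apply: eq_integral => t _.
  rewrite -(setIT (cube n r)) -integral_indic//; last exact: measurable_cube.
  rewrite -ge0_integralZl//; last first.
    by apply: measurable_EFin_indic; exact: measurable_cube.
  apply: eq_integral => v _; rewrite -EFinM; congr EFin.
  rewrite !indicE -natrM mulnb; congr (_%:R); congr nat_of_bool.
  apply/idP/andP => [|[]]; rewrite !in_setE /cube/= in_itv/=.
    move=> h; split; first by have := h ord0; rewrite rcons0_0 ler_norml.
    by move=> i; have := h (lift ord0 i); rewrite rcons0_S.
  move=> h1 h2 i; case: (unliftP ord0 i) => [j ->|->]; first by rewrite rcons0_S.
  by rewrite rcons0_0 ler_norml.
rewrite ge0_integralZr//; last exact: measurable_EFin_indic.
rewrite integral_indic// setIT lte_mul_pinfty//.
have : leb1 `[- r, r]%classic \is a fin_num.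
  by rewrite lebesgue_measure_itv/=; case: ifPn => // _; rewrite -EFinB.
by [].
Qed.

Definition eball n (r : R) : set 'rV[R]_n := [set x | enorm x < r].

Arguments eball n r : clear implicits.

Lemma measurable_eball n r : measurable (eball n r).
Proof.
by apply: measurable_set_lt; exact: measurable_enorm.
Qed.

Lemma leb_eball_lty n r : (leb R n (eball n r) < +oo)%E.
Proof.
apply: le_lt_trans (leb_cube_lty n r).
apply: le_measure; rewrite ?inE; [exact: measurable_eball|exact: measurable_cube|].
move=> x xr i; exact: le_trans (coord_le_enorm _ _) (ltW xr).
Qed.

Definition bvol n : R := fine (leb R n (eball n 1)).

Lemma leb_eball n r : 0 < r -> leb R n (eball n r) = (r ^+ n * bvol n)%:E.
Proof.
move=> r0; rewrite EFinM /bvol fineK; last first.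
  by rewrite ge0_fin_numE// leb_eball_lty.
rewrite -(setIT (eball n r)) -integral_indic//; last exact: measurable_eball.
rewrite (@ge0_integral_affine R n r 0)//; last first.
  by apply: measurable_EFin_indic; exact: measurable_eball.
congr (_ * _)%E; rewrite -(setIT (eball n 1)) -integral_indic//; last exact: measurable_eball.
apply: eq_integral => x _; congr EFin; apply: indic_iff.
by rewrite /eball/= addr0 enormZ gtr0_norm// gtr_pMr.
Qed.

End NullSets.
Arguments cube {R} n r.
Arguments eball {R} n r.
Arguments bvol R n : clear implicits.

Lemma finite_set_argmin (R : realType) (T : eqType) (S : set T) (f : T -> R) (x0 : T) :
  finite_set S -> S x0 -> exists2 x, S x & forall y, S y -> f x <= f y.
Proof.
move=> /finite_seqP[s ->] /= x0s.
have : exists2 x, x \in s & forall y, y \in s -> f x <= f y.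
  elim: s x0 x0s => [//|a s IH] _ _.
  case: s IH => [_|b s IH].
    by exists a => [|y]; rewrite ?inE// => /eqP ->.
  have [|x xs hx] := IH b; first by rewrite inE eqxx.
  have [fax|fxa] := leP (f a) (f x).
    exists a; first by rewrite inE eqxx.
    by move=> y; rewrite inE => /predU1P[->//|/hx]; exact: le_trans.
  exists x; first by rewrite inE xs orbT.
  by move=> y; rewrite inE => /predU1P[->|/hx//]; exact: ltW.
by [].
Qed.

Section Lattice.
Variables (R : realType) (d : nat) (A : 'M[R]_d).
Hypothesis uA : A \in unitmx.
Local Notation L := (lattice A).
Local Notation Q := (wigner_seitz L).

Lemma lat0 : L 0.
Proof. by exists 0 => //; rewrite map_mx0 mul0mx. Qed.

Lemma latD x y : L x -> L y -> L (x + y).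
Proof.
move=> [k _ <-] [l _ <-]; exists (k + l) => //.
by rewrite -mulmxDl; congr mulmx; apply/rowP => i; rewrite !mxE intrD.
Qed.

Lemma latN x : L x -> L (- x).
Proof.
move=> [k _ <-]; exists (- k) => //.
by rewrite -mulNmx; congr mulmx; apply/rowP => i; rewrite !mxE intrN.
Qed.

Lemma latB x y : L x -> L y -> L (x - y).
Proof. by move=> Lx Ly; apply: latD => //; exact: latN. Qed.

(** Integer coordinates are recovered by [invmx A], so on a ball they are bounded by [|r|] times the
    sum [M] of the absolute entries of [invmx A]. *)
Lemma lat_ball_finite r : finite_set (lat_ball L r).
Proof.
pose M : R := \sum_i \sum_j `|invmx A i j|.
pose N : nat := (Num.truncn (`|r| * M)).+1.
pose h (f : {ffun 'I_d -> 'I_(N + N).+1}) : 'rV[R]_d :=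
  map_mx (fun z : int => z%:~R) (\row_i ((f i : nat)%:Z - N%:Z) : 'rV[int]_d) *m A.
apply: (@sub_finite_set _ _ (h @` setT)); last by apply: finite_image; exact: finite_finset.
move=> x [[k _ <-] xr].
set x' := map_mx _ _ *m A in xr.
have kE : map_mx (fun z : int => z%:~R) k = x' *m invmx A by rewrite /x' mulmxK.
have kb i : `|k ord0 i| <= N%:Z.
  have : `|(k ord0 i)%:~R : R| <= `|r| * M.
    have := congr1 (fun B : 'rV[R]_d => B ord0 i) kE; rewrite mxE => ->.
    rewrite mxE; apply: le_trans (ler_norm_sum _ _ _) _.
    rewrite mulr_sumr; apply: ler_sum => j _; rewrite normrM ler_pM//.
      apply: le_trans (coord_le_enorm _ _) _.
      by apply: ltW; apply: lt_le_trans xr (ler_norm r).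
    by rewrite (bigD1 i)//= lerDl sumr_ge0.
  rewrite -intr_norm => kM.
  have : (`|k ord0 i|%:~R : R) < N%:R.
    by apply: le_lt_trans kM _; rewrite /N truncnS_gt.
  by rewrite -[N%:R]/(N%:~R) ltr_int => /ltW.
have kn i : (absz (k ord0 i + N%:Z)%R < (N + N).+1)%N.
  rewrite -ltz_nat gez0_abs; last by have := kb i; lia.
  by have := kb i; lia.
exists [ffun i => Ordinal (kn i)] => //.
rewrite /h /x'; congr (map_mx _ _ *m A); apply/rowP => i; rewrite mxE ffunE /=.
by rewrite gez0_abs ?addrK//; have := kb i; lia.
Qed.

(** Rounding down the coordinates of [x] in the basis [A] moves them by at most 1, hence [x] by at
    most the sum of the absolute entries of [A]; the extra 1 makes the radius positive. *)
Lemma lat_cover : exists2 rho : R, 0 < rho & forall x, exists2 l, L l & enorm (x - l) <= rho.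
Proof.
exists (1 + \sum_j \sum_i `|A i j|).
  by rewrite ltr_pwDl// sumr_ge0// => j _; rewrite sumr_ge0.
move=> x; pose c := x *m invmx A.
pose k : 'rV[int]_d := \row_i Num.floor (c ord0 i).
exists (map_mx (fun z : int => z%:~R) k *m A); first by exists k.
have -> : x - map_mx (fun z : int => z%:~R) k *m A =
    (c - map_mx (fun z : int => z%:~R) k) *m A.
  by rewrite mulmxBl /c mulmxKV.
apply: le_trans (enorm_le_sum _) _; apply: ler_wpDl => //.
apply: ler_sum => j _; rewrite mxE; apply: le_trans (ler_norm_sum _ _ _) _.
apply: ler_sum => i _; rewrite normrM ler_piMl// !mxE.
rewrite ger0_norm ?subr_ge0 ?floor_le// lerBlDr.
rewrite addrC -[1]/(1%:~R) -intrD; exact/ltW/floorD1_gt.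
Qed.

Lemma wsN x : Q x -> Q (- x).
Proof.
move=> Qx l Ll; rewrite enormN; have := Qx _ (latN Ll).
by rewrite opprK -[x + l]opprK enormN opprD.
Qed.

(** Only finitely many lattice points lie within [rho] of [y], and at least one does, so a nearest
    one exists. *)
Lemma ws_near y : exists2 l, L l & Q (y - l).
Proof.
have [rho rho0 /(_ y)[l0 Ll0 yl0]] := lat_cover.
pose S := [set l | L l /\ enorm (y - l) <= rho].
have Sf : finite_set S.
  apply: (@sub_finite_set _ _ (lat_ball L (enorm y + rho + 1))); last exact: lat_ball_finite.
  move=> l [Ll yl]; split => //.
  have := enorm_tri l y 0; rewrite !subr0 enorm_distC; lra.
have [l [Ll _] hl] := finite_set_argmin (fun l => enorm (y - l)) Sf (conj Ll0 yl0).
exists l => // m Lm; rewrite -addrA -opprD.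
have [ylm|ylm] := leP (enorm (y - (l + m))) rho.
  by apply: hl; split => //; exact: latD.
exact: (le_trans (hl l0 (conj Ll0 yl0)) (le_trans yl0 (ltW ylm))).
Qed.

Lemma ws_bounded : exists2 rho : R, 0 < rho & forall x, Q x -> enorm x <= rho.
Proof.
have [rho rho0 h] := lat_cover; exists rho => // x Qx.
by have [l Ll xl] := h x; apply: le_trans xl; exact: Qx.
Qed.

(** An enumeration turns conditions over all lattice points into countable ones, as measurability
    requires; indices that decode to nothing give 0. *)
Definition pts (n : nat) : 'rV[R]_d :=
  if unpickle n is Some k then map_mx (fun z : int => z%:~R) (k : 'rV[int]_d) *m A else 0.

Lemma L_pts n : L (pts n).
Proof. by rewrite /pts; case: unpickle => [k|]; [exists k|exact: lat0]. Qed.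

Lemma pts_surj l : L l -> exists n, pts n = l.
Proof. by move=> [k _ <-]; exists (pickle k); rewrite /pts pickleK. Qed.

Lemma measurable_ws : measurable Q.
Proof.
have -> : Q = \bigcap_n [set x | enorm x - enorm (x - pts n) <= 0].
  apply/seteqP; split => [x Qx n _ /=|x h l /pts_surj[n <-]].
    by rewrite subr_le0; apply: Qx; exact: L_pts.
  by have := h n I; rewrite /= subr_le0.
apply: bigcapT_measurable => n; apply: measurable_set_le.
apply: measurable_funB; first exact: measurable_enorm.
apply: (measurableT_comp (@measurable_enorm R d)).
by apply: measurable_rowD => //; exact: measurable_id.
Qed.

Lemma measurable_preimage d1 d2 (T1 : measurableType d1) (T2 : measurableType d2) (f : T1 -> T2) B :
  measurable_fun setT f -> measurable B -> measurable [set x | B (f x)].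
Proof. by move=> mf mB; have := mf measurableT _ mB; rewrite setTI. Qed.

Lemma measurable_wsB l : measurable [set y | Q (y - l)].
Proof.
apply: (@measurable_preimage _ _ _ _ (fun y : 'rV[R]_d => y - l)); last exact: measurable_ws.
by apply: measurable_rowD => //; exact: measurable_id.
Qed.

(** A point of both cells is equidistant from 0 and [l], so it lies on their bisecting
    hyperplane. *)
Lemma ws_overlap_null l : L l -> l != 0 -> leb R d [set y | Q y /\ Q (y - l)] = 0%E.
Proof.
move=> Ll l0; apply/eqP; rewrite -measure_le0 -(leb_hyperplane (dot l l / 2) l0).
apply: le_measure; rewrite ?inE; last first.
- move=> x [Qx Qxl] /=.
  have h1 := Qx _ Ll.
  have := Qxl _ (latN Ll); rewrite opprK subrK => h2.
  have : enorm x ^+ 2 = enorm (x - l) ^+ 2 by congr (_ ^+ 2); apply/eqP; rewrite eq_le h1 h2.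
  rewrite !sqr_enorm !(dotDl, dotDr, dotNl, dotNr) (dotC x l); lra.
- exact: measurable_hyperplane.
- by apply: measurableI; [exact: measurable_ws|exact: measurable_wsB].
Qed.

Lemma idx_ex y : exists n, `[< Q (y - pts n) >].
Proof.
by have [l /pts_surj[n <-] h] := ws_near y; exists n; exact/asboolP.
Qed.

(** On cell boundaries the least index breaks ties, which makes the choice of a lattice point
    measurable and defined everywhere. *)
Definition idx y : nat := ex_minn (idx_ex y).
Definition latpt y : 'rV[R]_d := pts (idx y).

Lemma L_latpt y : L (latpt y). Proof. exact: L_pts. Qed.

Lemma ws_latpt y : Q (y - latpt y).
Proof. by rewrite /latpt /idx; case: ex_minnP => n /asboolP. Qed.

Lemma measurable_idx : measurable_fun setT idx.
Proof.
move=> _ B _; rewrite setTI.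
have cell n : measurable [set y | idx y = n].
  have -> : [set y | idx y = n] = [set y | Q (y - pts n)] `&`
      ~` \bigcup_(m in `I_n) [set y | Q (y - pts m)].
    apply/seteqP; split => [y /= <-|y [/= Qn nQ]]; rewrite /idx.
      case: ex_minnP => n' /asboolP h1 h2; split => //.
      move=> -[m /= mn' Qm].
      by have := h2 m (asboolT Qm); rewrite leqNgt mn'.
    case: ex_minnP => n' /asboolP h1 h2.
    have := h2 n (asboolT Qn); rewrite leq_eqVlt => /predU1P[//|n'n].
    by exfalso; apply: nQ; exists n'.
  apply: measurableI; first exact: measurable_wsB.
  by apply: measurableC; apply: bigcup_measurable => m _; exact: measurable_wsB.
have -> : idx @^-1` B = \bigcup_n (if n \in B then [set y | idx y = n] else set0).
  apply/seteqP; split => [y /= By|y [n _]].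
    by exists (idx y) => //; rewrite mem_set.
  by case: ifPn => // /set_mem Bn /= idy; rewrite idy.
apply: bigcup_measurable => n _; case: ifPn => // _; exact: measurable0.
Qed.

Lemma measurable_latpt d' (T : measurableType d') (g : 'rV[R]_d -> T) :
  measurable_fun setT (fun y => g (latpt y)).
Proof.
apply: (measurableT_comp (f := fun n => g (pts n))); last exact: measurable_idx.
by move=> _ B mB.
Qed.

End Lattice.

(** * Integrable and locally integrable real functions *)

Section RealIntegral.
Variables (R : realType) (n : nat).
Local Notation mu := (leb R n).
Implicit Types f g : 'rV[R]_n -> R.

Definition integ f := mu.-integrable setT (EFin \o f).
Definition lint f : R := \int[mu]_x f x.

Lemma integ_measurable f : integ f -> measurable_fun setT f.
Proof. by move=> /measurable_int/measurable_EFinP. Qed.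

Lemma integP f : measurable_fun setT f -> (\int[mu]_x `|f x|%:E < +oo)%E -> integ f.
Proof. by move=> mf fi; apply/integrableP; split => //; exact/measurable_EFinP. Qed.

Lemma integ_abs_lty f : integ f -> (\int[mu]_x `|f x|%:E < +oo)%E.
Proof. by move=> /integrableP[]. Qed.

Lemma integD f g : integ f -> integ g -> integ (fun x => f x + g x).
Proof. exact: integrableD. Qed.

Lemma integN f : integ f -> integ (fun x => - f x).
Proof. exact: integrableN. Qed.

Lemma integB f g : integ f -> integ g -> integ (fun x => f x - g x).
Proof. by move=> fi gi; apply: integD => //; exact: integN. Qed.

Lemma integZ k f : integ f -> integ (fun x => k * f x).
Proof. exact: integrableZl. Qed.

Lemma integ_norm f : integ f -> integ (fun x => `|f x|).
Proof. exact: integrable_norm. Qed.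

Lemma integ0 : integ (fun=> 0). Proof. exact: integrable0. Qed.

Lemma le_integ f g : measurable_fun setT f -> (forall x, `|f x| <= g x) -> integ g -> integ f.
Proof.
move=> mf fg; apply: le_integrable => //; first exact/measurable_EFinP.
by move=> x _; rewrite lee_fin (le_trans (fg x))// ler_norm.
Qed.

Lemma integ_sum (I : Type) (s : seq I) (F : I -> 'rV[R]_n -> R) :
  (forall i, integ (F i)) -> integ (fun x => \sum_(i <- s) F i x).
Proof.
move=> Fi; elim: s => [|i s IH].
  by under [X in integ X]eq_fun do rewrite big_nil; exact: integ0.
by under [X in integ X]eq_fun do rewrite big_cons; exact: integD.
Qed.

Lemma integ_fin f : integ f -> (lint f)%:E = (\int[mu]_x (f x)%:E)%E.
Proof. by move=> fi; rewrite fineK//; exact: integrable_fin_num. Qed.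

Lemma lintD f g : integ f -> integ g -> lint (fun x => f x + g x) = lint f + lint g.
Proof. by move=> fi gi; exact: RintegralD. Qed.

Lemma lintB f g : integ f -> integ g -> lint (fun x => f x - g x) = lint f - lint g.
Proof. by move=> fi gi; exact: RintegralB. Qed.

Lemma lintZ k f : integ f -> lint (fun x => k * f x) = k * lint f.
Proof. by move=> fi; exact: RintegralZl. Qed.

Lemma lint0 : lint (fun=> 0) = 0.
Proof. by rewrite /lint Rintegral_cst// mul0r. Qed.

Lemma lint_sum (I : Type) (s : seq I) (F : I -> 'rV[R]_n -> R) :
  (forall i, integ (F i)) -> lint (fun x => \sum_(i <- s) F i x) = \sum_(i <- s) lint (F i).
Proof.
move=> Fi; elim: s => [|i s IH].
  by rewrite big_nil; under [X in lint X]eq_fun do rewrite big_nil; exact: lint0.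
rewrite big_cons -IH -lintD//; last exact: integ_sum.
by congr lint; apply/funext => x; rewrite big_cons.
Qed.

Lemma le_lint f g : integ f -> integ g -> (forall x, f x <= g x) -> lint f <= lint g.
Proof. by move=> fi gi fg; apply: le_Rintegral. Qed.

Lemma lint_ge0 f : (forall x, 0 <= f x) -> 0 <= lint f.
Proof. by move=> f0; apply: Rintegral_ge0. Qed.

Lemma le_norm_lint f : integ f -> `|lint f| <= lint (fun x => `|f x|).
Proof. by move=> fi; exact: le_normr_Rintegral. Qed.

Lemma le_norm_lint2 f g : integ f -> integ g -> (forall x, `|f x| <= g x) -> `|lint f| <= lint g.
Proof.
move=> fi gi fg; apply: le_trans (le_norm_lint fi) _.
by apply: le_lint => //; exact: integ_norm.
Qed.

Lemma lint_ae_eq f g : measurable_fun setT f -> measurable_fun setT g ->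
  {ae mu, forall x, f x = g x} -> lint f = lint g.
Proof.
move=> mf mg fg; congr fine; apply: ae_eq_integral => //.
- exact/measurable_EFinP.
- exact/measurable_EFinP.
- by apply: filterS fg => x /= ->.
Qed.

Lemma integ_indic B : measurable B -> (mu B < +oo)%E -> integ \1_B.
Proof. move=> mB Boo; apply: integP; first exact: measurable_indic.
under eq_integral do rewrite ger0_norm//.
by rewrite integral_indic// setIT. Qed.

Lemma lint_indic B : measurable B -> lint \1_B = fine (mu B).
Proof. by move=> mB; rewrite /lint /Rintegral integral_indic// setIT. Qed.

Lemma lint_dct (F : nat -> 'rV[R]_n -> R) f b :
  (forall k, measurable_fun setT (F k)) -> measurable_fun setT f -> integ b ->
  (forall k x, `|F k x| <= b x) -> (forall x, F ^~ x @ \oo --> f x) ->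
  integ f /\ (fun k => lint (F k)) @ \oo --> lint f.
Proof.
move=> mF mf bi Fb Ff.
have [||||fi _ h] := @dominated_convergence _ _ _ mu setT measurableT
  (fun k x => (F k x)%:E) (fun x => (f x)%:E) (fun x => (b x)%:E) _ _ _ bi.
- by move=> k; exact/measurable_EFinP.
- exact/measurable_EFinP.
- by apply: nearW => x _; apply: cvg_EFin; [exact: nearW|exact: Ff].
- by apply: nearW => x k _; rewrite lee_fin.
split => //.
have Fi k : integ (F k) by exact: le_integ (mF k) (Fb k) bi.
move: h; rewrite -(integ_fin fi) => /fine_cvgP[_].
by apply: cvg_trans; apply: near_eq_cvg; apply: nearW => k.
Qed.

Lemma integ_pos f : integ f -> integ (fun x => Num.max (f x) 0).
Proof.
move=> fi; apply: (le_integ _ _ (integ_norm fi)).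
  by apply: measurable_maxr => //; exact: integ_measurable.
by move=> x; rewrite ger0_norm ?le_max ?lexx ?orbT// ge_max ler_norm normr_ge0.
Qed.

Lemma lint_posneg f : integ f ->
  lint f = lint (fun x => Num.max (f x) 0) - lint (fun x => Num.max (- f x) 0).
Proof.
move=> fi; rewrite -lintB; [|exact: integ_pos|exact/integ_pos/integN].
by congr lint; apply/funext => x; case: (leP (f x) 0); case: (leP (- f x) 0); lra.
Qed.

Section change.
Variables (k : R) (phi : 'rV[R]_n -> 'rV[R]_n).
Hypotheses (k0 : 0 < k) (mphi : measurable_fun setT phi).
Hypothesis hphi : forall g : 'rV[R]_n -> \bar R, measurable_fun setT g ->
  (forall x, (0 <= g x)%E) -> (\int[mu]_x g x = k%:E * \int[mu]_x g (phi x))%E.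

Lemma integ_change f : integ f -> integ (f \o phi).
Proof.
move=> fi; have mf := integ_measurable fi.
apply: integP; first exact: measurableT_comp.
have := integ_abs_lty fi; rewrite hphi//; last first.
  by apply/measurable_EFinP; exact: measurableT_comp.
set X := (\int[mu]_x _)%E => /=.
have X0 : (0 <= X)%E by apply: integral_ge0.
by clearbody X; case: X X0 => [r| |]//= _; rewrite ?ltry// mulry gtr0_sg// mul1e.
Qed.

Let lint_change_ge0 f : integ f -> (forall x, 0 <= f x) -> lint f = k * lint (f \o phi).
Proof.
move=> fi f0; apply: EFin_inj; rewrite EFinM (integ_fin fi) (integ_fin (integ_change fi)).
apply: (@hphi (fun x => (f x)%:E)); first by apply/measurable_EFinP; exact: integ_measurable.
by move=> x; rewrite lee_fin.
Qed.

(** The rule is assumed for nonnegative functions and extends through positive and negative parts;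
    the dilations and point reflections below are instances. *)
Lemma lint_change f : integ f -> lint f = k * lint (f \o phi).
Proof.
move=> fi; rewrite (lint_posneg fi) (lint_posneg (integ_change fi)) mulrBr.
rewrite (lint_change_ge0 (integ_pos fi)) => [|x]; last by rewrite le_max lexx orbT.
rewrite (lint_change_ge0 (integ_pos (integN fi))) => [|x]; last by rewrite le_max lexx orbT.
by [].
Qed.
End change.

Lemma integ_affine (r : R) c f : 0 < r -> integ f -> integ (fun x => f (r *: x + c)).
Proof.
move=> r0 fi; apply: (@integ_change (r ^+ n) (fun x => r *: x + c)) => //.
- exact: exprn_gt0.
- apply: measurable_rowD => //; apply: measurable_rowZ; exact: measurable_id.
- by move=> g mg g0; exact: ge0_integral_affine.
Qed.

Lemma lint_affine (r : R) c f : 0 < r -> integ f ->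
  lint f = r ^+ n * lint (fun x => f (r *: x + c)).
Proof.
move=> r0 fi; apply: (@lint_change (r ^+ n) (fun x => r *: x + c)) => //.
- exact: exprn_gt0.
- apply: measurable_rowD => //; apply: measurable_rowZ; exact: measurable_id.
- by move=> g mg g0; exact: ge0_integral_affine.
Qed.

Lemma ge0_integral_refl c (g : 'rV[R]_n -> \bar R) : measurable_fun setT g ->
  (forall x, (0 <= g x)%E) -> (\int[mu]_x g x = \int[mu]_x g (c - x)%R)%E.
Proof.
move=> mg g0; rewrite (ge0_integral_affine c ltr01)// expr1n mul1e ge0_integral_opp//; last first.
  apply: (measurableT_comp mg); apply: measurable_rowD => //; apply: measurable_rowZ; exact: measurable_id.
by apply: eq_integral => x _; rewrite scale1r addrC.
Qed.

Lemma integ_refl c f : integ f -> integ (fun x => f (c - x)).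
Proof.
move=> fi; apply: (@integ_change 1 (fun x => c - x)) => //.
- apply: measurable_rowD => //; apply: measurable_rowN; exact: measurable_id.
- by move=> g mg g0; rewrite mul1e; exact: ge0_integral_refl.
Qed.

Lemma lint_refl c f : integ f -> lint f = lint (fun x => f (c - x)).
Proof.
move=> fi; rewrite -[RHS]mul1r; apply: (@lint_change 1 (fun x => c - x)) => //.
- apply: measurable_rowD => //; apply: measurable_rowN; exact: measurable_id.
- by move=> g mg g0; rewrite mul1e; exact: ge0_integral_refl.
Qed.

(** The natural domain of the cell average, since the cell is bounded: for [s < d] Riesz potentials
    are locally integrable without being integrable. *)
Definition locint f := measurable_fun setT f /\ forall r, integ (fun x => \1_(eball n r) x * f x).

Lemma locint_measurable f : locint f -> measurable_fun setT f. Proof. by case. Qed.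

Lemma integ_locint f : integ f -> locint f.
Proof.
move=> fi; have mf := integ_measurable fi; split => // r.
apply: (le_integ _ _ (integ_norm fi)).
  apply: measurable_funM => //; apply: measurable_indic; exact: measurable_eball.
by move=> x; rewrite normrM ler_piMl// indicE normr_nat; case: (_ \in _).
Qed.

Lemma locintD f g : locint f -> locint g -> locint (fun x => f x + g x).
Proof.
move=> [mf fi] [mg gi]; split => [|r]; first exact: measurable_funD.
by under [X in integ X]eq_fun do rewrite mulrDr; exact: integD.
Qed.

Lemma locintZ k f : locint f -> locint (fun x => k * f x).
Proof.
move=> [mf fi]; split => [|r]; first exact: measurable_funM.
by under [X in integ X]eq_fun do rewrite mulrCA; exact: integZ.
Qed.

Lemma locintB f g : locint f -> locint g -> locint (fun x => f x - g x).
Proof.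
move=> fi gi; have := locintD fi (locintZ (-1) gi).
by congr locint; apply/funext => x; rewrite mulN1r.
Qed.

Lemma locint_norm f : locint f -> locint (fun x => `|f x|).
Proof.
move=> [mf fi]; split => [|r]; first exact: measurableT_comp.
have := integ_norm (fi r); congr integ; apply/funext => x.
by rewrite normrM indicE normr_nat.
Qed.

Lemma le_locint f g : measurable_fun setT f -> (forall x, `|f x| <= g x) -> locint g -> locint f.
Proof.
move=> mf fg [mg gi]; split => // r; apply: (le_integ _ _ (gi r)).
  apply: measurable_funM => //; apply: measurable_indic; exact: measurable_eball.
by move=> x; rewrite normrM indicE normr_nat ler_wpM2l.
Qed.

Lemma locint_shift c f : locint f -> locint (fun x => f (x + c)).
Proof.
move=> [mf fi].
have mfc : measurable_fun setT (fun x : 'rV[R]_n => f (x + c)).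
  by apply: (measurableT_comp mf); apply: measurable_rowD => //; exact: measurable_id.
split => // r.
have := integ_norm (integ_affine c ltr01 (fi (r + enorm c))).
apply: le_integ => [|x].
  apply: measurable_funM => //; apply: measurable_indic; exact: measurable_eball.
rewrite !normrM !indicE !normr_nat scale1r.
have [xr|] := boolP (x \in eball n r); last by rewrite mul0r.
rewrite mem_set//= /eball/=; apply: le_lt_trans (enormD _ _) _.
by rewrite ltrD2r; move: xr; rewrite inE.
Qed.

End RealIntegral.

(** * Averages over the cell and lattice sums *)

Section Averaging.
Variables (R : realType) (d : nat) (A : 'M[R]_d).
Hypothesis uA : A \in unitmx.
Local Notation L := (lattice A).
Local Notation Q := (wigner_seitz L).
Local Notation mu := (leb R d).
Local Notation V := 'rV[R]_d.
Hypothesis vQ : mu Q = 1%E.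
Implicit Types (f g h : V -> R).

Let mQ : measurable Q := measurable_ws A.

Lemma leb_shift (B : set V) c : measurable B -> mu [set y | B (y - c)] = mu B.
Proof.
move=> mB; have mBc : measurable [set y | B (y - c)].
  apply: (@measurable_preimage _ _ _ _ (fun y : V => y - c)) => //.
  by apply: measurable_rowD => //; exact: measurable_id.
rewrite -[in LHS](setIT [set y | _]) -integral_indic// -[in RHS](setIT B) -integral_indic//.
rewrite (@ge0_integral_affine R d 1 c)//; last exact: measurable_EFin_indic.
rewrite expr1n mul1e; apply: eq_integral => x _; congr EFin; apply: indic_iff.
by rewrite /= scale1r addrK.
Qed.

Lemma leb_wsB c : mu [set y | Q (y - c)] = 1%E.
Proof. by rewrite leb_shift. Qed.

Lemma integ_ws : integ (\1_Q : V -> R).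
Proof. by apply: integ_indic => //; rewrite vQ ltry. Qed.

Lemma lint_ws : lint (\1_Q : V -> R) = 1.
Proof. by rewrite lint_indic// vQ. Qed.

Lemma ws_int : (\int[mu]_x (\1_Q x : R)%:E)%E = 1%E.
Proof. by rewrite integral_indic// setIT; exact: vQ. Qed.

Definition avg f x : R := lint (fun y => \1_Q y * f (x - y)).
Definition dif f x : R := f x - avg f x.

Lemma measurable_subc x : measurable_fun setT (fun y : V => x - y).
Proof. by apply: measurable_rowD => //; apply: measurable_rowN; exact: measurable_id. Qed.

Lemma avg_integ f x : locint f -> integ (fun y => \1_Q y * f (x - y)).
Proof.
move=> [mf fi]; have [rho rho0 hr] := ws_bounded uA.
have := integ_norm (integ_refl x (fi (enorm x + rho + 1))).
apply: le_integ => [|y].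
  apply: measurable_funM; first exact: measurable_indic.
  exact: measurableT_comp mf (measurable_subc x).
rewrite !normrM !indicE !normr_nat.
have [yQ|] := boolP (y \in Q); last by rewrite mul0r.
rewrite mem_set//= /eball/=; apply: le_lt_trans (enormB _ _) _.
by have := hr y (set_mem yQ); lra.
Qed.

Lemma avgD f g x : locint f -> locint g -> avg (fun x => f x + g x) x = avg f x + avg g x.
Proof.
move=> fi gi; rewrite /avg -lintD; try exact: avg_integ.
by congr lint; apply/funext => y; rewrite mulrDr.
Qed.

Lemma avgZ k f x : locint f -> avg (fun x => k * f x) x = k * avg f x.
Proof.
move=> fi; rewrite /avg -lintZ; last exact: avg_integ.
by congr lint; apply/funext => y; rewrite mulrCA.
Qed.

Lemma avgB f g x : locint f -> locint g -> avg (fun x => f x - g x) x = avg f x - avg g x.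
Proof.
move=> fi gi; rewrite /avg -lintB; try exact: avg_integ.
by congr lint; apply/funext => y; rewrite mulrBr.
Qed.

Lemma le_avg f g x : locint f -> locint g -> (forall y, f y <= g y) -> avg f x <= avg g x.
Proof.
move=> fi gi fg; apply: le_lint; try exact: avg_integ.
by move=> y; rewrite ler_wpM2l.
Qed.

Lemma norm_avg f x : locint f -> `|avg f x| <= avg (fun y => `|f y|) x.
Proof.
move=> fi; apply: le_norm_lint2; try exact: avg_integ.
  by apply: (avg_integ (f := fun y => `|f y|)); exact: locint_norm.
by move=> y; rewrite normrM indicE normr_nat.
Qed.

Lemma avg_shift c f x : avg (fun z => f (z + c)) x = avg f (x + c).
Proof. by congr lint; apply/funext => y; rewrite addrAC. Qed.

Lemma indic_wsN y : \1_Q (- y) = \1_Q y :> R.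
Proof.
apply: indic_iff; split; last exact: wsN.
by move=> /wsN; rewrite opprK.
Qed.

(** Reflect [y]: the symmetry of the cell is what gives [dif] a second-order gain. *)
Lemma avg_sym f x : locint f -> avg f x = lint (fun y => \1_Q y * f (x + y)).
Proof.
move=> fi; rewrite /avg (lint_refl 0); last exact: avg_integ.
by congr lint; apply/funext => y; rewrite sub0r indic_wsN opprK.
Qed.

Lemma avg_integ_sym f x : locint f -> integ (fun y => \1_Q y * f (x + y)).
Proof.
move=> fi; have := integ_refl 0 (avg_integ x fi).
by congr integ; apply/funext => y; rewrite sub0r indic_wsN opprK.
Qed.

Lemma measurable_joint f : measurable_fun setT f ->
  measurable_fun setT (fun p : V * V => \1_Q p.2 * f (p.1 - p.2)).
Proof.
move=> mf; apply: measurable_funM.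
  apply: (measurableT_comp (measurable_indic mQ)); exact: measurable_snd.
apply: (measurableT_comp mf); apply: measurable_rowD; first exact: measurable_fst.
apply: measurable_rowN; exact: measurable_snd.
Qed.

Lemma measurable_avg f : locint f -> measurable_fun setT (avg f).
Proof.
move=> fi; have mf := locint_measurable fi.
have -> : avg f = (fun x => fine (lebint (fun y => (\1_Q y * f (x - y))%:E))).
  apply/funext => x; rewrite (lebint_integrable (f := fun y => (\1_Q y * f (x - y))%:E))//.
  exact: avg_integ.
apply: (measurableT_comp (@fine_measurable R setT _)) => //.
apply: (measurable_lebint (F := fun p : V * V => (\1_Q p.2 * f (p.1 - p.2))%:E)).
apply/measurable_EFinP; exact: measurable_joint.
Qed.

(** Used with [w = 1] to see that averaging preserves integrals, and with [w] the indicator of a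
    ball to see that it preserves local integrability. *)
Lemma avg_tonelli (w g : V -> R) : measurable_fun setT w -> (forall x, 0 <= w x) ->
  locint g -> (forall x, 0 <= g x) ->
  (\int[mu]_x (w x * avg g x)%:E =
   \int[mu]_y ((\1_Q y : R)%:E * \int[mu]_x (w x * g (x - y))%:E))%E.
Proof.
move=> mw w0 gi g0; have mg := locint_measurable gi.
pose F (p : V * V) := (w p.1 * (\1_Q p.2 * g (p.1 - p.2)))%:E.
have mF : measurable_fun setT F.
  apply/measurable_EFinP; apply: measurable_funM; last exact: measurable_joint.
  by apply: (measurableT_comp mw); exact: measurable_fst.
have F0 p : (0 <= F p)%E by rewrite lee_fin !mulr_ge0.
transitivity (\int[mu]_x \int[mu]_y F (x, y))%E.
  apply: eq_integral => x _; rewrite EFinM (integ_fin (avg_integ x gi)).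
  rewrite -ge0_integralZl//.
  - by apply/measurable_EFinP; apply: integ_measurable; exact: avg_integ.
  - by move=> y _; rewrite lee_fin mulr_ge0.
  - by rewrite lee_fin.
rewrite fubini_tonelli//; apply: eq_integral => y _.
rewrite -ge0_integralZl//; last 2 first.
- by apply/measurable_EFinP; apply: measurable_funM => //; apply: (measurableT_comp mg); apply: measurable_rowD => //; exact: measurable_id.
- by move=> x _; rewrite lee_fin mulr_ge0.
by apply: eq_integral => x _; rewrite /F/= -EFinM; congr EFin; ring.
Qed.

(** On the ball of radius [r], averages of [|f|] involve [f] only on the ball of radius
    [r + rho]. *)
Lemma locint_avg f : locint f -> locint (avg f).
Proof.
move=> fi; have mf := locint_measurable fi.
have mavg := measurable_avg fi.
have [rho rho0 hr] := ws_bounded uA.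
split => // r; have nfi := locint_norm fi.
have m1 s : measurable_fun setT (\1_(eball d s) : V -> R).
  by apply: measurable_indic; exact: measurable_eball.
apply: integP; first exact: measurable_funM.
apply: (@le_lt_trans _ _ (\int[mu]_x (\1_(eball d r) x * avg (fun y => `|f y|) x)%:E)%E).
  apply: ge0_le_integral => //.
  - by apply/measurable_EFinP; apply: measurableT_comp => //; exact: measurable_funM.
  - by apply/measurable_EFinP; apply: measurable_funM => //; exact: measurable_avg.
  - move=> x _; rewrite lee_fin normrM indicE normr_nat ler_wpM2l//; exact: norm_avg.
rewrite avg_tonelli//.
have := integ_abs_lty (nfi.2 (r + rho)); set M := (X in (X < _)%E -> _) => Moo.
apply: (@le_lt_trans _ _ (\int[mu]_y ((\1_Q y : R)%:E * M))%E); last first.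
  rewrite ge0_integralZr//; last 2 first.
  - exact: measurable_EFin_indic.
  - by apply: integral_ge0.
  by rewrite ws_int mul1e.
have mfy y : measurable_fun setT (fun x => \1_(eball d r) x * `|f (x - y)|).
  apply: measurable_funM => //; apply: measurableT_comp => //.
  by apply: (measurableT_comp mf); apply: measurable_rowD => //; exact: measurable_id.
apply: ge0_le_integral => //.
- by move=> y _; rewrite mule_ge0// ?lee_fin// integral_ge0// => x _; rewrite lee_fin mulr_ge0.
- apply: emeasurable_funM; first exact: measurable_EFin_indic.
  apply: (measurable_fun_fubini_tonelli_F (m2 := mu)
     (fun p : V * V => (\1_(eball d r) p.2 * `|f (p.2 - p.1)|)%:E)) => [|p]; last by rewrite lee_fin mulr_ge0.
  apply/measurable_EFinP; apply: measurable_funM.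
    by apply: (measurableT_comp (m1 r)); exact: measurable_snd.
  apply: measurableT_comp => //; apply: (measurableT_comp mf).
  apply: measurable_rowD; first exact: measurable_snd.
  by apply: measurable_rowN; exact: measurable_fst.
- by apply: emeasurable_funM => //; exact: measurable_EFin_indic.
- move=> y _; have [yQ|yQ] := pselect (Q y); last by rewrite indicE memNset// !mul0e.
  rewrite indicE mem_set// !mul1e /M.
  rewrite [leRHS](@ge0_integral_affine R d 1 (- y))//; last first.
  - apply/measurable_EFinP; apply: measurableT_comp => //; apply: measurable_funM => //.
    exact: measurableT_comp.
  rewrite expr1n mul1e; apply: ge0_le_integral => //.
  + by apply/measurable_EFinP.
  + apply/measurable_EFinP; apply: measurableT_comp => //; apply: measurable_funM.
      apply: (measurableT_comp (m1 _)); apply: measurable_rowD => //; apply: measurable_rowZ; exact: measurable_id.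
    apply: measurableT_comp => //; apply: (measurableT_comp mf).
    by apply: measurable_rowD => //; apply: measurable_rowZ; exact: measurable_id.
  + move=> x _; rewrite lee_fin scale1r normrM normr_id ler_wpM2r//.
    rewrite !indicE normr_nat; have [xr|//] := boolP (x \in eball d r).
    rewrite mem_set//= /eball/=; apply: le_lt_trans (enormB _ _) _.
    by move: xr; rewrite inE /eball/= => xr; have := hr y yQ; lra.
Qed.

Lemma locint_dif f : locint f -> locint (dif f).
Proof. by move=> fi; apply: locintB => //; exact: locint_avg. Qed.

Lemma locint_iter_dif k f : locint f -> locint (iter k dif f).
Proof. by move=> fi; elim: k => //= k IH; exact: locint_dif. Qed.

Lemma integ_avg_ge0 f : integ f -> (forall x, 0 <= f x) ->
  (\int[mu]_x (avg f x)%:E = \int[mu]_x (f x)%:E)%E.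
Proof.
move=> fi f0; have := avg_tonelli (w := cst 1) _ _ (integ_locint fi) f0.
under [X in (_ -> _ -> X = _) -> _]eq_integral do rewrite mul1r.
move=> -> //; rewrite (eq_integral (fun y => (\1_Q y : R)%:E * \int[mu]_x (f x)%:E)%E).
  rewrite ge0_integralZr//; last 2 first.
  - exact: measurable_EFin_indic.
  - by apply: integral_ge0 => x _; rewrite lee_fin.
  by rewrite ws_int mul1e.
move=> y _; congr (_ * _)%E.
rewrite [RHS](@ge0_integral_affine R d 1 (- y))//; last first.
- apply/measurable_EFinP; exact: integ_measurable.
rewrite expr1n mul1e; apply: eq_integral => x _.
by rewrite scale1r mul1r.
Qed.

Lemma avg_posneg f x : locint f ->
  avg f x = avg (fun y => Num.max (f y) 0) x - avg (fun y => Num.max (- f y) 0) x.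
Proof.
move=> fi; have mf := locint_measurable fi.
rewrite -avgB; last 2 first.
- apply: (le_locint _ _ (locint_norm fi)) => [|y]; first exact: measurable_maxr.
  by rewrite ger0_norm ?le_max ?lexx ?orbT// ge_max ler_norm normr_ge0.
- apply: (le_locint _ _ (locint_norm fi)) => [|y].
    by apply: measurable_maxr => //; exact: measurable_funN.
  by rewrite ger0_norm ?le_max ?lexx ?orbT// ge_max -normrN ler_norm normr_ge0.
congr (avg _ x); apply/funext => y.
by case: (leP (f y) 0); case: (leP (- f y) 0); lra.
Qed.

Lemma integ_avg f : integ f -> integ (avg f).
Proof.
move=> fi; apply: integP; first by apply: measurable_avg; exact: integ_locint.
apply: (@le_lt_trans _ _ (\int[mu]_x (avg (fun y => `|f y|) x)%:E)%E).
  apply: ge0_le_integral => //.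
  - by apply/measurable_EFinP; apply: measurableT_comp => //; apply: measurable_avg; exact: integ_locint.
  - by apply/measurable_EFinP; apply: measurable_avg; apply: integ_locint; exact: integ_norm.
  - move=> x _; rewrite lee_fin; apply: norm_avg; exact: integ_locint.
by rewrite integ_avg_ge0//; [exact: integ_abs_lty|exact: integ_norm].
Qed.

Lemma lint_avg f : integ f -> lint (avg f) = lint f.
Proof.
move=> fi; have pi := integ_pos fi; have ni := integ_pos (integN fi).
rewrite (lint_posneg fi).
have -> : avg f = fun x => avg (fun y => Num.max (f y) 0) x - avg (fun y => Num.max (- f y) 0) x.
  by apply/funext => x; rewrite -avg_posneg//; exact: integ_locint.
rewrite lintB; try exact: integ_avg.
by congr (_ - _); congr fine; apply: integ_avg_ge0 => // x; rewrite le_max lexx orbT.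
Qed.

Lemma integ_dif f : integ f -> integ (dif f).
Proof. by move=> fi; apply: integB => //; exact: integ_avg. Qed.

Lemma integ_iter_dif k f : integ f -> integ (iter k dif f).
Proof. by move=> fi; elim: k => //= k IH; exact: integ_dif. Qed.

Lemma lint_dif f : integ f -> lint (dif f) = 0.
Proof. by move=> fi; rewrite lintB ?lint_avg ?subrr//; exact: integ_avg. Qed.

End Averaging.

(** * The cells tile space; lattice sums as integrals *)

Section Tiling.
Variables (R : realType) (d : nat) (A : 'M[R]_d).
Hypothesis uA : A \in unitmx.
Local Notation L := (lattice A).
Local Notation Q := (wigner_seitz L).
Local Notation mu := (leb R d).
Local Notation V := 'rV[R]_d.
Hypothesis vQ : mu Q = 1%E.
Implicit Types (f g h : V -> R).

Let mQ : measurable Q := measurable_ws A.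
Local Notation latpt := (latpt uA).

(** The enumeration may repeat a point, hence the test on points instead of indices. *)
Definition overlap m n : set V :=
  if pts A m == pts A n then set0 else [set y | Q (y - pts A m) /\ Q (y - pts A n)].

Lemma overlap_negligible m n : mu.-negligible (overlap m n).
Proof.
rewrite /overlap; case: eqVneq => [_|mn]; first exact: negligible_set0.
have mI : measurable [set y : V | Q y /\ Q (y - (pts A n - pts A m))].
  by apply: measurableI => //; exact: measurable_wsB.
exists [set y | Q (y - pts A m) /\ Q (y - pts A n)]; split => //.
  by apply: measurableI; exact: measurable_wsB.
have := leb_shift (pts A m) mI.
rewrite ws_overlap_null ?subr_eq0 1?eq_sym//; last by apply: latB; exact: L_pts.
move=> <-; congr (mu _); apply/seteqP; split => y /=;
  by rewrite opprB addrA subrK.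
Qed.

Definition overlaps : set V := \bigcup_m \bigcup_n overlap m n.

Lemma overlaps_negligible : mu.-negligible overlaps.
Proof. by apply: negligible_bigcup => m; apply: negligible_bigcup => n; exact: overlap_negligible. Qed.

(** Off the null set of points lying in two cells, the closed cells behave like a partition. *)
Lemma ws_latptE y l : ~ overlaps y -> L l -> Q (y - l) <-> latpt y = l.
Proof.
move=> yN Ll; split => [Qyl|<-]; last exact: ws_latpt.
apply: contrapT => yl; apply: yN.
have [n nl] := pts_surj Ll.
exists (idx uA y) => //; exists n => //; rewrite /overlap.
case: eqVneq => [|_]; first by rewrite nl.
by split; [exact: ws_latpt|rewrite nl].
Qed.

Lemma measurable_latpt_eq l : measurable [set y | latpt y = l].
Proof.
have := @measurable_latpt R d A uA _ bool (fun x => x == l) measurableT [set true] I.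
by rewrite setTI; congr measurable; apply/seteqP; split => y /= /eqP.
Qed.

(** The set of points assigned to [l] differs from the cell of [l] by a null set. Its unit mass is
    what makes the integral [lsum] a sum over the lattice. *)
Lemma leb_latpt_eq l : L l -> mu [set y | latpt y = l] = 1%E.
Proof.
move=> Ll; rewrite -(leb_wsB vQ l); have [B [mB B0 NB]] := overlaps_negligible.
apply/eqP; rewrite eq_le; apply/andP; split.
  apply: le_measure; rewrite ?inE.
  - exact: measurable_latpt_eq.
  - exact: measurable_wsB.
  - by move=> y /= <-; exact: ws_latpt.
apply: (@le_trans _ _ (mu ([set y | latpt y = l] `|` B))).
  apply: le_measure; rewrite ?inE.
  - exact: measurable_wsB.
  - by apply: measurableU => //; exact: measurable_latpt_eq.
  - move=> y /= Qy; have [yN|yN] := pselect (overlaps y); first by right; exact: NB.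
    by left; apply/(ws_latptE yN Ll).
apply: (le_trans (measureU2 _ (measurable_latpt_eq l) mB)).
by rewrite [X in (_ + X)%E](_ : _ = 0%E) ?adde0//; exact: B0.
Qed.

(* Sums over the lattice are integrals of the function read at the lattice point of
   the cell: dominated convergence for sums is then that of Lebesgue integrals. *)
Definition lsum g : R := lint (fun y => g (latpt y)).
Definition lsummable g := integ (fun y => g (latpt y)).

Lemma lsum_finite (S : set V) g : finite_set S -> S `<=` L ->
  lsummable (fun l => \1_S l * g l) /\ lsum (fun l => \1_S l * g l) = \sum_(x \in S) g x.
Proof.
move=> /finite_seqP[s0 S0] SL.
have [s su Ss] : exists2 s : seq V, uniq s & S = [set` s].
  exists (undup s0); first exact: undup_uniq.
  by rewrite S0; apply/seteqP; split => x /=; rewrite mem_undup.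
have sL x : x \in s -> L x by move=> xs; apply: SL; rewrite Ss.
have -> : \sum_(x \in S) g x = \sum_(x <- s) g x by rewrite Ss; apply/esym; apply: fsbig_seq.
pose F x y : R := if x \in s then g x * \1_[set y | latpt y = x] y else 0.
have -> : (fun l => \1_S l * g l) = (fun l => if l \in s then g l else 0).
  apply/funext => l; rewrite indicE Ss; have [ls|ls] := boolP (l \in s).
    by rewrite mem_set// mul1r.
  by rewrite memNset ?mul0r//=; exact/negP.
have FE : (fun y => if latpt y \in s then g (latpt y) else 0) = (fun y => \sum_(x <- s) F x y).
  apply/funext => y; have [yS|yS] := boolP (latpt y \in s).
    rewrite (bigD1_seq (latpt y))//= /F yS indicE mem_set// mulr1 big1 ?addr0// => x xy.
    by case: ifP => // _; rewrite indicE memNset ?mulr0//= => /eqP; rewrite eq_sym (negbTE xy).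
  rewrite big1_seq// => x /andP[_ xs]; rewrite /F xs indicE memNset ?mulr0//= => yx.
  by rewrite yx xs in yS.
have ii x : integ (F x).
  have [xs|xs] := boolP (x \in s); last first.
    by rewrite (_ : F x = fun=> 0); [exact: integ0|apply/funext => y; rewrite /F (negbTE xs)].
  rewrite (_ : F x = fun y => g x * \1_[set y | latpt y = x] y); last first.
    by apply/funext => y; rewrite /F xs.
  apply: integZ; apply: integ_indic; first exact: measurable_latpt_eq.
  by rewrite leb_latpt_eq ?ltry//; exact: sL.
rewrite /lsummable /lsum FE; split; first exact: integ_sum.
rewrite lint_sum//; apply: eq_big_seq => x xs.
rewrite (_ : F x = fun y => g x * \1_[set y | latpt y = x] y); last first.
  by apply/funext => y; rewrite /F xs.
rewrite lintZ.
  rewrite lint_indic; last exact: measurable_latpt_eq.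
  by rewrite leb_latpt_eq ?mulr1//; exact: sL.
apply: integ_indic; first exact: measurable_latpt_eq.
by rewrite leb_latpt_eq ?ltry//; exact: sL.
Qed.

(** By Tonelli each [y] is weighted by the measure of the [x] whose lattice point [l] has [y] in
    [l - Q]; for almost every [y] these are the [x] with the same lattice point as [y], a set of
    measure 1. *)
Let lsum_avg_ge0 h : integ h -> (forall x, 0 <= h x) ->
  (\int[mu]_x (avg A h (latpt x))%:E = \int[mu]_x (h x)%:E)%E.
Proof.
move=> hi h0; have mh := integ_measurable hi.
pose F (p : V * V) := (\1_Q (latpt p.1 - p.2) * h p.2)%:E.
have mF : measurable_fun setT F.
  apply/measurable_EFinP; apply: measurable_funM.
    apply: (measurableT_comp (measurable_indic mQ)); apply: measurable_rowD.
      apply: (measurableT_comp (f := latpt)); last exact: measurable_fst.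
      exact: (measurable_latpt uA id).
    by apply: measurable_rowN; exact: measurable_snd.
  by apply: (measurableT_comp mh); exact: measurable_snd.
have F0 p : (0 <= F p)%E by rewrite lee_fin mulr_ge0.
transitivity (\int[mu]_x \int[mu]_y F (x, y))%E.
  apply: eq_integral => x _; rewrite (integ_fin (avg_integ uA (latpt x) (integ_locint hi))).
  rewrite (@ge0_integral_refl R d (latpt x))//; last 2 first.
  - by apply/measurable_EFinP; apply: integ_measurable; apply: avg_integ => //; exact: integ_locint.
  - by move=> y; rewrite lee_fin mulr_ge0.
  by apply: eq_integral => y _; rewrite /F/= subKr.
rewrite fubini_tonelli//; apply: ge0_ae_eq_integral => //.
- exact: measurable_fun_fubini_tonelli_G.
- exact/measurable_EFinP.
- by move=> y _; exact: integral_ge0.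
- by move=> y _; rewrite lee_fin.
have [B [mB B0 NB]] := overlaps_negligible.
exists B; split => // y /= yB; apply: NB; apply: contrapT => yN; apply: yB => _.
rewrite (eq_integral (fun x => (h y)%:E * (\1_[set x | latpt x = latpt y] x)%:E)%E).
  rewrite ge0_integralZl//.
  - rewrite integral_indic ?setIT//; last exact: measurable_latpt_eq.
    by rewrite [X in (_ * X)%E](leb_latpt_eq (L_latpt uA y)) mule1.
  - by apply: measurable_EFin_indic; exact: measurable_latpt_eq.
  - by rewrite lee_fin.
move=> x _; rewrite /F/= -EFinM mulrC; congr (_ * _)%:E; apply: indic_iff => /=.
split => [Qxy|xy].
  apply/esym/(ws_latptE yN); first exact: L_latpt.
  by rewrite -opprB; exact: wsN.
by rewrite xy -opprB; apply: wsN; exact: ws_latpt.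
Qed.

Lemma lsummable_avg h : integ h -> lsummable (avg A h).
Proof.
move=> hi; apply: integP; first exact: measurable_latpt.
apply: (@le_lt_trans _ _ (\int[mu]_x (avg A (fun y => `|h y|) (latpt x))%:E)%E).
  apply: ge0_le_integral => //.
  - by apply/measurable_EFinP; exact: (measurable_latpt uA (fun y => `|avg A h y|)).
  - by apply/measurable_EFinP; exact: measurable_latpt.
  - by move=> x _; rewrite lee_fin; apply: norm_avg => //; exact: integ_locint.
by rewrite lsum_avg_ge0//; [exact: integ_abs_lty|exact: integ_norm].
Qed.

Lemma lsum_avg h : integ h -> lsum (avg A h) = lint h.
Proof.
move=> hi; have hp := integ_pos hi; have hn := integ_pos (integN hi).
rewrite (lint_posneg hi) /lsum.
have -> : (fun y => avg A h (latpt y)) = fun x => avg A (fun y => Num.max (h y) 0) (latpt x)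
     - avg A (fun y => Num.max (- h y) 0) (latpt x).
  by apply/funext => x; rewrite -avg_posneg//; exact: integ_locint.
rewrite lintB; try exact: lsummable_avg.
by congr (_ - _); congr fine; apply: lsum_avg_ge0 => // x; rewrite le_max lexx orbT.
Qed.

Lemma lsum_dif h : integ h -> lsummable h ->
  lsummable (dif A h) /\ lsum (dif A h) = lsum h - lint h.
Proof.
move=> hi hs; have ha := lsummable_avg hi; split; first exact: integB.
by rewrite /lsum lintB// -[X in _ - X]/(lsum _) lsum_avg.
Qed.

(** The first difference subtracts the integral; its result has integral 0, so the later ones leave
    the sum unchanged. *)
Lemma lsum_iter_dif k h : integ h -> lsummable h ->
  lsummable (iter k.+1 (dif A) h) /\ lsum (iter k.+1 (dif A) h) = lsum h - lint h.
Proof.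
move=> hi hs; elim: k => [|k [IH1 IH2]]; first exact: lsum_dif.
have l0 : lint (iter k.+1 (dif A) h) = 0.
  by rewrite iterS lint_dif//; exact: integ_iter_dif.
have := integ_iter_dif uA vQ k.+1 hi; move: IH1 IH2 l0; rewrite [iter k.+2 _ _]iterS.
move: (iter k.+1 (dif A) h) => g gs <- g0 gi.
by have [h1 ->] := lsum_dif gi gs; rewrite g0 subr0.
Qed.

End Tiling.

(** * Decay of iterated differences *)

Section MeanValue.
Variable R : realType.

Lemma mvt01 (f df : R -> R) :
  (forall t : R, 0 <= t <= 1 -> is_derive t (1 : R) f (df t)) ->
  exists2 c, 0 <= c <= 1 & f 1 - f 0 = df c.
Proof.
move=> fd; have [|t t01|c c01 ->] := @MVT_segment R f df 0 1 ler01.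
- by move=> t; rewrite in_itv/= => /andP[t0 t1]; apply: fd; rewrite !ltW.
- apply: derivable_within_continuous => u; rewrite in_itv/= => u01.
  by have [] := fd u u01.
- by exists c; [rewrite in_itv/= in c01|rewrite subr0 mulr1].
Qed.

(* Symbol estimates in the variable [u = ln |x|]: the first [m] derivatives of [g] are
   bounded by [C * w]. *)
Fixpoint Der m (C : R) (w g : R -> R) : Prop :=
  (forall u, `|g u| <= C * w u) /\
  if m is m'.+1 then exists g', (forall u, is_derive u (1 : R) g (g' u)) /\ Der m' C w g'
  else True.

Lemma Der_bound m C w g : Der m C w g -> forall u, `|g u| <= C * w u.
Proof. by case: m => [|m] []. Qed.

End MeanValue.

Section Symbols.
Variables (R : realType) (d : nat).
Local Notation V := 'rV[R]_d.
Implicit Types (f g : V -> R) (W : V -> R).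
Variable rho : R.
Hypothesis rho0 : 0 <= rho.

(** Only off the origin, where the radial functions considered may be singular. *)
Definition dirder f (y : V) f' :=
  forall x (t : R), x + t *: y != 0 -> is_derive t (1 : R) (fun t : R => f (x + t *: y)) (f' (x + t *: y)).

(* Each derivative of [f] in a direction of length at most [rho] gains a factor [1 / |x|]. *)
Fixpoint Sym m W f : Prop :=
  (forall x, x != 0 -> `|f x| <= W x) /\
  if m is m'.+1 then forall y, enorm y <= rho -> exists f', dirder f y f' /\
     Sym m' (fun x => W x / enorm x) f'
  else True.

Lemma Sym_bound m W f : Sym m W f -> forall x, x != 0 -> `|f x| <= W x.
Proof. by case: m => [|m] []. Qed.

Lemma Sym_le m W W' f : (forall x, x != 0 -> W x <= W' x) -> Sym m W f -> Sym m W' f.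
Proof.
elim: m W W' f => [|m IH] W W' f WW' [h1 h2]; split => //.
- by move=> x x0; exact: le_trans (h1 x x0) (WW' x x0).
- by move=> x x0; exact: le_trans (h1 x x0) (WW' x x0).
move=> y yr; have [f' [h3 h4]] := h2 y yr; exists f'; split => //.
by apply: IH h4 => x x0; rewrite ler_wpM2r ?invr_ge0 ?enorm_ge0// WW'.
Qed.

Lemma SymS m W f : Sym m.+1 W f -> Sym m W f.
Proof.
elim: m W f => [|m IH] W f [h1 h2]; split => // y yr.
by have [f' [h3 h4]] := h2 y yr; exists f'; split => //; exact: IH.
Qed.

Lemma SymD m W W' f g : Sym m W f -> Sym m W' g -> Sym m (fun x => W x + W' x) (fun x => f x + g x).
Proof.
elim: m W W' f g => [|m IH] W W' f g [f1 f2] [g1 g2]; split => //.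
- by move=> x x0; rewrite (le_trans (ler_normD _ _))// lerD ?f1 ?g1.
- by move=> x x0; rewrite (le_trans (ler_normD _ _))// lerD ?f1 ?g1.
move=> y yr; have [f' [f3 f4]] := f2 y yr; have [g' [g3 g4]] := g2 y yr.
exists (fun x => f' x + g' x); split.
  move=> x t xt; have := f3 x t xt; have := g3 x t xt => ? ?.
  exact: is_deriveD.
by apply: Sym_le (IH _ _ _ _ f4 g4) => x _; rewrite mulrDl.
Qed.

Lemma SymZ m W c f : Sym m W f -> Sym m (fun x => `|c| * W x) (fun x => c * f x).
Proof.
elim: m W f => [|m IH] W f [f1 f2]; split => //.
- by move=> x x0; rewrite normrM ler_wpM2l// f1.
- by move=> x x0; rewrite normrM ler_wpM2l// f1.
move=> y yr; have [f' [f3 f4]] := f2 y yr.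
exists (fun x => c * f' x); split.
  move=> x t xt; have ? := f3 x t xt.
  exact: is_deriveZ.
by apply: Sym_le (IH _ _ f4) => x _; rewrite mulrA.
Qed.

(** Leibniz rule: each derivative doubles the number of terms, hence [2 ^+ m]. *)
Lemma SymM m W W' f g : Sym m W f -> Sym m W' g ->
  Sym m (fun x => 2 ^+ m * W x * W' x) (fun x => f x * g x).
Proof.
elim: m W W' f g => [|m IH] W W' f g fs gs.
  case: fs gs => f1 _ [g1 _]; split => // x x0.
  by rewrite normrM mul1r ler_pM// ?f1 ?g1.
have f1 := Sym_bound fs; have g1 := Sym_bound gs.
case: (fs) (gs) => _ f2 [_ g2]; split.
  move=> x x0; rewrite normrM -mulrA.
  have WW0 : 0 <= W x * W' x.
    by rewrite mulr_ge0//; [exact: le_trans (normr_ge0 _) (f1 x x0)|exact: le_trans (normr_ge0 _) (g1 x x0)].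
  apply: le_trans (_ : W x * W' x <= _); first by rewrite ler_pM// ?f1 ?g1.
  by rewrite ler_peMl// exprn_ege1// ler1n.
move=> y yr; have [f' [f3 f4]] := f2 y yr; have [g' [g3 g4]] := g2 y yr.
exists (fun x => f' x * g x + f x * g' x); split.
  move=> x t xt; have ? := f3 x t xt; have ? := g3 x t xt.
  apply: is_derive_eq; rewrite addrC; congr (_ + _); last exact: mulrC.
have h1 := IH _ _ _ _ f4 (SymS gs).
have h2 := IH _ _ _ _ (SymS fs) g4.
apply: Sym_le (SymD h1 h2) => x _; rewrite exprS.
by rewrite le_eqVlt; apply/orP; left; apply/eqP; ring.
Qed.

(** The derivative of [ln |x|] in direction [y]. Directional derivatives of [lrad] and of [qrad],
    which is [|x|^-2], are polynomials in these same functions, so only these two need estimates. *)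
Definition lrad (y x : V) : R := dot x y / dot x x.
Definition qrad (x : V) : R := (dot x x)^-1.

Lemma dot_neq0 (x : V) : x != 0 -> dot x x != 0.
Proof. by rewrite -sqr_enorm expf_eq0/= enorm_eq0. Qed.

Lemma is_derive_dot (x y z : V) t :
  is_derive t (1 : R) (fun t : R => dot (x + t *: y) z) (dot y z).
Proof.
have -> : (fun t : R => dot (x + t *: y) z) = (fun t : R => dot x z + t * dot y z).
  by apply/funext => s; rewrite dotDl dotZl.
by apply: is_derive_eq; rewrite /GRing.scale/=; ring.
Qed.

Lemma is_derive_dot2 (x y : V) (t : R) :
  is_derive t (1 : R) (fun t : R => dot (x + t *: y) (x + t *: y)) (2 * dot (x + t *: y) y).
Proof.
have -> : (fun t : R => dot (x + t *: y) (x + t *: y)) =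
   (fun t : R => dot x x + (2 * dot x y) * t + dot y y * t ^+ 2).
  apply/funext => s; rewrite !(dotDl, dotDr, dotZl, dotZr) (dotC y x); ring.
apply: is_derive_eq; rewrite dotDl dotZl.
rewrite /= !scaler1 /GRing.scale/=; ring.
Qed.

Lemma dirder_qrad y : dirder qrad y (fun x => -2 * (qrad x * lrad y x)).
Proof.
move=> x t xt; have h := is_derive_dot2 x y t.
have := is_deriveV (f := fun t : R => dot (x + t *: y) (x + t *: y)) (dot_neq0 xt) h.
move=> h'; apply: (is_derive_eq (df := _) h').
rewrite /qrad /lrad /GRing.scale/= expr2 invfM; ring.
Qed.

Lemma dirder_lrad y z :
  dirder (lrad z) y (fun x => dot y z * qrad x + -2 * (lrad z x * lrad y x)).
Proof.
move=> x t xt; have h := is_derive_dot2 x y t.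
have h1 := is_deriveV (f := fun t : R => dot (x + t *: y) (x + t *: y)) (dot_neq0 xt) h.
have h2 := is_derive_dot x y z t.
have h3 := is_deriveM h2 h1.
apply: (is_derive_eq (df := _) h3).
rewrite /qrad /lrad /GRing.scale/= expr2 invfM; ring.
Qed.

Lemma lrad_bound y x : enorm y <= rho -> x != 0 -> `|lrad y x| <= rho / enorm x.
Proof.
move=> yr x0; rewrite /lrad -sqr_enorm normrM normfV (ger0_norm (exprn_ge0 _ (enorm_ge0 _))).
have xp : 0 < enorm x by rewrite enorm_gt0.
rewrite ler_pdivrMr ?exprn_gt0// expr2 mulrA divfK ?gt_eqF//.
by apply: le_trans (normr_dot_le _ _) _; rewrite mulrC ler_wpM2r// enorm_ge0.
Qed.

(** Joint induction: a derivative of either function is a combination of [qrad] and of products of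
    the two, to which the bounds of order [m] apply. *)
Lemma Sym_lqrad m : exists2 K : R, 0 <= K &
  (forall y, enorm y <= rho -> Sym m (fun x => K / enorm x) (lrad y)) /\
  Sym m (fun x => K / enorm x ^+ 2) qrad.
Proof.
have nz2 (x : V) : `|qrad x| = (enorm x ^+ 2)^-1.
  by rewrite /qrad -sqr_enorm ger0_norm// invr_ge0 exprn_ge0// enorm_ge0.
elim: m => [|m [K K0 [Hl Hq]]].
  exists (rho + 1); first by rewrite addr_ge0.
  split.
    move=> y yr; split => // x x0; apply: le_trans (lrad_bound yr x0) _.
    by rewrite ler_wpM2r ?invr_ge0 ?enorm_ge0// lerDl.
  split => // x x0; rewrite nz2 ler_peMl ?invr_ge0 ?exprn_ge0 ?enorm_ge0//.
  by rewrite lerDr.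
(* [rho + 1] bounds the functions themselves, the rest their derivatives, with
   [|dot y z| <= rho ^+ 2]. *)
pose K' := rho + 1 + (rho ^+ 2 * K + 2 * (2 ^+ m * K * K)).
have K2 : 0 <= rho ^+ 2 * K + 2 * (2 ^+ m * K * K).
  by rewrite addr_ge0// ?mulr_ge0// ?exprn_ge0.
exists K'; first by rewrite addr_ge0// addr_ge0.
split.
  move=> z zr; split.
    move=> x x0; apply: le_trans (lrad_bound zr x0) _.
    by rewrite ler_wpM2r ?invr_ge0 ?enorm_ge0// /K' -addrA lerDl addr_ge0.
  move=> y yr; exists (fun x => dot y z * qrad x + -2 * (lrad z x * lrad y x)).
  split; first exact: dirder_lrad.
  have h1 := SymZ (dot y z) Hq.
  have h2 := SymZ (-2) (SymM (Hl _ zr) (Hl _ yr)).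
  apply: Sym_le (SymD h1 h2) => x x0.
  have xp : 0 < enorm x by rewrite enorm_gt0.
  have dyz : `|dot y z| <= rho ^+ 2.
    by apply: le_trans (normr_dot_le _ _) _; rewrite expr2 ler_pM// enorm_ge0.
  rewrite normrN (ger0_norm (ler0n _ 2)).
  have -> : K' / enorm x / enorm x = K' / enorm x ^+ 2 by rewrite expr2 invfM mulrA.
  have -> : `|dot y z| * (K / enorm x ^+ 2) + 2 * (2 ^+ m * (K / enorm x) * (K / enorm x)) =
    (`|dot y z| * K + 2 * (2 ^+ m * K * K)) / enorm x ^+ 2.
    by rewrite expr2 invfM; ring.
  rewrite ler_wpM2r ?invr_ge0 ?exprn_ge0 ?enorm_ge0//.
  rewrite /K'; apply: ler_wpDl; first by rewrite addr_ge0.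
  by rewrite lerD2r ler_wpM2r.
split.
  move=> x x0; rewrite nz2 ler_peMl ?invr_ge0 ?exprn_ge0 ?enorm_ge0//.
  by rewrite /K' -addrA addrCA lerDl addr_ge0.
move=> y yr; exists (fun x => -2 * (qrad x * lrad y x)); split; first exact: dirder_qrad.
apply: Sym_le (SymZ (-2) (SymM Hq (Hl _ yr))) => x x0.
rewrite normrN (ger0_norm (ler0n _ 2)).
have -> : 2 * (2 ^+ m * (K / enorm x ^+ 2) * (K / enorm x)) =
   2 * (2 ^+ m * K * K) / enorm x ^+ 2 / enorm x by ring.
rewrite !ler_wpM2r ?invr_ge0 ?exprn_ge0 ?enorm_ge0//.
rewrite /K' addrA lerDr addr_ge0// ?addr_ge0// mulr_ge0// exprn_ge0//.
Qed.

Definition radial (g : R -> R) (x : V) : R := g (ln (enorm x)).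

Lemma ln_enorm (x : V) : ln (enorm x) = 2^-1 * ln (dot x x).
Proof.
have [->|x0] := eqVneq x 0.
  by rewrite -sqr_enorm enorm0 expr0n !ln0 ?mulr0.
rewrite -sqr_enorm lnXn ?enorm_gt0//.
by rewrite -[ln _ *+ 2]mulr_natl mulKf.
Qed.

Lemma is_derive_ln_enorm (x y : V) (t : R) : x + t *: y != 0 ->
  is_derive t (1 : R) (fun t : R => ln (enorm (x + t *: y))) (lrad y (x + t *: y)).
Proof.
move=> xt; have h := is_derive_dot2 x y t.
have p : 0 < dot (x + t *: y) (x + t *: y) by rewrite lt0r dot_neq0// dot_ge0.
have hl := is_derive1_comp (is_derive1_ln p) h.
have hl2 := is_deriveZ (2^-1) hl.
have -> : lrad y (x + t *: y) = 2^-1 *: ((dot (x + t *: y) (x + t *: y))^-1 * (2 * dot (x + t *: y) y)).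
  by rewrite /lrad /GRing.scale/=; field; rewrite gt_eqF.
have -> : (fun t : R => ln (enorm (x + t *: y))) =
    2^-1 \*: (ln (R:=R) \o (fun t : R => dot (x + t *: y) (x + t *: y))).
  by apply/funext => s; rewrite ln_enorm.
exact: hl2.
Qed.

(** Chain rule with [lrad]. That [K] does not depend on [g], [w] or [C] is what later allows limits
    and Taylor expansions over whole families. *)
Lemma Sym_radial m : exists2 K : R, 0 <= K & forall C (w g : R -> R), 0 <= C -> (forall u, 0 <= w u) ->
  Der m C w g -> Sym m (fun x => K * (C * w (ln (enorm x)))) (radial g).
Proof.
elim: m => [|m [K K0 IH]].
  exists 1 => // C w g C0 w0 [g0 _]; split => // x x0; rewrite mul1r; exact: g0.
have [K1 K10 [Hl _]] := Sym_lqrad m.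
exists (1 + 2 ^+ m * K * K1); first by rewrite addr_ge0// !mulr_ge0// exprn_ge0.
move=> C w g C0 w0 [g0 [g' [g'd g'D]]].
have p x : 0 <= C * w (ln (enorm x)) by rewrite mulr_ge0.
split.
  move=> x x0; apply: le_trans (g0 _) _.
  by rewrite ler_peMl// lerDl !mulr_ge0// exprn_ge0.
move=> y yr; exists (fun x => radial g' x * lrad y x); split.
  move=> x t xt; have h := is_derive_ln_enorm xt.
  exact: (is_derive1_comp (g'd _) h).
apply: Sym_le (SymM (IH _ _ _ C0 w0 g'D) (Hl _ yr)) => x x0.
have -> : 2 ^+ m * (K * (C * w (ln (enorm x)))) * (K1 / enorm x) =
   2 ^+ m * K * K1 * (C * w (ln (enorm x))) / enorm x by ring.
rewrite ler_wpM2r ?invr_ge0 ?enorm_ge0// ler_wpM2r//.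
by rewrite lerDr.
Qed.

Definition dl (y : V) f : V -> R := fun x => f (x + y) - f x.
Definition dls (ys : seq V) f := foldr dl f ys.

Lemma dls_ext ys f g x : all (fun y => enorm y <= rho) ys ->
  (forall x', enorm (x' - x) <= (size ys)%:R * rho -> f x' = g x') -> dls ys f x = dls ys g x.
Proof.
elim: ys x => [|y ys IH] x /=; first by move=> _ h; apply: h; rewrite subrr enorm0 mul0r.
move=> /andP[yr ysr] h; rewrite /dl; congr (_ - _); apply: IH => // x' x'x; apply: h.
  have -> : x' - x = (x' - (x + y)) + y by rewrite opprD addrA subrK.
  apply: le_trans (enormD _ _) _.
  by rewrite -[(size ys).+1]addn1 natrD mulrDl mul1r lerD.
by apply: le_trans x'x _; rewrite ler_wpM2r// ler_nat.
Qed.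

Lemma is_derive_dls ys f y f' x (t : R) : dirder f y f' -> all (fun y => enorm y <= rho) ys ->
  (forall x', enorm (x' - (x + t *: y)) <= (size ys)%:R * rho -> x' != 0) ->
  is_derive t (1 : R) (fun t : R => dls ys f (x + t *: y)) (dls ys f' (x + t *: y)).
Proof.
move=> ff'; elim: ys x => [|z ys IH] x /=.
  by move=> _ h; apply: ff'; apply: h; rewrite subrr enorm0 mul0r.
move=> /andP[zr ysr] h.
have h1 : is_derive t (1 : R) (fun t : R => dls ys f (x + t *: y)) (dls ys f' (x + t *: y)).
  apply: IH => // x' x'x; apply: h; apply: le_trans x'x _.
  by rewrite ler_wpM2r// ler_nat.
have h2 : is_derive t (1 : R) (fun t : R => dls ys f (x + z + t *: y)) (dls ys f' (x + z + t *: y)).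
  apply: IH => // x' x'x; apply: h.
  have -> : x' - (x + t *: y) = (x' - (x + z + t *: y)) + z.
    by rewrite (addrAC x z) [- (x + _ + z)]opprD addrA subrK.
  apply: le_trans (enormD _ _) _.
  by rewrite -[(size ys).+1]addn1 natrD mulrDl mul1r lerD.
have := is_deriveB h2 h1.
by rewrite /dl addrAC; under [X in is_derive _ _ X _ -> _]eq_fun do rewrite [x + z + _]addrAC.
Qed.

(** By the mean value theorem each difference is a directional derivative at a nearby point and
    gains a factor [1 / |x|]; the hypothesis keeps all these points away from 0. *)
Lemma dls_bound m W f x B ys : Sym m W f -> size ys = m -> all (fun y => enorm y <= rho) ys ->
  (forall x', enorm (x' - x) <= m%:R * rho -> x' != 0 /\ W x' / enorm x' ^+ m <= B) ->
  `|dls ys f x| <= B.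
Proof.
elim: m W f x ys => [|m IH] W f x ys.
  move=> [f0 _] /size0nil -> _ h; have [|x0 WB] := h x.
    by rewrite subrr enorm0 mul0r.
  by apply: le_trans (f0 x x0) _; rewrite expr0 divr1 in WB.
case: ys => // y ys fS [sys] /= /andP[yr ysr] h.
case: fS => _ /(_ y yr)[f' [ff' fS']].
have [t t01|c /andP[c0 c1] hc] := @mvt01 R (fun t => dls ys f (x + t *: y)) (fun t => dls ys f' (x + t *: y)).
  have txy : enorm (x + t *: y - x) <= rho.
    rewrite addrC addKr enormZ; case/andP: t01 => t0 t1.
    by rewrite ger0_norm// (le_trans _ yr)// ler_piMl// enorm_ge0.
  apply: is_derive_dls => // x' x'x; apply: (h x' _).1.
  apply: le_trans (enorm_tri _ (x + t *: y) _) _.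
  by rewrite mulrSr mulrDl mul1r lerD// -sys.
rewrite scale1r scale0r addr0 in hc; rewrite /dl hc.
apply: (IH (fun x => W x / enorm x)) => // x' x'x.
have cxy : enorm (x + c *: y - x) <= rho.
  rewrite addrC addKr enormZ.
  by rewrite ger0_norm// (le_trans _ yr)// ler_piMl// enorm_ge0.
have [|x'0 WB] := h x'.
  apply: le_trans (enorm_tri _ (x + c *: y) _) _.
  by rewrite mulrSr mulrDl mul1r lerD.
split => //; apply: le_trans WB; rewrite exprS invfM mulrA.
by rewrite lexx.
Qed.

End Symbols.

(** * Integrability of powers of |x| *)

Section PowerIntegrals.
Variables (R : realType) (d : nat).
Local Notation V := 'rV[R]_d.
Local Notation mu := (leb R d).

Lemma lint_mct (F : nat -> V -> R) (f : V -> R) (M : R) : (forall k, integ (F k)) -> (forall k x, 0 <= F k x) ->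
  (forall k x, F k x <= F k.+1 x) -> measurable_fun setT f ->
  (forall x, F ^~ x @ \oo --> f x) -> (forall k, lint (F k) <= M) -> integ f.
Proof.
move=> Fi F0 Fmono mf Ff FM.
have nd x : {homo (fun k => (F k x)%:E) : m n / (m <= n)%N >-> (m <= n)%E}.
  apply/nondecreasing_seqP => k; by rewrite lee_fin.
have ndR x : {homo (F ^~ x) : m n / (m <= n)%N >-> m <= n} by exact/nondecreasing_seqP.
have f0 x : 0 <= f x.
  apply: le_trans (F0 0%N x) _; rewrite -(cvg_lim (@Rhausdorff R) (Ff x)).
  apply: nondecreasing_cvgn_le; first exact: ndR.
  by apply/cvg_ex; exists (f x).
apply: integP => //.
have -> : (\int[mu]_x `|f x|%:E = \int[mu]_x limn (fun k => (F k x)%:E))%E.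
  apply: eq_integral => x _; rewrite ger0_norm//; apply/esym/cvg_lim => //.
  by apply: cvg_EFin; [exact: nearW|exact: Ff].
rewrite (@monotone_convergence _ _ _ mu setT measurableT (fun k x => (F k x)%:E)); first last.
- by move=> x _; exact: nd.
- by move=> k x _; rewrite lee_fin.
- by move=> k; apply/measurable_EFinP; exact: integ_measurable.
apply: (@le_lt_trans _ _ M%:E); last exact: ltry.
apply: lime_le.
  apply: ereal_nondecreasing_is_cvgn => m n mn; apply: ge0_le_integral => //.
  - by move=> x _; rewrite lee_fin.
  - by apply/measurable_EFinP; exact: integ_measurable.
  - by apply/measurable_EFinP; exact: integ_measurable.
  - by move=> x _; exact: nd.
by apply: nearW => k; rewrite -integ_fin// lee_fin.
Qed.

(** The power [|x|^-b]; as [ln 0 = 0], its value at the origin is 1. *)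
Definition pw (b : R) (x : V) : R := expR (- b * ln (enorm x)).

Lemma pw_ge0 b x : 0 <= pw b x. Proof. exact: expR_ge0. Qed.

Lemma measurable_ln_enorm : measurable_fun setT (fun x : V => ln (enorm x)).
Proof. by apply: measurableT_comp (@measurable_enorm R d); exact: measurable_ln. Qed.

Lemma measurable_pw b : measurable_fun setT (pw b).
Proof.
apply: measurableT_comp; first exact: measurable_expR.
apply: measurable_funM => //; exact: measurable_ln_enorm.
Qed.

Definition ann (r s : R) : set V := [set x | r <= enorm x < s].

Lemma in_ann r s x : (x \in ann r s) = (r <= enorm x < s).
Proof. by apply/idP/idP; rewrite inE. Qed.

Lemma ann_split r s t x : r <= s -> s <= t ->
  \1_(ann r t) x = \1_(ann r s) x + \1_(ann s t) x :> R.
Proof.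
move=> rs st; rewrite !indicE !in_ann -natrD; congr (_%:R).
rewrite !(leNgt _ (enorm x)).
by case: (ltP (enorm x) r) => h1; case: (ltP (enorm x) s) => h2; case: (ltP (enorm x) t) => h3 //=;
  exfalso; lra.
Qed.

Lemma measurable_ann r s : measurable (ann r s).
Proof.
have -> : ann r s = ~` eball d r `&` eball d s.
  apply/seteqP; split => x; rewrite /ann /eball/=.
    by move=> /andP[h1 h2]; split => //; apply/negP; rewrite -leNgt.
  by move=> [/negP]; rewrite -leNgt => -> ->.
by apply: measurableI; [apply: measurableC|]; exact: measurable_eball.
Qed.

Lemma pw_scale b (t : R) x : 0 < t -> x != 0 -> pw b (t *: x) = expR (- b * ln t) * pw b x.
Proof.
move=> t0 x0; rewrite /pw enormZ gtr0_norm// lnM ?qualifE/= ?enorm_gt0//.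
by rewrite mulrDr expRD.
Qed.

Lemma pw_ann_le b r s x : 0 < r -> ann r s x -> pw b x <= expR (`|b| * (`|ln r| + `|ln s|)).
Proof.
move=> r0 /andP[rx xs]; rewrite ler_expR.
have x0 : 0 < enorm x by exact: lt_le_trans rx.
apply: le_trans (ler_norm _) _; rewrite normrM normrN ler_wpM2l//.
have h1 : ln r <= ln (enorm x) by rewrite ler_ln.
have h2 : ln (enorm x) <= ln s by rewrite ler_ln// ?ltW// qualifE/= (lt_trans x0).
have := ler_norm (ln s); have := ler_norm (- ln r); rewrite normrN.
have := normr_ge0 (ln s); have := normr_ge0 (ln r).
rewrite ler_norml => *; apply/andP; split; lra.
Qed.

Lemma integ_ann_bounded (f : V -> R) (r s M : R) : 0 <= M -> measurable_fun setT f ->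
  (forall x, ann r s x -> `|f x| <= M) -> integ (fun x => \1_(ann r s) x * f x).
Proof.
move=> M0 mf fM; apply: (@le_integ _ _ _ (fun x => M * \1_(eball d s) x)).
- by apply: measurable_funM => //; apply: measurable_indic; exact: measurable_ann.
- move=> x; rewrite normrM indicE normr_nat.
  have [xa|xa] := boolP (x \in ann r s); last by rewrite mul0r mulr_ge0.
  rewrite mul1r indicE mem_set ?mulr1; first by apply: fM; rewrite inE in xa.
  by move: xa; rewrite inE => /andP[].
- by apply: integZ; apply: integ_indic; [exact: measurable_eball|exact: leb_eball_lty].
Qed.

Lemma integ_pw_ann b r s : 0 < r -> integ (fun x => \1_(ann r s) x * pw b x).
Proof.
move=> r0; apply: (@integ_ann_bounded _ _ _ (expR (`|b| * (`|ln r| + `|ln s|)))).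
- exact: expR_ge0.
- exact: measurable_pw.
- by move=> x xa; rewrite ger0_norm ?pw_ge0//; exact: pw_ann_le xa.
Qed.

Lemma lint_pw_ann_scale b r s t : 0 < t -> 0 < r ->
  lint (fun x => \1_(ann (t * r) (t * s)) x * pw b x) =
  expR ((d%:R - b) * ln t) * lint (fun x => \1_(ann r s) x * pw b x).
Proof.
move=> t0 r0; rewrite (lint_affine 0 t0); last by apply: integ_pw_ann; rewrite mulr_gt0.
have -> : (fun x : V => \1_(ann (t * r) (t * s)) (t *: x + 0) * pw b (t *: x + 0)) =
   (fun x => expR (- b * ln t) * (\1_(ann r s) x * pw b x)).
  apply/funext => x; rewrite addr0.
  have -> : \1_(ann (t * r) (t * s)) (t *: x) = \1_(ann r s) x :> R.
    by apply: indic_iff; rewrite /ann/= enormZ gtr0_norm// ler_pM2l// ltr_pM2l.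
  have [x0|x0] := eqVneq x 0; last by rewrite pw_scale// mulrCA.
  by rewrite indicE memNset ?mul0r ?mulr0//= /ann/= x0 enorm0 leNgt r0.
rewrite lintZ; last exact: integ_pw_ann.
rewrite mulrA -{1}(lnK t0) -expRM_natl -expRD; congr (expR _ * _).
by rewrite mulrBl mulNr.
Qed.

(** Dyadic annuli: dilation by 2 multiplies the integrals by [q = 2 ^ (d - b) < 1], so the integrals
    [I_k] over the first [k] annuli satisfy [I_(k+1) = c + q I_k] and stay below [c / (1 - q)]. *)
Lemma integ_pw_ge b r : d%:R < b -> 0 < r -> integ (fun x => \1_(~` eball d r) x * pw b x).
Proof.
move=> db r0; pose F k x := \1_(ann r (2 ^+ k * r)) x * pw b x.
have Fi k : integ (F k) by exact: integ_pw_ann.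
pose q := expR ((d%:R - b) * ln 2); pose c := lint (F 1%N).
have q1 : q < 1 by rewrite /q expR_lt1 pmulr_llt0 ?ln_gt0 ?ltr1n// subr_lt0.
have c0 : 0 <= c by apply: lint_ge0 => x; rewrite mulr_ge0// pw_ge0.
apply: (@lint_mct F _ (c / (1 - q))) => //.
- by move=> k x; rewrite mulr_ge0// pw_ge0.
- move=> k x; rewrite /F ler_wpM2r ?pw_ge0// !indicE ler_nat.
  have [|] := boolP (x \in ann r (2 ^+ k * r)) => //; rewrite inE => /andP[rx xk].
  rewrite mem_set// /ann/= rx (lt_le_trans xk)// ler_pM2r// exprS ler_peMl ?exprn_ge0// ler1n//.
- apply: measurable_funM; last exact: measurable_pw.
  by apply: measurable_indic; apply: measurableC; exact: measurable_eball.
- move=> x; have [rx|xr] := leP r (enorm x); last first.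
    rewrite indicE memNset/=; last by apply.
    rewrite mul0r (_ : F ^~ x = fun=> 0); first exact: cvg_cst.
    by apply/funext => k; rewrite /F indicE memNset ?mul0r// /ann/= leNgt xr.
  rewrite indicE mem_set ?mul1r; last by rewrite /eball/=; apply/negP; rewrite -leNgt.
  apply: cvg_near_cst; near=> k; rewrite /F indicE mem_set ?mul1r//= /ann/= rx/=.
  rewrite -ltr_pdivrMr//; apply: (@lt_trans _ _ k%:R).
    by near: k; exact: nbhs_infty_gtr.
  by rewrite -natrX ltr_nat ltn_expl.
- have Fr k : lint (F k.+1) = c + q * lint (F k).
    have -> : F k.+1 = fun x => F 1%N x + \1_(ann (2 * r) (2 * (2 ^+ k * r))) x * pw b x.
      apply/funext => x; rewrite /F -mulrDl; congr (_ * _).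
      rewrite expr1 mulrA -exprS; apply: ann_split; first by lra.
      by rewrite ler_pM2r// exprS ler_peMr// exprn_ege1// ler1n.
    rewrite lintD//; last by apply: integ_pw_ann; rewrite mulr_gt0.
    by rewrite lint_pw_ann_scale.
  elim=> [|k IH].
    rewrite (_ : F 0%N = fun=> 0) ?lint0 ?divr_ge0 ?subr_ge0 ?(ltW q1)//.
    apply/funext => x; rewrite /F indicE memNset ?mul0r//= /ann/= expr0 mul1r => /andP[h1 h2].
    by rewrite leNgt h2 in h1.
  rewrite Fr; have q0 : 0 < 1 - q by rewrite subr_gt0.
  apply: (@le_trans _ _ (c + q * (c / (1 - q)))).
    by rewrite lerD2l ler_wpM2l// expR_ge0.
  by rewrite le_eqVlt; apply/orP; left; apply/eqP; field; rewrite gt_eqF.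
Unshelve. all: by end_near. Qed.

(** Punctured, since annuli exhaust only the complement of the origin. *)
Definition pball r : set V := [set x | 0 < enorm x < r].

Lemma measurable_pball r : measurable (pball r).
Proof.
have -> : pball r = ~` [set x | enorm x <= 0] `&` eball d r.
  apply/seteqP; split => x; rewrite /pball /eball/=.
    by move=> /andP[h1 h2]; split => //; apply/negP; rewrite -ltNge.
  by move=> [/negP]; rewrite -ltNge => -> ->.
apply: measurableI; [apply: measurableC|exact: measurable_eball].
by apply: measurable_set_le; exact: measurable_enorm.
Qed.

(** The same recursion with dilation by 1/2, where [q = 2 ^ (b - d) < 1]. *)
Lemma integ_pw_lt b r : b < d%:R -> 0 < r -> integ (fun x => \1_(pball r) x * pw b x).
Proof.
move=> db r0; pose F k x := \1_(ann (2^-1 ^+ k * r) r) x * pw b x.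
have h0 : (0 : R) < 2^-1 by rewrite invr_gt0.
have kp k : 0 < 2^-1 ^+ k * r by rewrite mulr_gt0// exprn_gt0.
have Fi k : integ (F k) by exact: integ_pw_ann.
pose q := expR ((d%:R - b) * ln 2^-1); pose c := lint (F 1%N).
have q1 : q < 1.
  rewrite /q expR_lt1 pmulr_rlt0 ?subr_gt0// ln_lt0// invr_gt0 ltr0n/=.
  by rewrite invf_lt1// ltr1n.
have c0 : 0 <= c by apply: lint_ge0 => x; rewrite mulr_ge0// pw_ge0.
have hk k : 2^-1 ^+ k.+1 * r <= 2^-1 ^+ k * r.
  by rewrite ler_pM2r// exprS ler_piMl ?exprn_ge0 ?ltW// invf_lt1// ltr1n.
apply: (@lint_mct F _ (c / (1 - q))) => //.
- by move=> k x; rewrite mulr_ge0// pw_ge0.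
- move=> k x; rewrite /F ler_wpM2r ?pw_ge0// !indicE ler_nat.
  have [|] := boolP (x \in ann (2^-1 ^+ k * r) r) => //; rewrite inE => /andP[rx xk].
  by rewrite mem_set// /ann/= xk (le_trans _ rx).
- apply: measurable_funM; last exact: measurable_pw.
  by apply: measurable_indic; exact: measurable_pball.
- move=> x; have [xr|xr] := pselect (pball r x); last first.
    rewrite indicE memNset// mul0r (_ : F ^~ x = fun=> 0); first exact: cvg_cst.
    apply/funext => k; rewrite /F indicE memNset ?mul0r// => /andP[h1 h2]; apply: xr.
    by rewrite /pball/= h2 (lt_le_trans _ h1).
  rewrite indicE mem_set ?mul1r//; case/andP: xr => x0 xr.
  apply: cvg_near_cst; near=> k; rewrite /F indicE mem_set ?mul1r//= /ann/= xr andbT.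
  rewrite exprVn ler_pdivrMl ?exprn_gt0// -ler_pdivrMr//.
  apply: (@le_trans _ _ k%:R).
    by near: k; exact: nbhs_infty_ger.
  by rewrite -natrX ler_nat ltnW// ltn_expl.
- have Fr k : lint (F k.+1) = c + q * lint (F k).
    have -> : F k.+1 = fun x => F 1%N x + \1_(ann (2^-1 * (2^-1 ^+ k * r)) (2^-1 * r)) x * pw b x.
      apply/funext => x; rewrite /F -mulrDl; congr (_ * _).
      rewrite expr1 mulrA -exprS addrC; apply: ann_split; last by lra.
      by rewrite ler_pM2r// exprS ler_piMr ?(ltW h0)// exprn_ile1 ?(ltW h0)// invf_le1// ler1n.
    rewrite lintD//; last by apply: integ_pw_ann; rewrite mulr_gt0.
    by rewrite lint_pw_ann_scale.
  elim=> [|k IH].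
    rewrite (_ : F 0%N = fun=> 0) ?lint0 ?divr_ge0 ?subr_ge0 ?(ltW q1)//.
    apply/funext => x; rewrite /F indicE memNset ?mul0r//= /ann/= expr0 mul1r => /andP[h1 h2].
    by rewrite leNgt h2 in h1.
  rewrite Fr; have q0 : 0 < 1 - q by rewrite subr_gt0.
  apply: (@le_trans _ _ (c + q * (c / (1 - q)))).
    by rewrite lerD2l ler_wpM2l// expR_ge0.
  by rewrite le_eqVlt; apply/orP; left; apply/eqP; field; rewrite gt_eqF.
Unshelve. all: by end_near. Qed.

End PowerIntegrals.

(** * Cell differences as averages of second differences *)

Section DifBounds.
Variables (R : realType) (d : nat) (A : 'M[R]_d).
Hypothesis uA : A \in unitmx.
Local Notation L := (lattice A).
Local Notation Q := (wigner_seitz L).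
Local Notation mu := (leb R d).
Local Notation V := 'rV[R]_d.
Hypothesis vQ : mu Q = 1%E.
Implicit Types (f g h : V -> R).
Local Notation latpt := (latpt uA).
Local Notation dif := (dif A).
Local Notation avg := (avg A).

Lemma ws0 : Q 0.
Proof. by move=> l _; rewrite enorm0 enorm_ge0. Qed.

Lemma locint_dl y f : locint f -> locint (dl y f).
Proof. by move=> fi; apply: locintB => //; exact: locint_shift. Qed.

Lemma dif_dl y f : locint f -> dif (dl y f) = dl y (dif f).
Proof.
move=> fi; apply/funext => x; rewrite /dif /dl.
rewrite (avgB uA)//; last exact: locint_shift.
by rewrite avg_shift; ring.
Qed.

Lemma iter_dif_dl k y f : locint f -> iter k dif (dl y f) = dl y (iter k dif f).
Proof.
move=> fi; elim: k => //= k ->; rewrite dif_dl//.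
exact: locint_iter_dif.
Qed.

Lemma dl_dlN y f x : dl y (dl (- y) f) x = 2 * f x - (f (x + y) + f (x - y)).
Proof. by rewrite /dl addrK; ring. Qed.

Lemma integ_dl_dlN f x : locint f -> integ (fun y => \1_Q y * dl y (dl (- y) f) x).
Proof.
move=> fi; have h1 := avg_integ_sym uA x fi; have h2 := avg_integ uA x fi.
have h3 := integZ (2 * f x) (integ_ws vQ).
have := integB h3 (integD h1 h2).
by congr integ; apply/funext => y; rewrite dl_dlN; ring.
Qed.

(** By symmetry of the cell, the values at [x + y] and [x - y] may be averaged together, which
    cancels the first-order terms. *)
Lemma dif_second f x : locint f -> dif f x = 2^-1 * lint (fun y => \1_Q y * dl y (dl (- y) f) x).
Proof.
move=> fi; have h1 := avg_integ_sym uA x fi; have h2 := avg_integ uA x fi.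
have h3 := integZ (2 * f x) (integ_ws vQ).
have -> : (fun y => \1_Q y * dl y (dl (- y) f) x) =
  (fun y => 2 * f x * \1_Q y - (\1_Q y * f (x + y) + \1_Q y * f (x - y))).
  by apply/funext => y; rewrite dl_dlN; ring.
rewrite lintB//; last exact: integD.
rewrite lintD// lintZ; last exact: integ_ws.
by rewrite lint_ws// /dif {1}/avg -/(avg f x) -(avg_sym uA)//; field.
Qed.

Definition pm (ys : seq V) : seq V := flatten [seq [:: y; - y] | y <- ys].

Lemma pm_rcons ys y : pm (rcons ys y) = pm ys ++ [:: y; - y].
Proof. by rewrite /pm map_rcons -cats1 flatten_cat. Qed.

Lemma size_pm ys : size (pm ys) = (2 * size ys)%N.
Proof. by elim: ys => //= y ys IH; rewrite IH mulnS. Qed.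

Lemma all_pm rho ys : all (fun y => enorm y <= rho) ys -> all (fun y => enorm y <= rho) (pm ys).
Proof. by elim: ys => //= y ys IH /andP[yr /IH ->]; rewrite enormN yr. Qed.

(** Since [dif] commutes with [dl], its [k]-th iterate is an iterated average of [2 k]-fold
    differences in directions [y], [- y] from the cell; a uniform bound on these passes to the
    average. *)
Lemma dif_iter_bound rho k f x B : (forall y, Q y -> enorm y <= rho) -> locint f ->
  (forall ys, size ys = k -> all (fun y => enorm y <= rho) ys -> `|dls (pm ys) f x| <= B) ->
  `|iter k dif f x| <= B.
Proof.
move=> hQ; elim: k f => [|k IH] f fi h; first exact: (h [::]).
have gi := locint_iter_dif uA vQ k fi.
have hB y : Q y -> `|dl y (dl (- y) (iter k dif f)) x| <= B.
  move=> Qy; rewrite -iter_dif_dl// -iter_dif_dl; last exact: locint_dl.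
  apply: IH => [|ys ysk ysr]; first by apply: locint_dl; exact: locint_dl.
  have := h (rcons ys y); rewrite size_rcons ysk all_rcons hQ// pm_rcons.
  by rewrite /dls foldr_cat; apply.
have B0 : 0 <= B by exact: le_trans (normr_ge0 _) (hB 0 ws0).
rewrite iterS dif_second// normrM ger0_norm//.
apply: (@le_trans _ _ (2^-1 * B)); last by rewrite ler_piMl// invf_le1// ler1n.
rewrite ler_wpM2l//.
have <- : lint (fun y => B * \1_Q y) = B by rewrite lintZ ?lint_ws ?mulr1//; exact: integ_ws.
apply: le_norm_lint2.
- exact: integ_dl_dlN.
- by apply: integZ; exact: integ_ws.
- move=> y; rewrite normrM indicE normr_nat.
  have [yQ|yQ] := boolP (y \in Q); last by rewrite mul0r mulr0.
  by rewrite mul1r mulr1; apply: hB; rewrite inE in yQ.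
Qed.

(** With [u = ln |x|] this is [|x|^-a] times the [delta]-th power of the larger of [|x|] and
    [1 / |x|]: a loss of [delta] in the exponent both far away and near 0. *)
Definition wt (a delta u : R) : R := expR (- a * u + delta * `|u|).

Lemma wt_ge0 a delta u : 0 <= wt a delta u. Proof. exact: expR_ge0. Qed.

Lemma wt_ln a delta (x : V) : 1 <= enorm x -> wt a delta (ln (enorm x)) = pw (a - delta) x.
Proof. by move=> x1; rewrite /wt /pw ger0_norm ?ln_ge0//; congr expR; ring. Qed.

Lemma wt_shift a delta u u' : 0 <= delta -> `|u' - u| <= ln 2 ->
  wt a delta u' <= expR ((`|a| + delta) * ln 2) * wt a delta u.
Proof.
move=> d0 uu; rewrite /wt -expRD ler_expR.
have h1 : - a * (u' - u) <= `|a| * ln 2.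
  by apply: le_trans (ler_norm _) _; rewrite normrM normrN ler_wpM2l.
have h2 : delta * `|u'| <= delta * (`|u| + ln 2).
  rewrite ler_wpM2l//; have := ler_normD u (u' - u); rewrite addrC subrK; lra.
lra.
Qed.

(** Far out, the points met by [2 k] differences have norms between [|x| / 2] and [2 |x|], hence
    comparable weights, and avoid the region of norm below [c] where [f] is not prescribed. [K] and
    [R0] do not depend on [c], [C] or [g]. *)
Lemma dif_symbol_bound k a delta : 0 <= delta -> exists2 K : R, 0 <= K &
  exists2 R0 : R, 1 <= R0 & forall C (g : R -> R) f c, 0 <= C -> 0 <= c ->
  Der (2 * k) C (wt a delta) g -> locint f -> (forall x, c <= enorm x -> f x = radial g x) ->
  forall x, R0 + 2 * c <= enorm x -> `|iter k dif f x| <= K * C * pw (a - delta + (2 * k)%:R) x.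
Proof.
move=> d0; have [rho rho0 hr] := ws_bounded uA.
have [K1 K10 HK] := @Sym_radial R d rho (ltW rho0) (2 * k).
pose m := (2 * k)%N; pose Kw := expR ((`|a| + delta) * ln 2).
have Kw0 : 0 <= Kw by exact: expR_ge0.
(* [K1] is the chain-rule constant, [Kw] compares weights at norms within a factor 2, and [2 ^+ m]
   comes from [|x'| >= |x| / 2]. *)
exists (K1 * Kw * 2 ^+ m); first by rewrite !mulr_ge0// exprn_ge0.
exists (1 + 2 * (m%:R * rho)); first by rewrite lerDl !mulr_ge0// ltW.
move=> C g f c C0 c0 gD fi fE x xR.
have h0 : 0 <= m%:R * rho by rewrite mulr_ge0// ltW.
have x1 : 1 <= enorm x by lra.
have near x' : enorm (x' - x) <= m%:R * rho -> [/\ enorm x / 2 <= enorm x', enorm x' <= 2 * enorm x & c <= enorm x'].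
  move=> x'x; have := ler_enormB x x'; rewrite enorm_distC => h1.
  have := ler_enormB x' x => h2; split; lra.
apply: (dif_iter_bound hr) => // ys ysk ysr.
have ysr' := all_pm ysr.
rewrite (@dls_ext R d rho (ltW rho0) (pm ys) f (radial g) x)//; last first.
  by move=> x' x'x; rewrite size_pm ysk in x'x; have [_ _ cx] := near x' x'x; exact: fE.
have := HK C (wt a delta) g C0 (wt_ge0 a delta) gD => gS.
apply: (dls_bound (ltW rho0) gS); rewrite ?size_pm ?ysk// => x' x'x.
have [h1 h2 _] := near x' x'x.
have x'0 : 0 < enorm x' by lra.
split; first by rewrite -enorm_gt0.
have lnx : `|ln (enorm x') - ln (enorm x)| <= ln 2.
  have h3 : ln (enorm x / 2) <= ln (enorm x') by rewrite ler_ln// ?qualifE/=; lra.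
  have h4 : ln (enorm x') <= ln (2 * enorm x) by rewrite ler_ln// ?qualifE/=; lra.
  move: h3 h4; rewrite ln_div ?qualifE/=; try lra.
  rewrite lnM ?qualifE/=; try lra.
  by move=> h3 h4; rewrite ler_norml; apply/andP; split; lra.
have -> : K1 * Kw * 2 ^+ m * C * pw (a - delta + m%:R) x =
   K1 * (C * (Kw * wt a delta (ln (enorm x)))) * (2 ^+ m / enorm x ^+ m).
  have -> : pw (a - delta + m%:R) x = wt a delta (ln (enorm x)) / enorm x ^+ m.
    rewrite wt_ln// /pw -[enorm x ^+ m](@lnK _ (enorm x ^+ m)) ?qualifE/= ?exprn_gt0//; last lra.
    rewrite lnXn; last lra.
    rewrite -expRN -expRD -mulr_natl; congr expR; ring.
  ring.
rewrite ler_pM//.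
- by rewrite !mulr_ge0// wt_ge0.
- by rewrite invr_ge0 exprn_ge0// enorm_ge0.
- by rewrite !ler_wpM2l// wt_shift.
- have xp : 0 < enorm x by lra.
  rewrite ler_pdivlMr ?exprn_gt0// mulrC ler_pdivrMr ?exprn_gt0// -exprMn.
  by rewrite lerXn2r ?nnegrE; lra.
Qed.

End DifBounds.

(** * Summability over the lattice *)

Section Summability.
Variables (R : realType) (d : nat) (A : 'M[R]_d).
Hypothesis uA : A \in unitmx.
Local Notation L := (lattice A).
Local Notation V := 'rV[R]_d.
Local Notation latpt := (latpt uA).
Implicit Types (f g h : V -> R).

Lemma latpt_near : exists2 rho : R, 0 < rho & forall y, enorm (y - latpt y) <= rho.
Proof.
have [rho rho0 hr] := ws_bounded uA; exists rho => // y.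
by apply: hr; exact: ws_latpt.
Qed.

Lemma le_lsummable g h : (forall l, L l -> `|g l| <= h l) -> lsummable uA h -> lsummable uA g.
Proof.
move=> gh; apply: le_integ; first exact: measurable_latpt.
by move=> y; apply: gh; exact: L_latpt.
Qed.

Lemma le_norm_lsum g h : (forall l, L l -> `|g l| <= h l) -> lsummable uA h ->
  `|lsum uA g| <= lsum uA h.
Proof.
move=> gh hs; apply: le_norm_lint2 => //; first exact: le_lsummable gh hs.
by move=> y; apply: gh; exact: L_latpt.
Qed.

Lemma lsum_dct (F : nat -> V -> R) f b : lsummable uA b ->
  (forall k l, L l -> `|F k l| <= b l) -> (forall l, L l -> F ^~ l @ \oo --> f l) ->
  lsummable uA f /\ (fun k => lsum uA (F k)) @ \oo --> lsum uA f.
Proof.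
move=> bs Fb Ff; apply: (lint_dct _ _ bs).
- by move=> k; exact: measurable_latpt.
- exact: measurable_latpt.
- by move=> k y; apply: Fb; exact: L_latpt.
- by move=> y; apply: Ff; exact: L_latpt.
Qed.

Definition bnd (b R0 : R) (l : V) : R := if enorm l < R0 then 1 else pw b l.

Lemma bnd_ge0 b R0 l : 0 <= bnd b R0 l.
Proof. by rewrite /bnd; case: ifP => // _; exact: pw_ge0. Qed.

(** Far out, the lattice point of [y] has at least half the norm of [y], so the sum is dominated by
    [2 ^ b] times the integral of [pw b]. *)
Lemma lsummable_bnd b R0 : d%:R < b -> 1 <= R0 -> lsummable uA (bnd b R0).
Proof.
move=> db R01; have [rho rho0 hr] := latpt_near.
have b0 : 0 <= b by apply: le_trans (ltW db).
pose R1 := R0 + 2 * rho + 2.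
apply: (@le_integ _ _ _ (fun y => \1_(eball d R1) y +
  expR (b * ln 2) * (\1_(~` eball d 1) y * pw b y))); first exact: measurable_latpt.
  move=> y; rewrite ger0_norm ?bnd_ge0//.
  have [yR|yR] := ltP (enorm y) R1.
    rewrite (@indicE _ _ (eball d R1)) mem_set//; apply: (@le_trans _ _ 1); last first.
      by rewrite lerDl !mulr_ge0 ?expR_ge0 ?pw_ge0.
    rewrite /bnd; case: ltP => // Rl; rewrite /pw -[leRHS]expR0 ler_expR.
    by rewrite mulNr oppr_le0 mulr_ge0// ln_ge0//; lra.
  rewrite (@indicE _ _ (eball d R1)) memNset ?add0r; last first.
    by rewrite /eball/=; apply/negP; rewrite -leNgt.
  rewrite indicE mem_set ?mul1r; last first.
    by rewrite /eball/=; apply/negP; rewrite -leNgt; move: yR; rewrite /R1; lra.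
  have yl : enorm y / 2 <= enorm (latpt y).
    have := ler_enormB y (latpt y); have := hr y; move: yR; rewrite /R1; lra.
  have yl2 : R0 <= enorm (latpt y).
    have := ler_enormB y (latpt y); have := hr y; move: yR; rewrite /R1; lra.
  rewrite /bnd ltNge yl2/= /pw -expRD ler_expR.
  have yp : 0 < enorm y by move: yR; rewrite /R1; lra.
  have : ln (enorm y / 2) <= ln (enorm (latpt y)) by rewrite ler_ln ?qualifE/=; lra.
  rewrite ln_div ?qualifE/=// => h.
  have : b * (ln (enorm y) - ln 2) <= b * ln (enorm (latpt y)) by rewrite ler_wpM2l.
  lra.
apply: integD.
  by apply: integ_indic; [exact: measurable_eball|exact: leb_eball_lty].
by apply: integZ; exact: integ_pw_ge.
Qed.

End Summability.

Local Open Scope complex_scope.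

(** * Complex powers as exponentials of ln |x| *)

Section ComplexParts.
Variable R : realType.
Local Notation C := R[i].
Implicit Types x y z c : C.

Lemma cReE z : cRe z = complex.Re z. Proof. by case: z. Qed.

Lemma ReD x y : complex.Re (x + y) = complex.Re x + complex.Re y. Proof. by case: x y => a b [c d]. Qed.
Lemma ImD x y : complex.Im (x + y) = complex.Im x + complex.Im y. Proof. by case: x y => a b [c d]. Qed.
Lemma ReN x : complex.Re (- x) = - complex.Re x. Proof. by case: x. Qed.
Lemma ImN x : complex.Im (- x) = - complex.Im x. Proof. by case: x. Qed.
Lemma ReM x y : complex.Re (x * y) = complex.Re x * complex.Re y - complex.Im x * complex.Im y.
Proof. by case: x y => a b [c d]. Qed.
Lemma ImM x y : complex.Im (x * y) = complex.Re x * complex.Im y + complex.Im x * complex.Re y.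
Proof. by case: x y => a b [c d]. Qed.

Lemma complex_ext x y : complex.Re x = complex.Re y -> complex.Im x = complex.Im y -> x = y.
Proof. by case: x y => a b [c d] /= -> ->. Qed.

(** The l1 norm: submultiplicative, equivalent to the modulus, and real-valued, whereas the modulus
    on [R[i]] is itself a complex number. *)
Definition cn z : R := `|complex.Re z| + `|complex.Im z|.

Lemma cn_ge0 z : 0 <= cn z. Proof. by rewrite addr_ge0. Qed.

Lemma cnD x y : cn (x + y) <= cn x + cn y.
Proof. rewrite /cn ReD ImD; have := ler_normD (complex.Re x) (complex.Re y); have := ler_normD (complex.Im x) (complex.Im y); lra. Qed.

Lemma cnN x : cn (- x) = cn x.
Proof. by rewrite /cn ReN ImN !normrN. Qed.

Lemma cnM x y : cn (x * y) <= cn x * cn y.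
Proof.
rewrite /cn ReM ImM.
have h1 := ler_normB (complex.Re x * complex.Re y) (complex.Im x * complex.Im y).
have h2 := ler_normD (complex.Re x * complex.Im y) (complex.Im x * complex.Re y).
rewrite !normrM in h1 h2; lra.
Qed.

Lemma Re_le_cn z : `|complex.Re z| <= cn z. Proof. by rewrite lerDl. Qed.
Lemma Im_le_cn z : `|complex.Im z| <= cn z. Proof. by rewrite lerDr. Qed.

Definition cderive (g g' : R -> C) := forall u : R,
  is_derive u (1 : R) (fun u => complex.Re (g u)) (complex.Re (g' u)) /\
  is_derive u (1 : R) (fun u => complex.Im (g u)) (complex.Im (g' u)).

Lemma cderiveD f f' g g' : cderive f f' -> cderive g g' ->
  cderive (fun u => f u + g u) (fun u => f' u + g' u).
Proof.
move=> hf hg u; have [f1 f2] := hf u; have [g1 g2] := hg u; split.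
  by under eq_fun do rewrite ReD; rewrite ReD; exact: is_deriveD.
by under eq_fun do rewrite ImD; rewrite ImD; exact: is_deriveD.
Qed.

Lemma cderiveM f f' g g' : cderive f f' -> cderive g g' ->
  cderive (fun u => f u * g u) (fun u => f' u * g u + f u * g' u).
Proof.
move=> hf hg u; have [f1 f2] := hf u; have [g1 g2] := hg u; split.
  under eq_fun do rewrite ReM; rewrite ReD !ReM.
  by apply: is_derive_eq; rewrite /GRing.scale/=; ring.
under eq_fun do rewrite ImM; rewrite ImD !ImM.
by apply: is_derive_eq; rewrite /GRing.scale/=; ring.
Qed.

Lemma cderive_cst c : cderive (fun=> c) (fun=> 0).
Proof. by move=> u; split; exact: is_derive_cst. Qed.

Lemma cderiveZ c g g' : cderive g g' -> cderive (fun u => c * g u) (fun u => c * g' u).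
Proof.
move=> hg; have := cderiveM (cderive_cst c) hg.
by congr cderive; apply/funext => u; rewrite mul0r add0r.
Qed.

Fixpoint DerC m (K : R) (w : R -> R) (g : R -> C) : Prop :=
  (forall u, cn (g u) <= K * w u) /\
  if m is m'.+1 then exists g', cderive g g' /\ DerC m' K w g' else True.

Lemma DerC_Re m K w g : DerC m K w g -> Der m K w (fun u => complex.Re (g u)).
Proof.
elim: m g => [|m IH] g [h1 h2]; split => //.
- by move=> u; exact: le_trans (Re_le_cn _) (h1 u).
- by move=> u; exact: le_trans (Re_le_cn _) (h1 u).
have [g' [gg' g'D]] := h2; exists (fun u => complex.Re (g' u)); split; last exact: IH.
by move=> u; have [] := gg' u.
Qed.

Lemma DerC_Im m K w g : DerC m K w g -> Der m K w (fun u => complex.Im (g u)).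
Proof.
elim: m g => [|m IH] g [h1 h2]; split => //.
- by move=> u; exact: le_trans (Im_le_cn _) (h1 u).
- by move=> u; exact: le_trans (Im_le_cn _) (h1 u).
have [g' [gg' g'D]] := h2; exists (fun u => complex.Im (g' u)); split; last exact: IH.
by move=> u; have [] := gg' u.
Qed.

Lemma DerC_le m K K' w g : (forall u, 0 <= w u) -> K <= K' -> DerC m K w g -> DerC m K' w g.
Proof.
move=> w0 KK; elim: m g => [|m IH] g [h1 h2]; split => //.
- by move=> u; apply: le_trans (h1 u) _; rewrite ler_wpM2r.
- by move=> u; apply: le_trans (h1 u) _; rewrite ler_wpM2r.
by have [g' [gg' g'D]] := h2; exists g'; split => //; exact: IH.
Qed.

Lemma DerCS m K w g : DerC m.+1 K w g -> DerC m K w g.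
Proof.
elim: m g => [|m IH] g [h1 h2]; split => //.
by have [g' [gg' g'D]] := h2; exists g'; split => //; exact: IH.
Qed.

Lemma DerCD m K K' w f g : DerC m K w f -> DerC m K' w g -> DerC m (K + K') w (fun u => f u + g u).
Proof.
elim: m f g => [|m IH] f g [f1 f2] [g1 g2]; split => //.
- by move=> u; rewrite mulrDl (le_trans (cnD _ _))// lerD.
- by move=> u; rewrite mulrDl (le_trans (cnD _ _))// lerD.
have [f' [ff' f'D]] := f2; have [g' [gg' g'D]] := g2.
by exists (fun u => f' u + g' u); split; [exact: cderiveD|exact: IH].
Qed.

Lemma DerCZ m K w c g : DerC m K w g -> DerC m (cn c * K) w (fun u => c * g u).
Proof.
elim: m g => [|m IH] g [g1 g2]; split => //.
- by move=> u; rewrite -mulrA (le_trans (cnM _ _))// ler_wpM2l// cn_ge0.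
- by move=> u; rewrite -mulrA (le_trans (cnM _ _))// ler_wpM2l// cn_ge0.
have [g' [gg' g'D]] := g2.
by exists (fun u => c * g' u); split; [exact: cderiveZ|exact: IH].
Qed.

(** The exponential families below solve [g' = c g + q], so bounds on [g] and on the source [q]
    control every derivative of [g]; each differentiation costs a factor [M + 1]. *)
Lemma DerC_ode m M K w c g q : 0 <= K -> (forall u, 0 <= w u) -> cn c <= M ->
  (forall u, cn (g u) <= K * w u) -> cderive g (fun u => c * g u + q u) ->
  DerC m K w q -> DerC m ((M + 1) ^+ m * K) w g.
Proof.
move=> K0 w0 cM gK gd; have M0 : 0 <= M := le_trans (cn_ge0 c) cM.
have M1 : 1 <= M + 1 by lra.
elim: m => [|m IH] qD.
  by split => // u; rewrite mul1r; exact: gK.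
split.
  move=> u; apply: le_trans (gK u) _; rewrite ler_wpM2r// ler_peMl//.
  exact: exprn_ege1.
exists (fun u => c * g u + q u); split => //.
have h1 := DerCZ c (IH (DerCS qD)).
apply: DerC_le (DerCD h1 (DerCS qD)) => //.
have e0 : 1 <= (M + 1) ^+ m by exact: exprn_ege1.
have -> : (M + 1) ^+ m.+1 * K = M * ((M + 1) ^+ m * K) + (M + 1) ^+ m * K.
  by rewrite exprS; ring.
rewrite lerD//; last by rewrite ler_peMl.
by rewrite ler_wpM2r// mulr_ge0// (le_trans _ e0).
Qed.

(** The exponential [exp (- z u)], so that [Ec z (ln |x|)] is [|x|^-z]. *)
Definition Ec (z : C) (u : R) : C :=
  Complex (expR (- complex.Re z * u) * cos (complex.Im z * u))
          (- (expR (- complex.Re z * u) * sin (complex.Im z * u))).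

Lemma EcD z w u : Ec (z + w) u = Ec z u * Ec w u.
Proof.
rewrite /Ec ReD ImD !mulrDl !opprD !mulrDl expRD cosD sinD.
by apply: complex_ext; rewrite ?ReM ?ImM/=; ring.
Qed.

Lemma Ec0 u : Ec 0 u = 1.
Proof. by apply: complex_ext; rewrite /= ?oppr0 !mul0r expR0 ?cos0 ?sin0 ?mulr0 ?mulr1 ?oppr0. Qed.

Lemma Ec_u0 z : Ec z 0 = 1.
Proof. by apply: complex_ext; rewrite /= !mulr0 expR0 ?cos0 ?sin0 ?mulr0 ?mulr1 ?oppr0. Qed.

Lemma EcDu z u v : Ec z (u + v) = Ec z u * Ec z v.
Proof.
rewrite /Ec !mulrDr expRD cosD sinD.
by apply: complex_ext; rewrite ?ReM ?ImM/=; ring.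
Qed.

Lemma cn_Ec z u : cn (Ec z u) <= 2 * expR (- complex.Re z * u).
Proof.
rewrite /cn/= normrN !normrM ger0_norm ?expR_ge0//.
have h1 : `|cos (complex.Im z * u)| <= 1 by rewrite ler_norml cos_geN1 cos_le1.
have h2 : `|sin (complex.Im z * u)| <= 1 by rewrite ler_norml sin_geN1 sin_le1.
have e0 := expR_ge0 (- complex.Re z * u).
rewrite -mulrDr mulrC ler_wpM2r//; lra.
Qed.

Lemma cderive_Ec z : cderive (Ec z) (fun u => - z * Ec z u).
Proof.
have hl (k u : R) : is_derive u (1 : R) (fun u => k * u) k.
  by apply: is_derive_eq; rewrite /GRing.scale/=; ring.
move=> u.
have he := is_derive1_comp (is_derive_expR _) (hl (- complex.Re z) u).
have hc := is_derive1_comp (is_derive_cos _) (hl (complex.Im z) u).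
have hs := is_derive1_comp (is_derive_sin _) (hl (complex.Im z) u).
split.
  apply: (is_derive_eq (is_deriveM he hc)).
  by rewrite ReM ReN ImN /GRing.scale/=; ring.
apply: (is_derive_eq (is_deriveN (is_deriveM he hs))).
by rewrite ImM ReN ImN /GRing.scale/=; ring.
Qed.

Lemma cn_mvt (g g' : R -> C) (u B : R) : cderive g g' -> g 0 = 0 ->
  (forall v, `|v| <= `|u| -> cn (g' v) <= B) -> cn (g u) <= 2 * `|u| * B.
Proof.
move=> gg' g0 hB.
have hl (t : R) : is_derive t (1 : R) (fun t => t * u) u.
  by apply: is_derive_eq; rewrite /GRing.scale/=; ring.
have tu t : 0 <= t <= 1 -> `|t * u| <= `|u|.
  by move=> /andP[t0 t1]; rewrite normrM ger0_norm// ler_piMl.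
have [t t01|c c01] := @mvt01 R (fun t => complex.Re (g (t * u))) (fun t => complex.Re (g' (t * u)) * u).
  exact: (@is_derive1_comp R (fun v => complex.Re (g v)) (fun t => t * u) t _ _ (gg' (t * u)).1 (hl t)).
rewrite mul1r mul0r g0 subr0 => h1.
have [t t01|e e01] := @mvt01 R (fun t => complex.Im (g (t * u))) (fun t => complex.Im (g' (t * u)) * u).
  exact: (@is_derive1_comp R (fun v => complex.Im (g v)) (fun t => t * u) t _ _ (gg' (t * u)).2 (hl t)).
rewrite mul1r mul0r g0 subr0 => h2.
rewrite /cn h1 h2 !normrM.
have b1 := le_trans (Re_le_cn _) (hB _ (tu _ c01)).
have b2 := le_trans (Im_le_cn _) (hB _ (tu _ e01)).
have := ler_wpM2r (normr_ge0 u) b1; have := ler_wpM2r (normr_ge0 u) b2; lra.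
Qed.

Lemma Ec_bound1 h (u : R) : cn (Ec h u - 1) <= 4 * `|u| * cn h * expR (cn h * `|u|).
Proof.
have -> : 4 * `|u| * cn h * expR (cn h * `|u|) = 2 * `|u| * (cn h * (2 * expR (cn h * `|u|))) by ring.
apply: (@cn_mvt (fun u => Ec h u - 1) (fun u => - h * Ec h u + 0)); last 2 first.
- by rewrite Ec_u0 subrr.
- move=> v vu; rewrite addr0; apply: le_trans (cnM _ _) _; rewrite cnN ler_wpM2l ?cn_ge0//.
  apply: le_trans (cn_Ec _ _) _; rewrite ler_wpM2l// ler_expR.
  apply: le_trans (ler_norm _) _; rewrite normrM normrN ler_pM//.
  exact: Re_le_cn.
by apply: cderiveD; [exact: cderive_Ec|exact: cderive_cst].
Qed.

Lemma cderive_lin c : cderive (fun u => c * u%:C) (fun=> c).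
Proof.
move=> u; split.
  under eq_fun do rewrite ReM/= mulr0 subr0.
  by apply: is_derive_eq; rewrite /GRing.scale/=; ring.
under eq_fun do rewrite ImM/= mulr0 add0r.
by apply: is_derive_eq; rewrite /GRing.scale/=; ring.
Qed.

(** A second use of the mean value bound: the derivative of the left-hand function is
    [- h (Ec h u - 1)]. *)
Lemma Ec_bound2 h (u : R) : cn (Ec h u - 1 + h * u%:C) <= 8 * `|u| ^+ 2 * cn h ^+ 2 * expR (cn h * `|u|).
Proof.
have -> : 8 * `|u| ^+ 2 * cn h ^+ 2 * expR (cn h * `|u|) =
  2 * `|u| * (cn h * (4 * `|u| * cn h * expR (cn h * `|u|))) by ring.
apply: (@cn_mvt (fun u => Ec h u - 1 + h * u%:C) (fun u => - h * (Ec h u - 1))); last 2 first.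
- by rewrite Ec_u0 subrr mulr0 addr0.
- move=> v vu; apply: le_trans (cnM _ _) _; rewrite cnN ler_wpM2l ?cn_ge0//.
  apply: le_trans (Ec_bound1 _ _) _.
  rewrite ler_pM ?mulr_ge0 ?cn_ge0 ?expR_ge0//.
    by rewrite ler_wpM2r ?cn_ge0// ler_wpM2l.
  by rewrite ler_expR ler_wpM2l// cn_ge0.
have := cderiveD (cderiveD (cderive_Ec h) (cderive_cst (- 1))) (cderive_lin h).
by congr cderive; apply/funext => v; ring.
Qed.

End ComplexParts.

(** * Symbol estimates for exponential families *)

Section ExpFamilies.
Variable R : realType.
Local Notation C := R[i].
Implicit Types z h : C.

Lemma expR_ge_self (x : R) : x <= expR x.
Proof. by have := expR_ge1Dx x; lra. Qed.

Lemma normr_le_expR (delta u : R) : 0 < delta -> `|u| <= delta^-1 * expR (delta * `|u|).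
Proof. by move=> d0; rewrite mulrC ler_pdivlMr// mulrC expR_ge_self. Qed.

Lemma sqr_le_expR (delta u : R) : 0 < delta -> `|u| ^+ 2 <= (2 / delta) ^+ 2 * expR (delta * `|u|).
Proof.
move=> d0; have d2 : 0 < delta / 2 by lra.
have := normr_le_expR u d2; rewrite invf_div => h.
have -> : expR (delta * `|u|) = expR (delta / 2 * `|u|) ^+ 2.
  by rewrite -expRM_natl; congr expR; field.
have p : 0 <= 2 / delta by rewrite divr_ge0// ltW.
rewrite -exprMn; apply: lerXn2r h; rewrite nnegrE//.
by rewrite mulr_ge0// expR_ge0.
Qed.

(** [Dif] and [Rem] are the first difference and the second-order remainder of [Ec z u] as a
    function of [z], whose derivative is [- u Ec z u]. *)
Definition Dif z h (u : R) : C := Ec (z + h) u - Ec z u.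
Definition Rem z h (u : R) : C := Ec (z + h) u - Ec z u + h * (u%:C * Ec z u).

Lemma cn_Ec_wt z h delta (u : R) : cn h <= delta -> cn (Ec (z + h) u) <= 4 * wt (complex.Re z) delta u.
Proof.
move=> hd; rewrite EcD; apply: le_trans (cnM _ _) _.
have -> : 4 * wt (complex.Re z) delta u = (2 * expR (- complex.Re z * u)) * (2 * expR (delta * `|u|)).
  by rewrite /wt expRD; ring.
rewrite ler_pM ?cn_ge0 ?cn_Ec//; apply: le_trans (cn_Ec _ _) _.
rewrite ler_wpM2l// ler_expR; apply: le_trans (ler_norm _) _; rewrite normrM normrN.
by rewrite ler_wpM2r// (le_trans (Re_le_cn _)).
Qed.

(** One half of [delta] pays for the factor [exp (|h| |u|)], the other half for the factor [|u|]. *)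
Lemma cn_Dif z h delta (u : R) : 0 < delta -> cn h <= delta / 2 ->
  cn (Dif z h u) <= (16 / delta) * cn h * wt (complex.Re z) delta u.
Proof.
move=> d0 hd; have d2 : 0 < delta / 2 by lra.
have -> : Dif z h u = Ec z u * (Ec h u - 1) by rewrite /Dif EcD; ring.
apply: le_trans (cnM _ _) _.
have -> : 16 / delta * cn h * wt (complex.Re z) delta u =
  (2 * expR (- complex.Re z * u)) * (4 * ((delta / 2)^-1 * expR (delta / 2 * `|u|)) * cn h * expR (delta / 2 * `|u|)).
  rewrite /wt expRD (_ : delta * `|u| = delta / 2 * `|u| + delta / 2 * `|u|); last by field.
  by rewrite expRD; field; rewrite gt_eqF.
rewrite ler_pM ?cn_ge0 ?cn_Ec//; apply: le_trans (Ec_bound1 _ _) _.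
rewrite ler_pM ?mulr_ge0 ?cn_ge0 ?expR_ge0//.
  by rewrite ler_wpM2r ?cn_ge0// ler_wpM2l// normr_le_expR.
by rewrite ler_expR ler_wpM2r.
Qed.

Lemma cn_Rem z h delta (u : R) : 0 < delta -> cn h <= delta / 2 ->
  cn (Rem z h u) <= (256 / delta ^+ 2) * cn h ^+ 2 * wt (complex.Re z) delta u.
Proof.
move=> d0 hd; have d2 : 0 < delta / 2 by lra.
have -> : Rem z h u = Ec z u * (Ec h u - 1 + h * u%:C) by rewrite /Rem EcD; ring.
apply: le_trans (cnM _ _) _.
have -> : 256 / delta ^+ 2 * cn h ^+ 2 * wt (complex.Re z) delta u =
  (2 * expR (- complex.Re z * u)) * (8 * ((2 / (delta / 2)) ^+ 2 * expR (delta / 2 * `|u|)) * cn h ^+ 2 * expR (delta / 2 * `|u|)).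
  rewrite /wt expRD (_ : delta * `|u| = delta / 2 * `|u| + delta / 2 * `|u|); last by field.
  by rewrite expRD; field; rewrite gt_eqF.
rewrite ler_pM ?cn_ge0 ?cn_Ec//; apply: le_trans (Ec_bound2 _ _) _.
rewrite ler_pM ?mulr_ge0 ?exprn_ge0 ?cn_ge0 ?expR_ge0//.
  by rewrite ler_wpM2r ?exprn_ge0 ?cn_ge0// ler_wpM2l// sqr_le_expR.
by rewrite ler_expR ler_wpM2r.
Qed.

Lemma DerC0 m (w : R -> R) : (forall u, 0 <= w u) -> DerC m 0 w (fun=> 0).
Proof.
move=> w0; elim: m => [|m IH]; split => //.
- by move=> u; rewrite /cn/= normr0 addr0 mul0r.
- by move=> u; rewrite /cn/= normr0 addr0 mul0r.
by exists (fun=> 0); split => //; exact: cderive_cst.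
Qed.

Lemma DerC_Ec m z delta : 0 <= delta -> exists2 K : R, 0 <= K &
  forall h, cn h <= delta -> DerC m K (wt (complex.Re z) delta) (Ec (z + h)).
Proof.
move=> d0; exists ((cn z + delta + 1) ^+ m * 4).
  by rewrite mulr_ge0// exprn_ge0// !addr_ge0// cn_ge0.
move=> h hd; apply: (@DerC_ode _ _ _ _ _ (- (z + h)) _ (fun=> 0)) => //.
- exact: wt_ge0.
- by rewrite cnN (le_trans (cnD _ _))// lerD2l.
- by move=> u; exact: cn_Ec_wt.
- have := cderive_Ec (z + h).
  by congr cderive; apply/funext => u; rewrite addr0.
- by apply: DerC_le (DerC0 m _) => // u; exact: wt_ge0.
Qed.

(** Each family drives the next: [Dif] solves the equation of [Ec z] with source [- h Ec (z + h)],
    and [Rem] solves it with source [- h Dif]. The factors [cn h] and [cn h ^+ 2] thus persist in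
    all derivatives. *)
Lemma cderive_Dif z h : cderive (Dif z h) (fun u => - z * Dif z h u + - h * Ec (z + h) u).
Proof.
have := cderiveD (cderive_Ec (z + h)) (cderiveZ (-1) (cderive_Ec z)).
congr cderive; apply/funext => u; rewrite /Dif; ring.
Qed.

Lemma DerC_Dif m z delta : 0 < delta -> exists2 K : R, 0 <= K &
  forall h, cn h <= delta / 2 -> DerC m (K * cn h) (wt (complex.Re z) delta) (Dif z h).
Proof.
move=> d0; have [K1 K10 hK1] := DerC_Ec m z (ltW d0).
have d16 : 0 <= 16 / delta by apply: divr_ge0; [exact: ler0n|exact: ltW].
exists ((cn z + 1) ^+ m * (16 / delta + K1)).
  by rewrite mulr_ge0 ?addr_ge0// exprn_ge0// addr_ge0// cn_ge0.
move=> h hd; rewrite -mulrA.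
apply: (@DerC_ode _ _ _ _ _ (- z) _ (fun u => - h * Ec (z + h) u)).
- by rewrite mulr_ge0 ?cn_ge0// addr_ge0.
- exact: wt_ge0.
- by rewrite cnN.
- move=> u; apply: le_trans (cn_Dif _ _ d0 hd) _; rewrite ler_wpM2r ?wt_ge0//.
  by rewrite ler_wpM2r ?cn_ge0// lerDl.
- exact: cderive_Dif.
- have hd' : cn h <= delta by lra.
  apply: DerC_le (DerCZ (- h) (hK1 h hd')); first exact: wt_ge0.
  by rewrite cnN mulrC ler_wpM2r ?cn_ge0// lerDr.
Qed.

Lemma cderive_Rem z h : cderive (Rem z h) (fun u => - z * Rem z h u + - h * Dif z h u).
Proof.
have h1 := cderiveM (cderive_lin 1) (cderive_Ec z).
have := cderiveD (cderive_Dif z h) (cderiveZ h h1).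
have -> : (fun u => Dif z h u + h * (1 * u%:C * Ec z u)) = Rem z h.
  by apply/funext => u; rewrite mul1r.
by congr cderive; apply/funext => u; rewrite /Rem /Dif; ring.
Qed.

Lemma DerC_Rem m z delta : 0 < delta -> exists2 K : R, 0 <= K &
  forall h, cn h <= delta / 2 -> DerC m (K * cn h ^+ 2) (wt (complex.Re z) delta) (Rem z h).
Proof.
move=> d0; have [K1 K10 hK1] := DerC_Dif m z d0.
have d16 : 0 <= 256 / delta ^+ 2.
  by apply: divr_ge0; [exact: ler0n|apply: exprn_ge0; exact: ltW].
exists ((cn z + 1) ^+ m * (256 / delta ^+ 2 + K1)).
  by rewrite mulr_ge0 ?addr_ge0// exprn_ge0// addr_ge0// cn_ge0.
move=> h hd; rewrite -mulrA.
apply: (@DerC_ode _ _ _ _ _ (- z) _ (fun u => - h * Dif z h u)).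
- by apply: mulr_ge0; [exact: addr_ge0|rewrite exprn_ge0 ?cn_ge0].
- exact: wt_ge0.
- by rewrite cnN.
- move=> u; apply: le_trans (cn_Rem _ _ d0 hd) _; rewrite ler_wpM2r ?wt_ge0//.
  by rewrite ler_wpM2r ?exprn_ge0 ?cn_ge0// lerDl.
- exact: cderive_Rem.
- apply: DerC_le (DerCZ (- h) (hK1 h hd)); first exact: wt_ge0.
  rewrite cnN expr2 mulrCA ler_wpM2r ?mulr_ge0 ?cn_ge0//.
  by rewrite lerDr.
Qed.

(** The logarithmic symbol, needed for the potential at [s = 0] and for the derivative in [z]. *)
Lemma DerC_uEc m z delta : 0 < delta -> exists2 K : R, 0 <= K &
  DerC m K (wt (complex.Re z) delta) (fun u => u%:C * Ec z u).
Proof.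
move=> d0; have [K1 K10 hK1] := DerC_Ec m z (ltW d0).
have di : 0 <= 2 / delta by rewrite divr_ge0// ltW.
exists ((cn z + 1) ^+ m * (2 / delta + K1)).
  by rewrite mulr_ge0 ?addr_ge0// exprn_ge0// addr_ge0// cn_ge0.
apply: (@DerC_ode _ _ _ _ _ (- z) _ (Ec z)).
- by rewrite addr_ge0.
- exact: wt_ge0.
- by rewrite cnN.
- move=> u; apply: le_trans (cnM _ _) _.
  rewrite {1}/cn/= normr0 addr0.
  apply: (@le_trans _ _ ((delta^-1 * expR (delta * `|u|)) * (2 * expR (- complex.Re z * u)))).
    by rewrite ler_pM ?cn_ge0 ?cn_Ec// normr_le_expR.
  rewrite /wt expRD [leRHS]mulrDl.
  have -> : delta^-1 * expR (delta * `|u|) * (2 * expR (- complex.Re z * u)) =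
    2 / delta * (expR (- complex.Re z * u) * expR (delta * `|u|)) by ring.
  by rewrite lerDl mulr_ge0// mulr_ge0// expR_ge0.
- have := cderiveM (cderive_lin 1) (cderive_Ec z).
  have -> : (fun u => 1 * u%:C * Ec z u) = (fun u => u%:C * Ec z u).
    by apply/funext => u; rewrite mul1r.
  by congr cderive; apply/funext => u; ring.
- have := hK1 0; rewrite addr0 => h; apply: DerC_le (h _) => //.
  + exact: wt_ge0.
  + by rewrite lerDr.
  + by rewrite /cn/= normr0 addr0 ltW.
Qed.

(* [|x| ^ (2 j)] times a Gaussian in [x], up to a dilation by [e^(c / 2)] of which the
   symbol estimates are independent. *)
Definition gcut j (c u : R) : R := expR (j%:R * (2 * u + c)) * expR (- expR (2 * u + c)).

Lemma gcut_ge0 j c u : 0 <= gcut j c u. Proof. by rewrite mulr_ge0// expR_ge0. Qed.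

(** With [y = exp (2 u + c)] this reads [y ^ j exp (- y) <= j ^ j], the [j]-th power of [t <= exp t]
    at [t = y / j]. *)
Lemma gcut_le j c u : gcut j c u <= j%:R ^+ j.
Proof.
rewrite /gcut; set y := expR (2 * u + c); have y0 : 0 < y by exact: expR_gt0.
case: j => [|j]; first by rewrite mul0r expR0 mul1r expr0 -[leRHS]expR0 ler_expR oppr_le0 ltW.
have h : y / j.+1%:R <= expR (y / j.+1%:R) by exact: expR_ge_self.
have h2 : (y / j.+1%:R) ^+ j.+1 <= expR (y / j.+1%:R) ^+ j.+1.
  by rewrite lerXn2r// nnegrE ?expR_ge0// divr_ge0// ltW.
rewrite -expRM_natl mulrCA divff ?pnatr_eq0// mulr1 in h2.
rewrite expRM_natl -/y expRN -ler_pdivlMr ?invr_gt0 ?expR_gt0// invrK.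
by rewrite mulrC -ler_pdivrMr ?exprn_gt0// -expr_div_n.
Qed.

Lemma cderive_gcut j c : cderive (fun u => (gcut j c u)%:C)
  (fun u => (2 * j%:R * gcut j c u - 2 * gcut j.+1 c u)%:C).
Proof.
move=> u; split => /=; last exact: is_derive_cst.
have hl (v : R) : is_derive v (1 : R) (fun u => 2 * u + c) 2.
  by apply: is_derive_eq; rewrite /GRing.scale/=; ring.
have he := is_derive1_comp (is_derive_expR _) (hl u).
have he2 := is_derive1_comp (is_derive_expR _) (is_deriveN he).
have hl2 (v : R) : is_derive v (1 : R) (fun u => j%:R * (2 * u + c)) (2 * j%:R).
  by apply: is_derive_eq; rewrite /GRing.scale/=; ring.
have he3 := is_derive1_comp (is_derive_expR _) (hl2 u).
apply: (is_derive_eq (is_deriveM he3 he2)).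
pose y := expR (2 * u + c); pose e := expR (j%:R * (2 * u + c)).
change (e * (expR (- y) * - (y * 2)) + expR (- y) * (e * (2 * j%:R)) =
  2 * j%:R * (e * expR (- y)) - 2 * (expR (j.+1%:R * (2 * u + c)) * expR (- y))).
have -> : expR (j.+1%:R * (2 * u + c)) = e * y.
  by rewrite -addn1 natrD mulrDl mul1r expRD.
by ring.
Qed.

(** Differentiation turns [gcut j] into a combination of [gcut j] and [gcut j.+1], so the induction
    on [m] runs over all [j]; the bound [j ^ j] is free of [c]. *)
Lemma DerC_gcut m j z : exists2 K : R, 0 <= K &
  forall c, DerC m K (wt (complex.Re z) 0) (fun u => Ec z u * (gcut j c u)%:C).
Proof.
have b c u : cn (Ec z u * (gcut j c u)%:C) <= 2 * j%:R ^+ j * wt (complex.Re z) 0 u.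
  apply: le_trans (cnM _ _) _; rewrite /wt mul0r addr0 mulrAC.
  apply: ler_pM; [exact: cn_ge0|exact: cn_ge0|exact: cn_Ec|].
  by rewrite /cn/= normr0 addr0 ger0_norm ?gcut_ge0// gcut_le.
elim: m j b => [|m IH] j b.
  by exists (2 * j%:R ^+ j); [rewrite mulr_ge0// exprn_ge0|move=> c; split].
have b' i c u : cn (Ec z u * (gcut i c u)%:C) <= 2 * i%:R ^+ i * wt (complex.Re z) 0 u.
  apply: le_trans (cnM _ _) _; rewrite /wt mul0r addr0 mulrAC.
  apply: ler_pM; [exact: cn_ge0|exact: cn_ge0|exact: cn_Ec|].
  by rewrite /cn/= normr0 addr0 ger0_norm ?gcut_ge0// gcut_le.
have [K1 K10 h1] := IH j b; have [K2 K20 h2] := IH j.+1 (b' j.+1).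
pose k1 := cn (- z + (2 * j%:R)%:C); pose k2 := cn (- 2%:C : C).
have jj : 0 <= 2 * j%:R ^+ j :> R by rewrite mulr_ge0// exprn_ge0.
exists (2 * j%:R ^+ j + (k1 * K1 + k2 * K2)).
  by rewrite !addr_ge0 ?mulr_ge0 ?cn_ge0// exprn_ge0.
move=> c; split.
  move=> u; apply: le_trans (b c u) _; rewrite ler_wpM2r ?wt_ge0// lerDl.
  by rewrite addr_ge0 ?mulr_ge0 ?cn_ge0.
exists (fun u => (- z + (2 * j%:R)%:C) * (Ec z u * (gcut j c u)%:C) +
   - 2%:C * (Ec z u * (gcut j.+1 c u)%:C)); split.
  have := cderiveM (cderive_Ec z) (cderive_gcut j c).
  congr cderive; apply/funext => u.
  have -> : (2 * j%:R * gcut j c u - 2 * gcut j.+1 c u)%:C =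
      (2 * j%:R)%:C * (gcut j c u)%:C - 2%:C * (gcut j.+1 c u)%:C.
    by rewrite rmorphB/= [in LHS]rmorphM/= [(2 * gcut _ _ _)%:C]rmorphM/=.
  by ring.
apply: DerC_le (DerCD (DerCZ _ (h1 c)) (DerCZ _ (h2 c))); first exact: wt_ge0.
by rewrite lerDr.
Qed.

End ExpFamilies.

Lemma finite_set_ub (R : realType) (T : eqType) (S : set T) (f : T -> R) :
  finite_set S -> exists2 M, 0 <= M & forall x, S x -> f x <= M.
Proof.
move=> /finite_seqP[s ->]; exists (\sum_(x <- s) `|f x|); first by rewrite sumr_ge0.
move=> x /= xs; apply: le_trans (ler_norm _) _.
elim: s xs => [//|y s IH]; rewrite inE big_cons => /predU1P[->|/IH h].
  by rewrite lerDl sumr_ge0.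
by apply: le_trans h _; rewrite lerDr.
Qed.

Lemma Der_measurable (R : realType) m K w (g : R -> R) : Der m.+1 K w g -> measurable_fun setT g.
Proof.
move=> [_ [g' [gg' _]]]; apply: continuous_measurable_fun => u.
apply: differentiable_continuous; apply/derivable1_diffP.
by have [] := gg' u.
Qed.

(** * Domination of iterated differences on the lattice *)

Section Domination.
Variables (R : realType) (d : nat) (A : 'M[R]_d).
Hypothesis uA : A \in unitmx.
Local Notation L := (lattice A).
Local Notation Q := (wigner_seitz L).
Local Notation mu := (leb R d).
Local Notation V := 'rV[R]_d.
Hypothesis vQ : mu Q = 1%E.
Implicit Types (f g h : V -> R).
Local Notation dif := (dif A).
Local Notation avg := (avg A).

Lemma lsummable_far f b (C R0 : R) : d%:R < b -> 0 <= C ->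
  (forall l, L l -> R0 <= enorm l -> `|f l| <= C * pw b l) -> lsummable uA f.
Proof.
move=> db C0 hf; pose R1 := Num.max R0 1.
have [M M0 hM] := finite_set_ub (fun l => `|f l|) (lat_ball_finite uA R1).
apply: (@le_lsummable _ _ _ _ _ (fun l => (M + C) * bnd b R1 l)).
  move=> l Ll; rewrite /bnd; case: ltP => lR.
    by rewrite mulr1 (le_trans (hM l (conj Ll lR)))// lerDl.
  apply: le_trans (hf l Ll _) _; first by move: lR; rewrite /R1 ge_max => /andP[].
  by rewrite ler_wpM2r ?pw_ge0// lerDr.
by apply: integZ; apply: lsummable_bnd => //; rewrite /R1 le_max lexx orbT.
Qed.

(** The operator [1 + T], a positive majorant of [D = 1 - T]. *)
Definition addavg f x : R := f x + avg f x.

Lemma locint_addavg f : locint f -> locint (addavg f).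
Proof. by move=> fi; apply: locintD => //; exact: locint_avg. Qed.

Lemma locint_iter_addavg k f : locint f -> locint (iter k addavg f).
Proof. by move=> fi; elim: k => //= k IH; exact: locint_addavg. Qed.

Lemma norm_iter_dif k f w C x : 0 <= C -> locint f -> locint w -> (forall x, `|f x| <= C * w x) ->
  `|iter k dif f x| <= C * iter k addavg w x.
Proof.
move=> C0 fi wi fw; elim: k x => [//|k IH] x.
have gi := locint_iter_dif uA vQ k fi.
have hi := locint_iter_addavg k wi.
rewrite !iterS {1}/dif {1}/addavg mulrDr.
apply: le_trans (ler_normB _ _) _; rewrite lerD//.
apply: le_trans (norm_avg uA x gi) _.
rewrite -(avgZ uA)//; apply: le_avg => //; first exact: locint_norm.
exact: locintZ.
Qed.

(** The value at the origin is 0 whatever [c], so that [c = 0] gives the uncut function without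
    self-interaction. *)
Definition radc (c : R) (g : R -> R) (x : V) : R :=
  if (x != 0) && (c <= enorm x) then g (ln (enorm x)) else 0.

Lemma measurable_radc c (g : R -> R) : measurable_fun setT g -> measurable_fun setT (radc c g).
Proof.
move=> mg; pose D : set V := ~` [set x | enorm x <= 0] `&` ~` eball d c.
have mD : measurable D.
  apply: measurableI; apply: measurableC; last exact: measurable_eball.
  by apply: measurable_set_le; exact: measurable_enorm.
have -> : radc c g = fun x => \1_D x * g (ln (enorm x)).
  apply/funext => x; rewrite /radc indicE.
  have -> : (x \in D) = (x != 0) && (c <= enorm x).
    rewrite -enorm_gt0; apply/idP/idP; rewrite !inE /D /eball/=.
      by move=> [/negP h1 /negP h2]; rewrite ltNge h1 leNgt.
    move=> /andP[h1 h2]; split; apply/negP; first by rewrite -ltNge.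
    by rewrite -leNgt.
  by case: ifP; rewrite ?mul1r ?mul0r.
apply: measurable_funM; first exact: measurable_indic.
by apply: (measurableT_comp mg); exact: measurable_ln_enorm.
Qed.

Lemma le_radc c (g w : R -> R) C x : 0 <= C -> (forall u, `|g u| <= C * w u) ->
  `|radc c g x| <= C * radc c w x.
Proof. by move=> C0 gw; rewrite /radc; case: ifP => // _; rewrite normr0 mulr0. Qed.

Lemma measurable_wt a delta : measurable_fun setT (wt (R:=R) a delta).
Proof.
apply: measurableT_comp; first exact: measurable_expR.
apply: measurable_funD; first exact: measurable_funM.
by apply: measurable_funM => //; exact: measurableT_comp.
Qed.

Lemma wt_le_pw a delta (x : V) : 0 <= delta ->
  wt a delta (ln (enorm x)) <= pw (a + delta) x + pw (a - delta) x.
Proof.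
move=> d0; have [u0|u0] := leP 0 (ln (enorm x)).
  rewrite /wt ger0_norm// (_ : expR _ = pw (a - delta) x); last by congr expR; ring.
  by rewrite lerDr pw_ge0.
rewrite /wt ltr0_norm// (_ : expR _ = pw (a + delta) x); last by congr expR; ring.
by rewrite lerDl pw_ge0.
Qed.

Lemma locint_radc_wt c a delta : 0 <= delta -> 0 <= c -> (c = 0 -> a + delta < d%:R) ->
  locint (radc c (wt a delta)).
Proof.
move=> d0 c0 hc.
have mr : measurable_fun setT (radc c (wt a delta)).
  by apply: measurable_radc; exact: measurable_wt.
have r0 x : 0 <= radc c (wt a delta) x by rewrite /radc; case: ifP => // _; exact: wt_ge0.
split => // r.
have mi : measurable_fun setT (fun x => \1_(eball d r) x * radc c (wt a delta) x).
  by apply: measurable_funM => //; apply: measurable_indic; exact: measurable_eball.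
have [c00|cN0] := eqVneq c 0; last first.
  have cp : 0 < c by rewrite lt0r cN0.
  apply: (@le_integ _ _ _ (fun x => \1_(ann c r) x * pw (a + delta) x + \1_(ann c r) x * pw (a - delta) x)).
  - exact: (mi).
  - move=> x; rewrite normrM (ger0_norm (r0 x)) -mulrDr !indicE normr_nat in_ann.
    rewrite (_ : (x \in eball d r) = (enorm x < r)); last by apply/idP/idP; rewrite inE.
    rewrite /radc; case: ltP => xr; rewrite ?mul0r ?mulr_ge0 ?addr_ge0 ?pw_ge0//.
    case: ifPn => [/andP[_ cx]|_]; last by rewrite mulr0 mulr_ge0 ?addr_ge0 ?pw_ge0.
    by rewrite cx/= !mul1r wt_le_pw.
  - by apply: integD; exact: integ_pw_ann.
have [r_le0|r_gt0] := leP r 0.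
  rewrite (_ : (fun x => _) = fun=> 0); first exact: integ0.
  apply/funext => x; rewrite indicE memNset ?mul0r//= /eball/= => xr.
  by have := enorm_ge0 x; lra.
have had := hc c00; rewrite c00 in mi r0 *.
apply: (@le_integ _ _ _ (fun x => \1_(pball r) x * pw (a + delta) x + \1_(pball r) x * pw (a - delta) x)).
- exact: mi.
- move=> x; rewrite normrM (ger0_norm (r0 x)) -mulrDr !indicE normr_nat.
  rewrite (_ : (x \in eball d r) = (enorm x < r)); last by apply/idP/idP; rewrite inE.
  rewrite (_ : (x \in pball r) = (0 < enorm x) && (enorm x < r)); last by apply/idP/idP; rewrite inE.
  rewrite /radc -enorm_gt0; case: ltP => xr; rewrite ?mul0r ?mulr_ge0 ?addr_ge0 ?pw_ge0//.
  case: ifPn => [/andP[x0 _]|_]; last by rewrite mulr0 mulr_ge0 ?addr_ge0 ?pw_ge0.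
  by rewrite x0/= !mul1r wt_le_pw.
- by apply: integD; apply: integ_pw_lt => //; lra.
Qed.

Lemma locint_radc c a delta C (g : R -> R) : 0 <= delta -> 0 <= c -> (c = 0 -> a + delta < d%:R) ->
  0 <= C -> measurable_fun setT g -> (forall u, `|g u| <= C * wt a delta u) -> locint (radc c g).
Proof.
move=> d0 c0 hc C0 mg gw; have := locintZ C (locint_radc_wt d0 c0 hc).
apply: le_locint; first exact: measurable_radc.
by move=> x; exact: le_radc.
Qed.

(** One majorant [B] serves all symbols of the same weight, scaled by their constant [C]. The
    finitely many lattice points near the origin are handled through [addavg], the others by
    [dif_symbol_bound]. *)
Lemma dif_dominated k c a delta : 0 <= delta -> 0 <= c -> (c = 0 -> a + delta < d%:R) ->
  d%:R < a - delta + (2 * k)%:R ->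
  exists2 B : V -> R, lsummable uA B & forall C (g : R -> R), 0 <= C -> measurable_fun setT g ->
    Der (2 * k) C (wt a delta) g -> forall l, L l -> `|iter k dif (radc c g) l| <= C * B l.
Proof.
move=> d0 c0 hc hk; have [K K0 [R0 R01 hK]] := dif_symbol_bound uA vQ k a d0.
have wi := locint_radc_wt d0 c0 hc.
pose W := iter k addavg (radc c (wt a delta)).
pose R1 := Num.max (R0 + 2 * (c + 1)) 1.
have [M M0 hM] := finite_set_ub W (lat_ball_finite uA R1).
exists (fun l => (M + K) * bnd (a - delta + (2 * k)%:R) R1 l).
  by apply: integZ; apply: lsummable_bnd => //; rewrite /R1 le_max lexx orbT.
move=> C g C0 mg gD l Ll.
have gi : locint (radc c g) by apply: (locint_radc d0 c0 hc C0 mg); exact: Der_bound gD.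
rewrite /bnd; case: ltP => lR.
  rewrite mulr1; apply: (@le_trans _ _ (C * W l)).
    by apply: norm_iter_dif => // x; apply: le_radc => //; exact: Der_bound gD.
  by rewrite ler_wpM2l// (le_trans (hM l (conj Ll lR)))// lerDl.
apply: (@le_trans _ _ (K * C * pw (a - delta + (2 * k)%:R) l)).
  (* The radius [c + 1] makes the points nonzero even when [c = 0]. *)
  apply: (hK C g (radc c g) (c + 1)) => //; first by rewrite addr_ge0.
    move=> x xc; rewrite /radc /radial -enorm_gt0.
    have x0 : 0 < enorm x by lra.
    have cx : c <= enorm x by lra.
    by rewrite x0 cx.
  by move: lR; rewrite /R1 ge_max => /andP[].
rewrite mulrA (mulrC K) ler_wpM2r ?pw_ge0// ler_wpM2l// lerDr//.
Qed.

End Domination.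

(** * Complex derivatives and limits from real bounds *)

Lemma fderive_eps (K : numFieldType) (f : K -> K) z G :
  (forall e, 0 < e -> exists2 m, 0 < m &
     forall h, `|h| <= m -> `|f (z + h) - f z - h * G| <= e * `|h|) ->
  fderivable f z /\ fderive f z = G.
Proof.
move=> hf.
have lim : (fun h : K => h^-1 *: (f (h *: 1 + z) - f z)) @ 0^' --> G.
  apply/cvgrPdist_le => /= e e0; have [m m0 hm] := hf e e0.
  near=> h.
  have h0 : h != 0 by near: h; exact: nbhs_dnbhs_neq.
  have hd : `|h| <= m by near: h; apply: dnbhs0_le.
  have -> : G - h^-1 *: (f (h *: 1 + z) - f z) = - (h^-1 * (f (z + h) - f z - h * G)).
    by rewrite /GRing.scale/= mulr1 [h + z]addrC; field.
  by rewrite normrN normrM normfV ler_pdivrMl ?normr_gt0// [leRHS]mulrC hm.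
split; first by apply/cvg_ex; exists G; exact: lim.
by apply: cvg_lim => //; exact: norm_hausdorff.
Unshelve. all: by end_near. Qed.

Lemma cvg_pinfty_eps (R : realType) (K : numFieldType) (u : R -> K) l :
  (forall e, 0 < e -> \forall r \near +oo, `|l - u r| <= e) -> cvg_pinfty u l.
Proof. by move=> h; apply/cvgrPdist_le. Qed.

Section ComplexTopology.
Variable R : realType.
Local Notation C := R[i].
Implicit Types x y z h : C.

Lemma normc_le_cn z : `|z| <= (cn z)%:C.
Proof.
case: z => a b; rewrite normc_def/= lecR /cn/=.
rewrite -(ler_pXn2r (n := 2))// ?nnegrE ?addr_ge0 ?sqrtr_ge0//.
rewrite sqr_sqrtr ?addr_ge0 ?sqr_ge0// sqrrD !real_normK ?num_real//.
by rewrite -addrA lerD2l lerDr mulrn_wge0// mulr_ge0.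
Qed.

Lemma cn_le_normc z : (cn z)%:C <= 2 * `|z|.
Proof.
case: z => a b; rewrite normc_def/= /cn/=.
have -> : (2 : C) = (2 : R)%:C by rewrite rmorph_nat.
rewrite -rmorphM lecR/= mulr_natl mulr2n lerD// -sqrtr_sqr ler_sqrt ?addr_ge0 ?sqr_ge0//.
  by rewrite lerDl sqr_ge0.
by rewrite lerDr sqr_ge0.
Qed.

(** A quadratic remainder gives complex differentiability. The sign of [G] suits [|x|^-z], whose
    derivative in [z] brings out [- ln |x|]. *)
Lemma fderive_bound (F : C -> C) z G (K delta : R) : 0 < delta -> 0 <= K ->
  (forall h, cn h <= delta -> cn (F (z + h) - F z + h * G) <= K * cn h ^+ 2) ->
  fderivable F z /\ fderive F z = - G.
Proof.
move=> d0 K0 hF; apply: fderive_eps => e e0.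
have d0C : 0 < (delta / 2)%:C :> C by rewrite ltcR; lra.
have K4 : 0 < (4 * (K + 1))%:C :> C by rewrite ltcR; lra.
have em : 0 < e / (4 * (K + 1))%:C by rewrite divr_gt0.
have eE (x : C) : 0 < x -> x = (complex.Re x)%:C.
  by case: x => a b; rewrite ltcE/= => /andP[/eqP -> _].
(* As [cn h <= 2 |h|], the bound [delta / 2] on [|h|] ensures [cn h <= delta], and
   [cn h ^+ 2 <= 4 |h| ^+ 2] accounts for the 4. *)
pose m := Num.min (delta / 2) (complex.Re (e / (4 * (K + 1))%:C)).
have m0 : 0 < m by rewrite lt_min -!ltcR -eE// d0C.
exists m%:C; first by rewrite ltcR.
move=> h hm.
have hd : `|h| <= (delta / 2)%:C by rewrite (le_trans hm)// lecR ge_min lexx.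
have he : `|h| <= e / (4 * (K + 1))%:C.
  by rewrite (le_trans hm)// [leRHS]eE// lecR ge_min lexx orbT.
have cnd : cn h <= delta.
  have := le_trans (cn_le_normc h) (ler_wpM2l (ler0n _ 2) hd).
  rewrite -[2 : C](rmorph_nat (real_complex R)) -rmorphM/= lecR.
  by rewrite mulrC divfK// pnatr_eq0.
have := hF h cnd; rewrite mulrN opprK; set r := (X in cn X) => hr.
apply: le_trans (normc_le_cn r) _.
apply: (@le_trans _ _ ((K + 1) * cn h ^+ 2)%:C).
  rewrite lecR (le_trans hr)// ler_wpM2r ?exprn_ge0 ?cn_ge0//; lra.
have c2 : (cn h ^+ 2)%:C <= 4 * `|h| ^+ 2 :> C.
  have -> : 4 * `|h| ^+ 2 = (2 * `|h|) ^+ 2 :> C by ring.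
  rewrite rmorphXn/= lerXn2r ?cn_le_normc// ?nnegrE ?mulr_ge0//.
  by rewrite ler0c cn_ge0.
rewrite rmorphM/=; apply: (@le_trans _ _ ((K + 1)%:C * (4 * `|h| ^+ 2))).
  by rewrite ler_wpM2l// ler0c; lra.
have -> : (K + 1)%:C * (4 * `|h| ^+ 2) = `|h| * ((4 * (K + 1))%:C * `|h|) :> C.
  by rewrite !rmorphM/= rmorph_nat; ring.
by rewrite [e * _]mulrC ler_wpM2l// mulrC -ler_pdivlMr.
Qed.

Lemma cvg_pinfty_parts (u : R -> C) l :
  (fun r => complex.Re (u r)) @ +oo --> complex.Re l ->
  (fun r => complex.Im (u r)) @ +oo --> complex.Im l ->
  cvg_pinfty u l.
Proof.
move=> hRe hIm; apply: cvg_pinfty_eps => /= e e0.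
have eE : e = (complex.Re e)%:C.
  by case: e e0 => a b; rewrite ltcE/= => /andP[/eqP -> _].
have e1 : 0 < complex.Re e by rewrite -ltcR -eE.
have e2 : 0 < complex.Re e / 2 by lra.
have h1 : \forall t \near +oo, `|complex.Re l - complex.Re (u t)| <= complex.Re e / 2.
  exact: (cvgrPdist_le _ _).1 hRe _ e2.
have h2 : \forall t \near +oo, `|complex.Im l - complex.Im (u t)| <= complex.Re e / 2.
  exact: (cvgrPdist_le _ _).1 hIm _ e2.
near=> r; apply: le_trans (normc_le_cn _) _; rewrite eE lecR.
rewrite /cn ReD ImD ReN ImN (splitr (complex.Re e)).
by apply: lerD; near: r.
Unshelve. all: by end_near. Qed.

End ComplexTopology.

Lemma Der_scale (R : realType) m K (w g : R -> R) r : Der m K w g -> Der m (`|r| * K) w (fun u => r * g u).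
Proof.
elim: m g => [|m IH] g /= [gK]; rewrite -/Der => H.
  by split=> // u; rewrite normrM -mulrA ler_wpM2l.
case: H => g' [dg g'K]; split; first by move=> u; rewrite normrM -mulrA ler_wpM2l.
exists (fun u => r * g' u); split; last exact: IH.
by move=> u; have := dg u => du; apply: is_derive_eq.
Qed.

(** * Analytic continuation of the Epstein zeta function *)

Section Regularised.
Variables (R : realType) (d : nat) (A : 'M[R]_d).
Hypothesis uA : A \in unitmx.
Local Notation L := (lattice A).
Local Notation Q := (wigner_seitz L).
Local Notation mu := (leb R d).
Local Notation V := 'rV[R]_d.
Local Notation C := R[i].
Hypothesis vQ : mu Q = 1%E.
Implicit Types (f h : V -> R) (g : R -> R) (G : R -> C).
Local Notation dif := (dif A).
Local Notation avg := (avg A).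

Lemma iter_difD k f h : locint f -> locint h ->
  iter k dif (fun x => f x + h x) = (fun x => iter k dif f x + iter k dif h x).
Proof.
move=> fi hi; elim: k => //= k ->; apply/funext => x; rewrite /dif.
have fi' := locint_iter_dif uA vQ k fi; have hi' := locint_iter_dif uA vQ k hi.
by rewrite (avgD uA)//; ring.
Qed.

Lemma iter_difZ k r f : locint f -> iter k dif (fun x => r * f x) = (fun x => r * iter k dif f x).
Proof.
move=> fi; elim: k => //= k ->; apply/funext => x; rewrite /dif.
have fi' := locint_iter_dif uA vQ k fi.
by rewrite (avgZ uA)//; ring.
Qed.

(** For integrable summable functions and [k >= 1] this is the lattice sum minus the integral, but
    it keeps a meaning for all symbols that are summable after [k] differences. *)
Definition lam k c g : R := lsum uA (iter k dif (@radc R d c g)).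
Definition Lam k c G : C := Complex (lam k c (fun u => complex.Re (G u))) (lam k c (fun u => complex.Im (G u))).

Definition symb k a delta g := exists2 K, 0 <= K & Der (2 * k) K (wt a delta) g.
Definition symbC k a delta G := exists2 K, 0 <= K & DerC (2 * k) K (wt a delta) G.

Lemma symbCZ k a delta z G : symbC k a delta G -> symbC k a delta (fun u => z * G u).
Proof. by move=> [K K0 GK]; exists (cn z * K); [rewrite mulr_ge0 ?cn_ge0|exact: DerCZ]. Qed.

Lemma symbCD k a delta G1 G2 : symbC k a delta G1 -> symbC k a delta G2 ->
  symbC k a delta (fun u => G1 u + G2 u).
Proof. by move=> [K K0 GK] [K' K0' GK']; exists (K + K'); [rewrite addr_ge0|exact: DerCD]. Qed.

Lemma symbC_Ec k z delta : 0 <= delta -> symbC k (complex.Re z) delta (Ec z).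
Proof.
move=> d0; have [K K0 hK] := DerC_Ec (2 * k) z d0; exists K => //.
by have := hK 0; rewrite addr0; apply; rewrite /cn/= !normr0 addr0.
Qed.

(** * Linearity and continuity in the symbol *)

Section Regime.
Variables (k : nat) (c a delta : R).
Hypotheses (k0 : (0 < k)%N) (d0 : 0 <= delta) (c0 : 0 <= c) (hc : c = 0 -> a + delta < d%:R)
  (hk : d%:R < a - delta + (2 * k)%:R).

Local Notation symb := (symb k a delta).
Local Notation symbC := (symbC k a delta).

Lemma symb_measurable g : symb g -> measurable_fun setT g.
Proof.
move=> [K _]; have -> : (2 * k = (2 * k).-1.+1)%N by rewrite prednK// muln_gt0.
exact: Der_measurable.
Qed.

Lemma symb_locint g : symb g -> locint (@radc R d c g).
Proof.
move=> gs; case: (gs) => K K0 gK; apply: (locint_radc d0 c0 hc K0).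
  exact: symb_measurable.
exact: Der_bound gK.
Qed.

Lemma symb_lsummable g : symb g -> lsummable uA (iter k dif (@radc R d c g)).
Proof.
move=> gs; case: (gs) => K K0 gK.
have [B Bi hB] := dif_dominated uA vQ d0 c0 hc hk.
apply: (le_lsummable (hB K g K0 (symb_measurable gs) gK)).
exact: integZ.
Qed.

Lemma symb_Re G : symbC G -> symb (fun u => complex.Re (G u)).
Proof. by move=> [K K0 GK]; exists K => //; exact: DerC_Re. Qed.

Lemma symb_Im G : symbC G -> symb (fun u => complex.Im (G u)).
Proof. by move=> [K K0 GK]; exists K => //; exact: DerC_Im. Qed.

Lemma symb_radcD g1 g2 : @radc R d c (fun u => g1 u + g2 u) = fun x => radc c g1 x + radc c g2 x.
Proof. by apply/funext => x; rewrite /radc; case: ifP => // _; rewrite addr0. Qed.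

Lemma symb_radcZ r g : @radc R d c (fun u => r * g u) = fun x => r * radc c g x.
Proof. by apply/funext => x; rewrite /radc; case: ifP => // _; rewrite mulr0. Qed.

Lemma lamD g1 g2 : symb g1 -> symb g2 -> lam k c (fun u => g1 u + g2 u) = lam k c g1 + lam k c g2.
Proof.
move=> s1 s2; rewrite /lam symb_radcD iter_difD; [|exact: symb_locint..].
by rewrite /lsum lintD//; exact: symb_lsummable.
Qed.

Lemma lamZ r g : symb g -> lam k c (fun u => r * g u) = r * lam k c g.
Proof.
move=> s1; rewrite /lam symb_radcZ iter_difZ; last exact: symb_locint.
by rewrite /lsum lintZ//; exact: symb_lsummable.
Qed.

(** Continuity of the functional in the symbol constant: applied to remainders, it yields holomorphy
    in [z] without differentiating a series term by term. *)
Lemma lam_bound : exists2 B, 0 <= B & forall K g, 0 <= K -> Der (2 * k) K (wt a delta) g ->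
  `|lam k c g| <= K * B.
Proof.
have [B Bi hB] := dif_dominated uA vQ d0 c0 hc hk.
exists `|lsum uA B|; first exact: normr_ge0.
move=> K g K0 gK; have gs : symb g by exists K.
have := le_norm_lsum (hB K g K0 (symb_measurable gs) gK) (integZ K Bi).
move=> /le_trans; apply; rewrite /lsum lintZ// ler_wpM2l// ler_norm//.
Qed.

Lemma LamD G1 G2 : symbC G1 -> symbC G2 -> Lam k c (fun u => G1 u + G2 u) = Lam k c G1 + Lam k c G2.
Proof.
move=> s1 s2; apply: complex_ext => /=.
  under [X in lam k c X]eq_fun do rewrite ReD.
  by apply: lamD; exact: symb_Re.
under [X in lam k c X]eq_fun do rewrite ImD.
by apply: lamD; exact: symb_Im.
Qed.

Lemma symbZ r g : symb g -> symb (fun u => r * g u).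
Proof.
move=> [K K0 gK]; exists (`|r| * K); first by rewrite mulr_ge0.
exact: Der_scale.
Qed.

Lemma LamZ (z : C) G : symbC G -> Lam k c (fun u => z * G u) = z * Lam k c G.
Proof.
move=> s1; have sR := symb_Re s1; have sI := symb_Im s1.
apply: complex_ext; rewrite ?ReM ?ImM /=.
  under [X in lam k c X]eq_fun do rewrite ReM -mulNr.
  by rewrite lamD ?lamZ ?mulNr//; exact: symbZ.
under [X in lam k c X]eq_fun do rewrite ImM.
by rewrite lamD ?lamZ//; exact: symbZ.
Qed.

Lemma Lam_bound : exists2 B, 0 <= B & forall K G, 0 <= K -> DerC (2 * k) K (wt a delta) G ->
  cn (Lam k c G) <= K * B.
Proof.
have [B B0 hB] := lam_bound; exists (2 * B); first by rewrite mulr_ge0.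
move=> K G K0 GK; rewrite /cn/= mulrCA mulr_natl mulr2n.
by apply: lerD; apply: hB => //; [exact: DerC_Re|exact: DerC_Im].
Qed.

End Regime.

(** The left-hand side is the functional applied to [Rem z h], whose symbol constant is quadratic in
    [h]. *)
Lemma Lam_Ec_deriv k (c : R) (z : C) : (0 < k)%N -> 0 <= c -> (c = 0 -> complex.Re z < d%:R) ->
  d%:R < complex.Re z + (2 * k)%:R ->
  exists2 delta : R, 0 < delta & exists2 K : R, 0 <= K & forall h : C, cn h <= delta ->
    cn (Lam k c (Ec (z + h)) - Lam k c (Ec z) + h * Lam k c (fun u => u%:C * Ec z u)) <= K * cn h ^+ 2.
Proof.
move=> k0 c0 hc hk.
(* Without a cut, [delta] must keep the exponent below [d]; with a cut, only the decay at infinity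
   restricts it. *)
pose e1 := if c == 0 then (d%:R - complex.Re z) / 2 else 1.
have e10 : 0 < e1 by rewrite /e1; case: eqP => // /hc; lra.
pose delta := Num.min e1 ((complex.Re z + (2 * k)%:R - d%:R) / 2).
have dl0 : 0 < delta by rewrite lt_min e10/=; lra.
have d0 : 0 <= delta by exact: ltW.
have hc' : c = 0 -> complex.Re z + delta < d%:R.
  move=> cz; have := hc cz.
  have : delta <= e1 by rewrite ge_min lexx.
  by rewrite /e1 cz eqxx; lra.
have hk' : d%:R < complex.Re z - delta + (2 * k)%:R.
  have : delta <= (complex.Re z + (2 * k)%:R - d%:R) / 2 by rewrite ge_min lexx orbT.
  lra.
have [B B0 hB] := Lam_bound k0 d0 c0 hc' hk'.
have [K K0 hK] := DerC_Rem (2 * k) z dl0.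
have [K1 K10 hK1] := DerC_Ec (2 * k) z d0.
have [K2 K20 hK2] := DerC_uEc (2 * k) z dl0.
exists (delta / 2); first by rewrite divr_gt0.
exists (K * B); first by rewrite mulr_ge0.
move=> h hh; have hh' : cn h <= delta by lra.
have s1 : symbC k (complex.Re z) delta (Ec (z + h)) by exists K1 => //; exact: hK1.
have s2 : symbC k (complex.Re z) delta (Ec z) by exact: symbC_Ec.
have s3 : symbC k (complex.Re z) delta (fun u => u%:C * Ec z u) by exists K2.
have -> : Lam k c (Ec (z + h)) - Lam k c (Ec z) + h * Lam k c (fun u => u%:C * Ec z u) =
    Lam k c (Rem z h).
  have -> : Rem z h = fun u => (Ec (z + h) u + -1 * Ec z u) + h * (u%:C * Ec z u).
    by apply/funext => u; rewrite /Rem mulN1r.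
  rewrite (LamD k0 d0 c0 hc' hk' (symbCD s1 (symbCZ (-1) s2)) (symbCZ h s3)).
  rewrite (LamD k0 d0 c0 hc' hk' s1 (symbCZ (-1) s2)).
  by rewrite (LamZ k0 d0 c0 hc' hk' (-1) s2) (LamZ k0 d0 c0 hc' hk' h s3) mulN1r.
rewrite mulrAC; apply: hB; last exact: hK.
by rewrite mulr_ge0 ?exprn_ge0 ?cn_ge0.
Qed.

(* The left-hand side does not involve [k]. *)
Lemma lam_approx k c a K (gn : nat -> R -> R) g : (0 < k)%N -> 0 < c -> d%:R < a + (2 * k)%:R ->
  0 <= K -> (forall n, Der (2 * k) K (wt a 0) (gn n)) ->
  measurable_fun setT g -> (forall u, gn ^~ u @ \oo --> g u) ->
  (forall n, integ (@radc R d c (gn n)) /\ lsummable uA (@radc R d c (gn n))) ->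
  (fun n => lsum uA (radc c (gn n)) - lint (@radc R d c (gn n))) @ \oo --> lam k c g.
Proof.
move=> k0 c0 hk K0 gK mg gg gi.
have c0' : 0 <= c by exact: ltW.
have hc : c = 0 -> a + 0 < d%:R by move=> cz; move: c0; rewrite cz ltxx.
have hk' : d%:R < a - 0 + (2 * k)%:R by rewrite subr0.
have [B Bi hB] := dif_dominated uA vQ (lexx 0) c0' hc hk'.
have mgn n : measurable_fun setT (gn n).
  have sn : symb k a 0 (gn n) by exists K.
  exact: (symb_measurable k0 sn).
have wi : locint (@radc R d c (wt a 0)) := locint_radc_wt (lexx 0) c0' hc.
have bn n u : `|gn n u| <= K * wt a 0 u by exact: Der_bound (gK n) u.
have b u : `|g u| <= K * wt a 0 u.
  have : (fun n => `|gn n u|) @ \oo --> `|g u| by apply: cvg_norm; exact: gg.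
  move=> cn'; rewrite -(cvg_lim _ cn')//; apply: limr_le; first by apply/cvg_ex; exists `|g u|.
  by apply: nearW => n; exact: bn.
have gni n : locint (@radc R d c (gn n)) by exact: (locint_radc (lexx 0) c0' hc K0 (mgn n)).
have gl : locint (@radc R d c g) by exact: (locint_radc (lexx 0) c0' hc K0 mg).
(* Pointwise convergence survives each [dif] by dominated convergence; the majorant is the [addavg]
   iterate of the weight. *)
have cv j x : (fun n => iter j dif (radc c (gn n)) x) @ \oo --> iter j dif (radc c g) x.
  elim: j x => [|j IH] x.
    by rewrite /= /radc; case: ifP => _; [exact: gg|exact: cvg_cst].
  have wj := locint_iter_addavg (A := A) uA vQ j wi.
  have ca : (fun n => lint (fun y => \1_Q y * iter j dif (radc c (gn n)) (x - y))) @ \oo -->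
      lint (fun y => \1_Q y * iter j dif (radc c g) (x - y)).
    apply: (lint_dct (b := fun y => K * (\1_Q y * iter j (addavg A) (radc c (wt a 0)) (x - y))) _ _ _ _ _).2.
    - by move=> n; apply: integ_measurable; apply: (avg_integ uA); exact: locint_iter_dif.
    - by apply: integ_measurable; apply: (avg_integ uA); exact: locint_iter_dif.
    - by apply: integZ; exact: (avg_integ uA).
    - move=> n y; rewrite normrM ger0_norm// mulrCA ler_wpM2l//.
      apply: (norm_iter_dif uA vQ) => // z; exact: le_radc.
    - by move=> y; apply: cvgM; [exact: cvg_cst|exact: IH].
  exact: cvgB (IH x) ca.
have [_] := lsum_dct (uA := uA) (F := fun n => iter k dif (radc c (gn n))) (f := iter k dif (radc c g))
  (integZ K Bi) (fun n l Ll => hB K (gn n) K0 (mgn n) (gK n) l Ll) (fun l _ => cv k l).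
apply: cvg_trans; apply: near_eq_cvg; apply: nearW => n.
case: k k0 hk gK hk' B Bi hB => // k _ _ _ _ _ _ _.
by have [_ ->] := lsum_iter_dif vQ k (gi n).1 (gi n).2.
Qed.

End Regularised.

(** * Integrals of |x|^-z inside and outside a ball *)

Section ComplexIntegral.
Variables (R : realType) (d : nat).
Local Notation V := 'rV[R]_d.
Local Notation mu := (leb R d).
Local Notation C := R[i].
Implicit Types (f h : V -> C).

Definition cinteg f := integ (fun x => complex.Re (f x)) /\ integ (fun x => complex.Im (f x)).
Definition cint f : C := Complex (lint (fun x => complex.Re (f x))) (lint (fun x => complex.Im (f x))).

Lemma cintegZ z f : cinteg f -> cinteg (fun x => z * f x).
Proof.
move=> [f1 f2]; split; [under eq_fun do rewrite ReM|under eq_fun do rewrite ImM].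
  by apply: integB; exact: integZ.
by apply: integD; exact: integZ.
Qed.

Lemma cintZ (z : C) f : cinteg f -> cint (fun x => z * f x) = z * cint f.
Proof.
move=> [f1 f2]; apply: complex_ext; rewrite ?ReM ?ImM /=.
  under [X in lint X]eq_fun do rewrite ReM.
  by rewrite lintB ?lintZ//; exact: integZ.
under [X in lint X]eq_fun do rewrite ImM.
by rewrite lintD ?lintZ//; exact: integZ.
Qed.

Lemma cintegD f h : cinteg f -> cinteg h -> cinteg (fun x => f x + h x).
Proof.
by move=> [f1 f2] [h1 h2]; split; [under eq_fun do rewrite ReD|under eq_fun do rewrite ImD];
  exact: integD.
Qed.

Lemma cintD f h : cinteg f -> cinteg h -> cint (fun x => f x + h x) = cint f + cint h.
Proof.
move=> [f1 f2] [h1 h2]; apply: complex_ext; rewrite ?ReD ?ImD /=.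
  by under [X in lint X]eq_fun do rewrite ReD; rewrite lintD.
by under [X in lint X]eq_fun do rewrite ImD; rewrite lintD.
Qed.

Lemma cn_cint f (h : V -> R) : cinteg f -> integ h -> (forall x, cn (f x) <= h x) ->
  cn (cint f) <= 2 * lint h.
Proof.
move=> [f1 f2] hi fh; rewrite /cn mulr_natl mulr2n lerD//=; apply: le_norm_lint2 => // x;
  by apply: le_trans (fh x); rewrite ?Re_le_cn ?Im_le_cn.
Qed.

Lemma measurable_Ec_Re (z : C) : measurable_fun setT (fun u : R => complex.Re (Ec z u)).
Proof.
apply: continuous_measurable_fun => u; apply: differentiable_continuous.
by apply/derivable1_diffP; have [[]] := cderive_Ec z u.
Qed.

Lemma measurable_Ec_Im (z : C) : measurable_fun setT (fun u : R => complex.Im (Ec z u)).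
Proof.
apply: continuous_measurable_fun => u; apply: differentiable_continuous.
by apply/derivable1_diffP; have [_ []] := cderive_Ec z u.
Qed.

Lemma le_mul_expR (c t : R) : 0 < c -> 0 <= t -> c <= c * expR t.
Proof.
move=> c0 t0; rewrite -{1}[c]mulr1 ler_pM2l//.
by rewrite -expR0 ler_expR.
Qed.

Lemma in_eball (r : R) (x : V) : (x \in eball d r) = (enorm x < r).
Proof. by apply/idP/idP => [/set_mem//|xr]; exact/mem_set. Qed.

Lemma in_pball (r : R) (x : V) : (x \in pball r) = (0 < enorm x < r).
Proof. by apply/idP/idP => [/set_mem//|xr]; exact/mem_set. Qed.

Lemma Ec_real_nat (t : R) : Ec (- (d%:R)%:C) t = (expR t ^+ d)%:C.
Proof.
apply: complex_ext; rewrite /Ec/= ?oppr0 mul0r ?cos0 ?sin0 ?mulr0 ?oppr0//.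
by rewrite mulr1 opprK expRM_natl.
Qed.

(** At the origin [ln 0 = 0] would give the value 1; the sets used below exclude that point. *)
Definition Erad (z : C) (D : set V) (x : V) : C := (\1_D x : R)%:C * Ec z (ln (enorm x)).

Lemma Erad_integ z (D : set V) : measurable D -> integ (fun x => \1_D x * pw (complex.Re z) x) ->
  cinteg (Erad z D).
Proof.
move=> mD Di.
have bnd (x : V) : cn (Erad z D x) <= 2 * (\1_D x * pw (complex.Re z) x).
  apply: le_trans (cnM _ _) _; rewrite {1}/cn/= normr0 addr0 ger0_norm// mulrCA.
  by rewrite ler_wpM2l//; apply: le_trans (cn_Ec _ _) _.
split; apply: (le_integ _ _ (integZ 2 Di)).
- under eq_fun do rewrite ReM/= mul0r subr0.
  apply: measurable_funM; first exact: measurable_indic.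
  exact: (measurableT_comp (measurable_Ec_Re z) (@measurable_ln_enorm R d)).
- by move=> x; apply: le_trans (Re_le_cn _) (bnd x).
- under eq_fun do rewrite ImM/= mul0r addr0.
  apply: measurable_funM; first exact: measurable_indic.
  exact: (measurableT_comp (measurable_Ec_Im z) (@measurable_ln_enorm R d)).
- by move=> x; apply: le_trans (Im_le_cn _) (bnd x).
Qed.

(** The Jacobian [expR t ^+ d] is [Ec (- d) t], which shifts the exponent from [z] to [z - d]. *)
Lemma cint_scale z (D D' : set V) (t : R) : cinteg (Erad z D') ->
  (forall x, x != 0 -> D' (expR t *: x) <-> D x) -> ~ D 0 -> ~ D' 0 -> cinteg (Erad z D) ->
  cint (Erad z D') = Ec (z - (d%:R)%:C) t * cint (Erad z D).
Proof.
move=> i' DD D0 D0' i0.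
have e0 := expR_gt0 t.
have sc (x : V) : Erad z D' (expR t *: x) = Ec z t * Erad z D x.
  rewrite /Erad; have [->|x0] := eqVneq x 0.
    by rewrite scaler0 !indicE !memNset// !mul0r mulr0.
  have -> : (\1_D' (expR t *: x) : R) = \1_D x by apply: indic_iff; exact: DD.
  rewrite enormZ gtr0_norm// lnM ?posrE ?enorm_gt0// expRK addrC EcDu.
  ring.
have -> : cint (Erad z D') = (expR t ^+ d)%:C * cint (fun x => Erad z D' (expR t *: x)).
  have [r' m'] := i'.
  apply: complex_ext; rewrite ?ReM ?ImM /= mul0r ?subr0 ?addr0.
    by rewrite (lint_affine 0 e0 r'); under eq_fun do rewrite addr0.
  by rewrite (lint_affine 0 e0 m'); under eq_fun do rewrite addr0.
under [X in cint X]eq_fun do rewrite sc.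
rewrite cintZ// mulrA; congr (_ * _).
by rewrite EcD Ec_real_nat mulrC.
Qed.

Lemma lint_indic_ann (c s : R) : 0 < c -> c <= s ->
  integ (\1_(ann c s) : V -> R) /\ lint (\1_(ann c s) : V -> R) = bvol R d * (s ^+ d - c ^+ d).
Proof.
move=> c0 cs; have s0 : 0 < s by lra.
have ib r : integ (\1_(eball d r) : V -> R).
  by apply: integ_indic; [exact: measurable_eball|exact: leb_eball_lty].
have lb r : 0 < r -> lint (\1_(eball d r) : V -> R) = r ^+ d * bvol R d.
  by move=> r0; rewrite lint_indic ?leb_eball//; exact: measurable_eball.
have -> : (\1_(ann c s) : V -> R) = fun x => \1_(eball d s) x - \1_(eball d c) x.
  apply/funext => x; rewrite !indicE in_ann !in_eball.
  by case: (ltP (enorm x) c); case: (ltP (enorm x) s) => //=; lra.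
by split; [exact: integB|rewrite lintB// !lb//; ring].
Qed.

Lemma Erad_ann z (c t : R) : 0 < c -> 0 <= t -> cinteg (Erad z (ann c (c * expR t))).
Proof.
move=> c0 t0; apply: Erad_integ; first exact: measurable_ann.
exact: integ_pw_ann.
Qed.

(** Replaces a derivative at 0: a first-order coefficient bounded by second-order terms vanishes. *)
Lemma cn_small (X : C) (M : R) : (forall t : R, 0 < t <= 1 -> cn (t%:C * X) <= M * t ^+ 2) -> X = 0.
Proof.
move=> H; have M0 : 0 <= M.
  by have := H 1; rewrite ltr01 lexx => /(_ isT); rewrite expr1n mulr1; apply: le_trans; exact: cn_ge0.
have cX : cn X <= 0.
  apply/ler_addgt0Pl => e e0; rewrite addr0.
  pose t := Num.min 1 (e / (M + 1)).
  have t0 : 0 < t by rewrite lt_min ltr01 divr_gt0//; lra.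
  have t1 : t <= 1 by rewrite ge_min lexx.
  have te : t * (M + 1) <= e by rewrite -ler_pdivlMr ?ge_min ?lexx ?orbT//; lra.
  have := H t; rewrite t0 t1 => /(_ isT).
  have -> : cn (t%:C * X) = t * cn X.
    rewrite /cn ReM ImM/= !mul0r subr0 addr0 !normrM gtr0_norm//; ring.
  rewrite expr2 mulrCA ler_pM2l// => h; apply: le_trans h _.
  by apply: le_trans te; rewrite mulrC ler_pM2l//; lra.
apply: complex_ext => /=; apply/eqP; rewrite -normr_eq0 -normr_le0.
  by rewrite normr_id; exact: le_trans (Re_le_cn _) cX.
by rewrite normr_id; exact: le_trans (Im_le_cn _) cX.
Qed.

(* The scaling relation [H t = Ec (z - d) t * H 0] and the first-order behaviour of
   the integral over a thin shell as [t -> 0] determine [H 0]. *)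
Lemma shell_identity z (c : R) (H : R -> C) : 0 < c ->
  (forall t, 0 <= t -> H t = Ec (z - (d%:R)%:C) t * H 0) ->
  (forall t, 0 <= t -> H 0 - H t = cint (Erad z (ann c (c * expR t)))) ->
  (z - (d%:R)%:C) * H 0 = (d%:R * bvol R d)%:C * Ec (z - (d%:R)%:C) (ln c).
Proof.
move=> c0 Hs Hd; set w := z - (d%:R)%:C.
pose v := bvol R d * c ^+ d.
pose E0 := Ec z (ln c).
have -> : (d%:R * bvol R d)%:C * Ec w (ln c) = (v * d%:R)%:C * E0.
  rewrite /E0 /w EcD Ec_real_nat lnK ?posrE// /v.
  by rewrite !(rmorphM, rmorphXn)/=; ring.
apply/eqP; rewrite -subr_eq0; apply/eqP.
have v0 : 0 <= v by rewrite mulr_ge0 ?exprn_ge0 ?fine_ge0// ltW.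
(* [K2] and [K3] bound the second-order errors of [Ec w t] and of the shell volume, [K1] the
   oscillation of [|x|^-z] across the shell. *)
pose K1 := 4 * cn z * expR (cn z).
pose K2 := 8 * cn w ^+ 2 * expR (cn w).
pose K3 : R := 8 * d%:R ^+ 2 * expR d%:R.
pose M : R := K2 * cn (H 0) + cn E0 * v * K3 + 2 * (cn E0 * K1 * v * (d%:R + K3)).
apply: (@cn_small _ M) => t /andP[t0 t1].
have t0' : 0 <= t by exact: ltW.
have [ia la] : integ (\1_(ann c (c * expR t)) : V -> R) /\
    lint (\1_(ann c (c * expR t)) : V -> R) = v * (expR (d%:R * t) - 1).
  have ce : c <= c * expR t by exact: le_mul_expR.
  have [? ->] := lint_indic_ann c0 ce; split=> //.
  by rewrite /v exprMn expRM_natl; ring.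
have b2 : `|expR (d%:R * t) - 1 - d%:R * t| <= K3 * t ^+ 2.
  have := le_trans (Re_le_cn _) (Ec_bound2 (- (d%:R)%:C) t).
  rewrite !ReD ReM !ReN ImN/= oppr0 mul0r cos0 mulr1 opprK mul0r subr0.
  have -> : cn (- (d%:R)%:C) = d%:R :> R by rewrite cnN /cn/= normr0 addr0 ger0_norm.
  rewrite (ger0_norm t0') mulNr => /le_trans; apply.
  have -> : K3 * t ^+ 2 = 8 * t ^+ 2 * d%:R ^+ 2 * expR d%:R by rewrite /K3; ring.
  by rewrite ler_wpM2l ?mulr_ge0 ?exprn_ge0// ler_expR ler_piMr.
have b2' : expR (d%:R * t) - 1 <= (d%:R + K3) * t.
  have : K3 * t ^+ 2 <= K3 * t.
    by rewrite ler_wpM2l ?mulr_ge0 ?exprn_ge0 ?expR_ge0// expr2 ler_piMr.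
  by move: b2; rewrite ler_norml => /andP[_]; rewrite mulrDl; lra.

have bw : cn (Ec w t - 1 + w * t%:C) <= K2 * t ^+ 2.
  apply: le_trans (Ec_bound2 w t) _; rewrite (ger0_norm t0') /K2.
  rewrite [leRHS](_ : _ = 8 * t ^+ 2 * cn w ^+ 2 * expR (cn w)); last by ring.
  by rewrite ler_wpM2l ?mulr_ge0 ?exprn_ge0 ?cn_ge0// ler_expR ler_piMr ?cn_ge0.
(* On the shell [|x|^-z] is compared with its value [E0] on the inner sphere; the error [N] is of
   order [t], on a set of volume of order [t]. *)
pose N x := Erad z (ann c (c * expR t)) x + - E0 * (\1_(ann c (c * expR t)) x : R)%:C.
have iE := @Erad_ann z c t c0 t0'.
have i1 : cinteg (fun x : V => (\1_(ann c (c * expR t)) x : R)%:C).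
  by split => //=; exact: integ0.
have Nb x : cn (N x) <= cn E0 * K1 * t * \1_(ann c (c * expR t)) x.
  have -> : N x = (\1_(ann c (c * expR t)) x : R)%:C * (Ec z (ln (enorm x)) - E0).
    by rewrite /N /Erad; ring.
  rewrite indicE in_ann; have [/andP[x1 x2]|_] := boolP (c <= enorm x < c * expR t); last first.
    by rewrite /= mul0r mulr0 /cn/= normr0 addr0.
  rewrite mul1r mulr1.
  have x0 : 0 < enorm x by lra.
  have -> : Ec z (ln (enorm x)) = E0 * Ec z (ln (enorm x) - ln c) by rewrite -EcDu subrKC.
  have -> : E0 * Ec z (ln (enorm x) - ln c) - E0 = E0 * (Ec z (ln (enorm x) - ln c) - 1) by ring.
  apply: le_trans (cnM _ _) _; rewrite -!mulrA ler_wpM2l ?cn_ge0//.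
  have u0 : 0 <= ln (enorm x) - ln c by rewrite subr_ge0 ler_ln ?posrE.
  have u1 : ln (enorm x) - ln c <= t.
    rewrite lerBlDl -[leRHS](expRK (ln c + t)) ler_ln ?posrE ?expR_gt0//.
    by rewrite expRD lnK ?posrE// ltW.
  apply: le_trans (Ec_bound1 _ _) _; rewrite (ger0_norm u0) /K1 -!mulrA ler_wpM2l//.
  rewrite [leLHS]mulrCA ler_wpM2l ?cn_ge0// mulrC ler_pM ?expR_ge0//.
  by rewrite ler_expR ler_piMr ?cn_ge0//; lra.
have iN : cinteg N by apply: cintegD => //; exact: cintegZ.
have cN : cint (Erad z (ann c (c * expR t))) = cint N + E0 * (v * (expR (d%:R * t) - 1))%:C.
  rewrite /N cintD//; last exact: cintegZ.
  rewrite cintZ//; have -> : cint (fun x : V => (\1_(ann c (c * expR t)) x : R)%:C) = (v * (expR (d%:R * t) - 1))%:C.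
    by apply: complex_ext => /=; rewrite ?lint0// -la.
  ring.
have cNb : cn (cint N) <= 2 * (cn E0 * K1 * v * (d%:R + K3)) * t ^+ 2.
  have := cn_cint iN (integZ (cn E0 * K1 * t) ia) Nb; rewrite lintZ// la.
  move/le_trans; apply.
  have K10 : 0 <= K1 by rewrite !mulr_ge0 ?cn_ge0 ?expR_ge0.
  rewrite [leLHS](_ : _ = 2 * cn E0 * K1 * t * v * (expR (d%:R * t) - 1)); last by ring.
  rewrite [leRHS](_ : _ = 2 * cn E0 * K1 * t * v * ((d%:R + K3) * t)); last by ring.
  apply: ler_wpM2l => //; do 3! [apply: mulr_ge0 => //].
  by rewrite mulr_ge0 ?cn_ge0.
have -> : t%:C * (w * H 0 - (v * d%:R)%:C * E0) =
    (Ec w t - 1 + w * t%:C) * H 0 + (E0 * (v * (expR (d%:R * t) - 1 - d%:R * t))%:C + cint N).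
  have := Hd t t0'; rewrite (Hs t t0') cN -/w => e.
  have -> : cint N = H 0 - Ec w t * H 0 - E0 * (v * (expR (d%:R * t) - 1))%:C by rewrite e; ring.
  by rewrite !(rmorphM, rmorphB)/=; ring.
rewrite [leRHS](_ : _ = K2 * t ^+ 2 * cn (H 0) + (cn E0 * (v * (K3 * t ^+ 2)) +
  2 * (cn E0 * K1 * v * (d%:R + K3)) * t ^+ 2)); last by rewrite /M; ring.
apply: le_trans (cnD _ _) _; apply: lerD.
  by apply: le_trans (cnM _ _) _; rewrite ler_wpM2r ?cn_ge0.
apply: le_trans (cnD _ _) _; apply: lerD => //.
apply: le_trans (cnM _ _) _; rewrite ler_wpM2l ?cn_ge0//.
by rewrite {1}/cn/= normr0 addr0 normrM (ger0_norm v0) ler_wpM2l.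
Qed.

Lemma cint_outside z (c : R) : d%:R < complex.Re z -> 0 < c ->
  cinteg (Erad z (~` eball d c)) /\
  (z - (d%:R)%:C) * cint (Erad z (~` eball d c)) = (d%:R * bvol R d)%:C * Ec (z - (d%:R)%:C) (ln c).
Proof.
move=> zd c0.
have ie r : 0 < r -> cinteg (Erad z (~` eball d r)).
  move=> r0; apply: Erad_integ; last exact: integ_pw_ge.
  by apply: measurableC; exact: measurable_eball.
split; first exact: ie.
have ce t : 0 < c * expR t by rewrite mulr_gt0 ?expR_gt0.
have n0 r : 0 < r -> ~ (~` eball d r) (0 : V) by move=> r0 /=; rewrite /eball/= enorm0; tauto.
pose H t := cint (Erad z (~` eball d (c * expR t))).
have H0 : H 0 = cint (Erad z (~` eball d c)) by rewrite /H expR0 mulr1.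
rewrite -H0; apply: shell_identity => // t t0.
  rewrite H0; apply: cint_scale; [exact: ie| |exact: n0|exact: n0|exact: ie].
  move=> x x0; rewrite /eball/= enormZ gtr0_norm ?expR_gt0//.
  by rewrite mulrC ltr_pM2r ?expR_gt0.
have iA := @Erad_ann z c t c0 t0.
rewrite H0; apply/eqP; rewrite subr_eq; apply/eqP.
rewrite -cintD//; last exact: ie.
congr cint; apply/funext => x; rewrite /Erad -mulrDl -rmorphD; congr (_%:C * _).
rewrite !indicE in_ann !in_setC !in_eball.
have : c <= c * expR t by exact: le_mul_expR.
by case: (ltP (enorm x) c); case: (ltP (enorm x) (c * expR t)) => //=; rewrite ?addr0 ?add0r//; lra.
Qed.

(** Minus the inner integral obeys the same scaling and shell relations as the outer integral, hence
    the opposite sign: for [Re z < d] it continues the outer integral. *)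
Lemma cint_inside z (c : R) : complex.Re z < d%:R -> 0 < c ->
  cinteg (Erad z (pball c)) /\
  (z - (d%:R)%:C) * cint (Erad z (pball c)) = - ((d%:R * bvol R d)%:C * Ec (z - (d%:R)%:C) (ln c)).
Proof.
move=> zd c0.
have ie r : 0 < r -> cinteg (Erad z (pball r)).
  by move=> r0; apply: Erad_integ; [exact: measurable_pball|exact: integ_pw_lt].
split; first exact: ie.
have ce t : 0 < c * expR t by rewrite mulr_gt0 ?expR_gt0.
have n0 r : 0 < r -> ~ pball r (0 : V) by move=> r0; rewrite /pball/= enorm0 ltxx.
pose H t := - cint (Erad z (pball (c * expR t))).
have H0 : H 0 = - cint (Erad z (pball c)) by rewrite /H expR0 mulr1.
rewrite -[cint _]opprK -H0 mulrN; congr (- _); apply: shell_identity => // t t0.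
  rewrite H0 mulrN /H; congr (- _).
  apply: cint_scale; [exact: ie| |exact: n0|exact: n0|exact: ie].
  move=> x x0; rewrite /pball/= enormZ gtr0_norm ?expR_gt0// pmulr_rgt0 ?expR_gt0//.
  by rewrite [c * _]mulrC ltr_pM2l ?expR_gt0.
have iA := @Erad_ann z c t c0 t0.
rewrite H0 /H opprK addrC; apply/eqP; rewrite subr_eq; apply/eqP.
rewrite -cintD//; last exact: ie.
congr cint; apply/funext => x; rewrite /Erad -mulrDl -rmorphD; congr (_%:C * _).
rewrite !indicE in_ann !in_pball.
have : c <= c * expR t by exact: le_mul_expR.
have := enorm_ge0 x; case: (ltP (enorm x) c); case: (ltP (enorm x) (c * expR t)); case: (ltP 0 (enorm x));
  rewrite /= ?addr0 ?add0r//; lra.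
Qed.

End ComplexIntegral.

Section Fderivable.
Variable K : numFieldType.
Implicit Types (f g : K -> K) (z : K).

Lemma fderivableD f g z : fderivable f z -> fderivable g z -> fderivable (fun w => f w + g w) z.
Proof. exact: derivableD. Qed.

Lemma fderivableM f g z : fderivable f z -> fderivable g z -> fderivable (fun w => f w * g w) z.
Proof. exact: derivableM. Qed.

Lemma fderivableV f z : f z != 0 -> fderivable f z -> fderivable (fun w => (f w)^-1) z.
Proof. exact: derivableV. Qed.

Lemma fderivable_cst (c : K) z : fderivable (fun=> c) z.
Proof. exact: derivable_cst. Qed.

Lemma fderivable_subr (c : K) z : fderivable (fun w => w - c) z.
Proof.
apply: (fderive_eps (G := 1) _).1 => e e0; exists 1 => // h _.
have -> : z + h - c - (z - c) - h * 1 = 0 by ring.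
by rewrite normr0 mulr_ge0// ltW.
Qed.

End Fderivable.

Lemma fderivable_Ec (R : realType) (w0 z : R[i]) (u : R) : fderivable (fun w => Ec (w - w0) u) z.
Proof.
have K0 : 0 <= cn (Ec (z - w0) u) * (8 * `|u| ^+ 2 * expR `|u|).
  by rewrite mulr_ge0 ?cn_ge0// !mulr_ge0 ?exprn_ge0 ?expR_ge0.
apply: (fderive_bound (G := u%:C * Ec (z - w0) u) ltr01 K0 _).1 => h h1.
have -> : Ec (z + h - w0) u - Ec (z - w0) u + h * (u%:C * Ec (z - w0) u) =
    Ec (z - w0) u * (Ec h u - 1 + h * u%:C).
  have -> : z + h - w0 = (z - w0) + h by ring.
  by set w := z - w0; rewrite EcD; ring.
apply: le_trans (cnM _ _) _; rewrite -!mulrA ler_wpM2l ?cn_ge0//.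
apply: le_trans (Ec_bound2 _ _) _.
rewrite [leRHS](_ : _ = 8 * `|u| ^+ 2 * cn h ^+ 2 * expR `|u|); last by ring.
by rewrite ler_wpM2l ?mulr_ge0 ?exprn_ge0 ?cn_ge0// ler_expR ler_piMl.
Qed.

(** * Construction and values of the continuation *)

Section Zeta.
Variables (R : realType) (d : nat) (A : 'M[R]_d).
Hypothesis uA : A \in unitmx.
Local Notation L := (lattice A).
Local Notation Q := (wigner_seitz L).
Local Notation mu := (leb R d).
Local Notation V := 'rV[R]_d.
Local Notation C := R[i].
Hypothesis vQ : mu Q = 1%E.
Local Notation dif := (dif A).

(** Finitely many lattice points have norm below 1, so their inverse norms are bounded by some
    [M]. *)
Lemma lattice_gap : exists2 c : R, 0 < c & forall l : V, L l -> l != 0 -> c <= enorm l.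
Proof.
have [M M0 hM] := finite_set_ub (fun x : V => (enorm x)^-1) (lat_ball_finite uA 1).
exists (Num.min 1 (M + 1)^-1).
  by rewrite lt_min ltr01 invr_gt0; lra.
move=> l Ll l0; have [l1|l1] := ltP (enorm l) 1; last by rewrite ge_min l1.
rewrite ge_min; apply/orP; right.
rewrite invf_ple ?posrE ?enorm_gt0//; last by lra.
by apply: le_trans (hM l (conj Ll l1)) _; lra.
Qed.

Lemma radc_decay (c b K : R) (g : R -> R) : 0 < c -> d%:R < b -> 0 <= K -> measurable_fun setT g ->
  (forall u, `|g u| <= K * expR (- b * u)) ->
  integ (@radc R d c g) /\ lsummable uA (@radc R d c g).
Proof.
move=> c0 db K0 mg gb; split.
  apply: (le_integ _ _ (integZ K (integ_pw_ge db c0))); first exact: measurable_radc.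
  move=> x; rewrite indicE in_setC in_eball -leNgt /radc; case: (leP c (enorm x)) => cx.
    by rewrite andbT mul1r; case: ifP => _; [exact: gb|rewrite normr0 mulr_ge0 ?pw_ge0].
  by rewrite andbF normr0 mul0r mulr0.
apply: (lsummable_far uA db K0 (R0 := 0)) => l Ll _; rewrite /radc.
by case: ifP => _; [exact: gb|rewrite normr0 mulr_ge0 ?pw_ge0].
Qed.

(** Squeeze by [1 - y <= exp (- y) <= 1] for [y = exp (2 u - n)], with
    [exp (- n) <= 1 / (n + 1)]. *)
Lemma gcut_cvg (u : R) : (fun n => gcut 0 (- n%:R) u) @ \oo --> (1 : R).
Proof.
have h : (fun n => 1 - expR (2 * u) * (@harmonic R n)) @ \oo --> (1 : R).
  rewrite -[X in _ --> X]subr0 -[X in _ --> _ - X](mulr0 (expR (2 * u))).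
  by apply: cvgB; [exact: cvg_cst|apply: cvgM; [exact: cvg_cst|exact: cvg_harmonic]].
apply: (squeeze_cvgr (h := fun=> 1) _ h); last exact: cvg_cst.
apply: nearW => n.
rewrite /gcut mul0r expR0 mul1r; apply/andP; split.
  apply: le_trans (expR_ge1Dx _); rewrite lerD2l lerN2 expRD ler_wpM2l ?expR_ge0//.
  rewrite expRN /harmonic lef_pV2 ?posrE ?expR_gt0//.
  by apply: le_trans (expR_ge1Dx _); rewrite mulrSr addrC.
by rewrite -[leRHS]expR0 ler_expR oppr_le0 expR_ge0.
Qed.

Section Part.
(** Stands for the real or the imaginary part, so that each real statement is proved once. *)
Variable p : C -> R.
Hypotheses (pDer : forall m K w G, DerC m K w G -> Der m K w (fun u => p (G u)))
  (pZ : forall (x : C) (r : R), p (x * r%:C) = p x * r) (p_le : forall x, `|p x| <= cn x).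

Lemma measurable_part (z : C) : measurable_fun setT (fun u : R => p (Ec z u)).
Proof.
have [K K0 hK] := DerC_Ec 1 z (lexx 0).
apply: (@Der_measurable _ 0 K (wt (complex.Re z) 0)); apply: pDer.
by have := hK 0; rewrite addr0; apply; rewrite /cn/= !normr0 addr0.
Qed.

(** By [lam_approx] both sides are limits of the same sequence, for the cut-offs
    [exp (- |x|^2 exp (- n))]. *)
Lemma lam_indep_part k k' c (z : C) : (0 < k)%N -> (0 < k')%N -> 0 < c ->
  d%:R < complex.Re z + (2 * k)%:R -> d%:R < complex.Re z + (2 * k')%:R ->
  lam uA k c (fun u => p (Ec z u)) = lam uA k' c (fun u => p (Ec z u)).
Proof.
move=> k0 k0' c0 hk hk'.
pose gn (n : nat) u := p (Ec z u * (gcut 0 (- n%:R) u)%:C).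
have cvg j : (0 < j)%N -> d%:R < complex.Re z + (2 * j)%:R ->
    (fun n => lsum uA (radc c (gn n)) - lint (@radc R d c (gn n))) @ \oo -->
      lam uA j c (fun u => p (Ec z u)).
  move=> j0 hj; have [K K0 hK] := DerC_gcut (2 * j) 0 z.
  have gD n : Der (2 * j) K (wt (complex.Re z) 0) (gn n) by exact: pDer (hK _).
  have mg n : measurable_fun setT (gn n).
    have e : (2 * j = (2 * j).-1.+1)%N by rewrite prednK// muln_gt0.
    by move: (gD n); rewrite e; exact: Der_measurable.
  apply: (lam_approx vQ j0 c0 hj K0 gD); first exact: measurable_part.
    move=> u; rewrite /gn; under eq_fun do rewrite pZ.
    have := cvgM (cvg_cst (p (Ec z u))) (gcut_cvg u); rewrite mulr1; exact.
  (* By [gcut_le] at [j] and [y = exp (2 u - n)], the cut-off is at most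
     [j ^ j exp (j n) |x| ^ (- 2 j)], so that the product decays fast enough to be integrable; the 2
     comes from [cn_Ec]. *)
  move=> n; pose B : R := 2 * (j%:R ^+ j * expR (j%:R * n%:R)).
  have B0 : 0 <= B by rewrite !mulr_ge0 ?exprn_ge0 ?expR_ge0.
  apply: (@radc_decay c _ B (gn n) c0 hj B0 (mg n)) => u.
  apply: le_trans (p_le _) _; apply: le_trans (cnM _ _) _.
  have -> : B * expR (- (complex.Re z + (2 * j)%:R) * u) =
      2 * expR (- complex.Re z * u) * (j%:R ^+ j * expR (j%:R * n%:R - (2 * j)%:R * u)).
    have -> : - (complex.Re z + (2 * j)%:R) * u = - complex.Re z * u + - ((2 * j)%:R * u) by ring.
    by rewrite /B !expRD; ring.
  apply: ler_pM; [exact: cn_ge0|exact: cn_ge0|exact: cn_Ec|].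
  rewrite /cn/= normr0 addr0 ger0_norm ?gcut_ge0//.
  have := gcut_le j (- n%:R) u; rewrite /gcut mul0r expR0 mul1r mulrC.
  rewrite -ler_pdivlMr ?expR_gt0// -expRN.
  have -> : - (j%:R * (2 * u + - n%:R)) = j%:R * n%:R - (2 * j)%:R * u :> R by rewrite natrM; ring.
  by [].
by rewrite -(cvg_lim _ (cvg k k0 hk))// -(cvg_lim _ (cvg k' k0' hk')).
Qed.

Lemma lam_convergent_part k c (z : C) : (0 < k)%N -> 0 < c -> d%:R < complex.Re z ->
  lsummable uA (@radc R d c (fun u => p (Ec z u))) /\
  lam uA k c (fun u => p (Ec z u)) =
    lsum uA (@radc R d c (fun u => p (Ec z u))) - lint (@radc R d c (fun u => p (Ec z u))).
Proof.
move=> k0 c0 dz; have mg := measurable_part z.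
have [|gi gs] := radc_decay c0 dz (ler0n _ 2) mg.
  by move=> u; apply: le_trans (p_le _) (cn_Ec _ _).
by split=> //; rewrite /lam; case: k k0 => // k _; have [_ ->] := lsum_iter_dif vQ k gi gs.
Qed.

(** The part removed by the cut lives on a punctured ball free of lattice points: its lattice sum is
    0, so its regularised sum is minus its integral. *)
Lemma lam_cut_part k c (z : C) (c0 : 0 < c) : (0 < k)%N ->
  (forall l : V, L l -> l != 0 -> c <= enorm l) ->
  complex.Re z < d%:R -> d%:R < complex.Re z + (2 * k)%:R ->
  integ (fun x : V => \1_(pball c) x * p (Ec z (ln (enorm x)))) ->
  lam uA k 0 (fun u => p (Ec z u)) =
  lam uA k c (fun u => p (Ec z u)) - lint (fun x : V => \1_(pball c) x * p (Ec z (ln (enorm x)))).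
Proof.
move=> k0 hc zd hk ib; set f := (fun x => _) in ib *.
have mg := measurable_part z.
have gb u : `|p (Ec z u)| <= 2 * wt (complex.Re z) 0 u.
  by rewrite /wt mul0r addr0; apply: le_trans (p_le _) (cn_Ec _ _).
have i1 : locint (@radc R d c (fun u => p (Ec z u))).
  apply: (locint_radc (a := complex.Re z) (lexx 0) (ltW c0) _ (ler0n _ 2) mg gb) => cz.
  by move: c0; rewrite cz ltxx.
have e : @radc R d 0 (fun u => p (Ec z u)) = fun x => radc c (fun u => p (Ec z u)) x + f x.
  apply/funext => x; rewrite /radc /f indicE in_pball enorm_ge0 -enorm_gt0.
  case: ltP => x0 /=; last by rewrite mul0r addr0.
  by case: ltP => /= _; rewrite ?mul1r ?add0r// mul0r addr0.
have fL l : L l -> f l = 0.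
  move=> Ll; rewrite /f indicE in_pball; have [->|l0] := eqVneq l 0.
    by rewrite enorm0 ltxx mul0r.
  by rewrite [enorm l < c]ltNge (hc l Ll l0) andbF mul0r.
have f0 : (fun y => f (latpt uA y)) = fun=> 0.
  by apply/funext => y; rewrite fL//; exact: L_latpt.
have fs : lsummable uA f by rewrite /lsummable f0; exact: integ0.
rewrite /lam e (iter_difD uA vQ)//; last exact: integ_locint.
case: k k0 hk => // k k0 hk.
have [s1 e1] := lsum_iter_dif vQ k ib fs.
rewrite /lsum in e1 *; rewrite lintD//; last first.
  have hcc : c = 0 -> complex.Re z + 0 < d%:R by move=> cz; move: c0; rewrite cz ltxx.
  have hk' : d%:R < complex.Re z - 0 + (2 * k.+1)%:R by rewrite subr0.
  apply: (symb_lsummable uA vQ k0 (lexx 0) (ltW c0) hcc hk').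
  by have [K K0 hK] := symbC_Ec k.+1 z (lexx 0); exists K => //; exact: pDer.
by rewrite e1 f0 lint0 sub0r.
Qed.

End Part.

Let pRe_Z (x : C) (r : R) : complex.Re (x * r%:C) = complex.Re x * r.
Proof. by rewrite ReM/= mulr0 subr0. Qed.

Let pIm_Z (x : C) (r : R) : complex.Im (x * r%:C) = complex.Im x * r.
Proof. by rewrite ImM/= mulr0 add0r. Qed.

Lemma Lam_indep k k' c (z : C) : (0 < k)%N -> (0 < k')%N -> 0 < c ->
  d%:R < complex.Re z + (2 * k)%:R -> d%:R < complex.Re z + (2 * k')%:R ->
  Lam uA k c (Ec z) = Lam uA k' c (Ec z).
Proof.
move=> k0 k0' c0 hk hk'; apply: complex_ext => /=.
  exact: (lam_indep_part (@DerC_Re R) pRe_Z (@Re_le_cn R)).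
exact: (lam_indep_part (@DerC_Im R) pIm_Z (@Im_le_cn R)).
Qed.

Variable c : R.
Hypotheses (c0 : 0 < c) (hc : forall l : V, L l -> l != 0 -> c <= enorm l).

(* The integral of [|x| ^ (- z)] over [|x| >= c] when [d < Re z]. *)
Definition polar (z : C) : C := (d%:R * bvol R d)%:C * Ec (z - (d%:R)%:C) (ln c) * (z - (d%:R)%:C)^-1.

(** By [Lam_indep] any [k >= 1] with [2 k > d - Re z] gives the same value. *)
Definition zlevel (z : C) : nat := (Num.truncn (d%:R - complex.Re z)).+1.

Definition Zeta (z : C) : C := 2^-1 * (Lam uA (zlevel z) c (Ec z) + polar z).

Lemma zlevelP z : d%:R < complex.Re z + (2 * zlevel z)%:R.
Proof.
have := truncnS_gt (d%:R - complex.Re z); rewrite -/(zlevel z) mulSn natrD mul1n.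
by have : 0 <= (zlevel z)%:R :> R by []; lra.
Qed.

Lemma ZetaE k z : (0 < k)%N -> d%:R < complex.Re z + (2 * k)%:R ->
  Zeta z = 2^-1 * (Lam uA k c (Ec z) + polar z).
Proof. by move=> k0 hk; rewrite /Zeta (@Lam_indep _ k)//; exact: zlevelP. Qed.

(** [zlevel] jumps, so on a neighbourhood of [z] the level is frozen at that of [z]; [m'] is small
    enough for this level to remain admissible. *)
Lemma Zeta_fderivable z : z != (d%:R)%:C -> fderivable Zeta z.
Proof.
move=> zd; apply: fderivableM; first exact: fderivable_cst.
apply: fderivableD.
  have k0 : (0 < zlevel z)%N by [].
  have hcc : c = 0 -> complex.Re z < d%:R by move=> cz; move: c0; rewrite cz ltxx.
  have [m m0 [K K0 hK]] := Lam_Ec_deriv uA vQ k0 (ltW c0) hcc (zlevelP z).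
  pose m' := Num.min m ((complex.Re z + (2 * zlevel z)%:R - d%:R) / 2).
  have m'0 : 0 < m' by rewrite lt_min m0/=; have := zlevelP z; lra.
  apply: (fderive_bound m'0 K0 _).1 => h hm.
  have h1 : cn h <= m by apply: le_trans hm _; rewrite ge_min lexx.
  have h2 : d%:R < complex.Re (z + h) + (2 * zlevel z)%:R.
    have : cn h <= (complex.Re z + (2 * zlevel z)%:R - d%:R) / 2.
      by apply: le_trans hm _; rewrite ge_min lexx orbT.
    have := Re_le_cn h; rewrite ReD ler_norml => /andP[]; have := zlevelP z; lra.
  rewrite (@Lam_indep (zlevel (z + h)) (zlevel z))//; first exact: hK.
  exact: zlevelP.
apply: fderivableM.
  by apply: fderivableM; [exact: fderivable_cst|exact: fderivable_Ec].
by apply: fderivableV; [rewrite subr_eq0|exact: fderivable_subr].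
Qed.

(** For [Re z > d] the polar term is the integral subtracted in [Lam], and the plain lattice sum
    remains. *)
Lemma Zeta_convergent z : d%:R < complex.Re z ->
  Zeta z = 2^-1 * Complex (lsum uA (@radc R d c (fun u => complex.Re (Ec z u))))
                          (lsum uA (@radc R d c (fun u => complex.Im (Ec z u)))).
Proof.
move=> dz; rewrite (@ZetaE 1)//; last by rewrite muln1; lra.
congr (_ * _).
have [iE eE] := cint_outside dz c0.
have -> : polar z = cint (@Erad R d z (~` eball d c)).
  rewrite /polar -eE mulrAC divff ?mul1r//.
  by apply/eqP => /(congr1 (@complex.Re R)); rewrite ReD ReN/=; lra.
have [_ eR] := lam_convergent_part (@DerC_Re R) (@Re_le_cn R) (ltn0Sn 0) c0 dz.
have [_ eI] := lam_convergent_part (@DerC_Im R) (@Im_le_cn R) (ltn0Sn 0) c0 dz.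
have eq (g : R -> R) : (fun x : V => \1_(~` eball d c) x * g (ln (enorm x))) = radc c g.
  apply/funext => x; rewrite /radc indicE in_setC in_eball -leNgt.
  case: (leP c (enorm x)) => cx; last by rewrite andbF mul0r.
  by rewrite -enorm_gt0 (lt_le_trans c0 cx) mul1r.
have ER : (fun x => complex.Re (@Erad R d z (~` eball d c) x)) = radc c (fun u => complex.Re (Ec z u)).
  by rewrite -eq; apply/funext => x; rewrite /Erad mulrC pRe_Z mulrC.
have EI : (fun x => complex.Im (@Erad R d z (~` eball d c) x)) = radc c (fun u => complex.Im (Ec z u)).
  by rewrite -eq; apply/funext => x; rewrite /Erad mulrC pIm_Z mulrC.
rewrite /Lam /cint eR eI ER EI.
by apply: complex_ext; rewrite ?ReD ?ImD; exact: subrK.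
Qed.

(** For [Re z < d] the polar term is minus the integral over the punctured ball, exactly what
    restoring the region [|x| < c] contributes. *)
Lemma Zeta_regular k z : (0 < k)%N -> complex.Re z < d%:R -> d%:R < complex.Re z + (2 * k)%:R ->
  Zeta z = 2^-1 * Lam uA k 0 (Ec z).
Proof.
move=> k0 zd hk; rewrite (@ZetaE k)//; congr (_ * _).
have [iE eE] := cint_inside (d := d) zd c0.
have -> : polar z = - cint (@Erad R d z (pball c)).
  rewrite /polar; have -> : (d%:R * bvol R d)%:C * Ec (z - (d%:R)%:C) (ln c) =
      - ((z - (d%:R)%:C) * cint (@Erad R d z (pball c))) by rewrite eE opprK.
  rewrite mulNr mulrAC divff ?mul1r//.
  by apply/eqP => /(congr1 (@complex.Re R)); rewrite ReD ReN/=; lra.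
have eR : (fun x => complex.Re (@Erad R d z (pball c) x)) =
    fun x : V => \1_(pball c) x * complex.Re (Ec z (ln (enorm x))).
  by apply/funext => x; rewrite /Erad mulrC pRe_Z mulrC.
have eI : (fun x => complex.Im (@Erad R d z (pball c) x)) =
    fun x : V => \1_(pball c) x * complex.Im (Ec z (ln (enorm x))).
  by apply/funext => x; rewrite /Erad mulrC pIm_Z mulrC.
have [iR iI] := iE; rewrite eR in iR; rewrite eI in iI.
apply: complex_ext; rewrite ?ReD ?ImD ?ReN ?ImN /= ?eR ?eI.
  by rewrite (lam_cut_part (@DerC_Re R) (@Re_le_cn R) c0 k0 hc zd hk iR).
by rewrite (lam_cut_part (@DerC_Im R) (@Im_le_cn R) c0 k0 hc zd hk iI).
Qed.

Lemma Re_sum (S : set V) (f : V -> C) : finite_set S ->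
  complex.Re (\sum_(x \in S) f x) = \sum_(x \in S) complex.Re (f x).
Proof.
move=> fS; rewrite !fsbig_finite//=.
by apply: (big_morph (@complex.Re R)) => // x y; exact: ReD.
Qed.

Lemma Im_sum (S : set V) (f : V -> C) : finite_set S ->
  complex.Im (\sum_(x \in S) f x) = \sum_(x \in S) complex.Im (f x).
Proof.
move=> fS; rewrite !fsbig_finite//=.
by apply: (big_morph (@complex.Im R)) => // x y; exact: ImD.
Qed.

Lemma cpowN_Ec (r : R) (z : C) : 0 < r -> cpowN r z = Ec z (ln r).
Proof. by case: z => a b r0; rewrite /cpowN /Ec/= /powR gt_eqF// mulrC. Qed.

Lemma lat_sum_cvg (g : R -> R) : lsummable uA (@radc R d c g) ->
  (fun r => \sum_(x \in lat_ball L r `\ 0) g (ln (enorm x))) @ +oo --> lsum uA (@radc R d c g).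
Proof.
move=> gs.
have fS r : finite_set (lat_ball L r `\ 0) by apply: finite_setD; exact: lat_ball_finite.
have SL r : lat_ball L r `\ 0 `<=` L by move=> l [[]].
have -> : (fun r => \sum_(x \in lat_ball L r `\ 0) g (ln (enorm x))) =
    fun r => lsum uA (fun l => \1_(lat_ball L r `\ 0) l * radc c g l).
  apply/funext => r; have [_ ->] := lsum_finite uA vQ (radc c g) (fS r) (SL r).
  apply: eq_fsbigr => x /set_mem[[Lx _] /eqP x0].
  by rewrite /radc x0 (hc Lx x0).
apply/cvg_pinftyP => u uoo.
apply: (lsum_dct (b := fun l => `|radc c g l|) (integ_norm gs) _ _).2 => [k l Ll|l Ll].
  by rewrite normrM ger0_norm// ler_piMl// indicE; case: (_ \in _).
have [l0|l0] := eqVneq l 0.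
  have -> : radc c g l = 0 by rewrite /radc l0 eqxx.
  by under eq_fun do rewrite mulr0; exact: cvg_cst.
apply: cvg_near_cst; have : \forall x \near \oo, enorm l < u x by exact: (cvgryPgt _).1 uoo (enorm l).
apply: filterS => n ln; rewrite indicE mem_set ?mul1r//.
by split=> //; exact/eqP.
Qed.

Lemma Zeta_epstein : epstein_continuation L Zeta.
Proof.
split; first exact: Zeta_fderivable.
move=> z; rewrite cReE => dz; rewrite (Zeta_convergent dz).
have [sR _] := lam_convergent_part (@DerC_Re R) (@Re_le_cn R) (ltn0Sn 0) c0 dz.
have [sI _] := lam_convergent_part (@DerC_Im R) (@Im_le_cn R) (ltn0Sn 0) c0 dz.
have fS r : finite_set (lat_ball L r `\ 0) by apply: finite_setD; exact: lat_ball_finite.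
have half : (2^-1 : C) = (2^-1 : R)%:C by rewrite fmorphV rmorph_nat.
have zE r : zeta_partial L z r = (2^-1 : R)%:C *
    \sum_(x \in lat_ball L r `\ 0) Ec z (ln (enorm x)).
  rewrite /zeta_partial half; congr (_ * _); apply: eq_fsbigr => x /set_mem[_ /eqP x0].
  by rewrite cpowN_Ec// enorm_gt0.
under eq_fun do rewrite zE; rewrite half.
apply: cvg_pinfty_parts.
  under eq_fun do rewrite mulrC pRe_Z Re_sum// mulrC.
  rewrite mulrC pRe_Z/= mulrC; apply: cvgM; [exact: cvg_cst|exact: lat_sum_cvg].
under eq_fun do rewrite mulrC pIm_Z Im_sum// mulrC.
rewrite mulrC pIm_Z/= mulrC; apply: cvgM; [exact: cvg_cst|exact: lat_sum_cvg].
Qed.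

Lemma Zeta_fderive0 k : (0 < k)%N -> (0 < d)%N -> (d < 2 * k)%N ->
  fderive Zeta 0 = - (2^-1 * Lam uA k 0 (fun u => u%:C)).
Proof.
move=> k0 d0 hk.
have zd : (0 : R) = 0 -> complex.Re (0 : C) < d%:R by rewrite ltr0n.
have hk' : d%:R < complex.Re (0 : C) + (2 * k)%:R by rewrite add0r ltr_nat.
have [m m0 [K K0 hK]] := Lam_Ec_deriv uA vQ k0 (lexx 0) zd hk'.
(* [|Re h| <= 1/2] keeps [Re h] between [d - 2 k] and [d], as [d >= 1] and [d + 1 <= 2 k]. *)
pose m' := Num.min m 2^-1.
have m'0 : 0 < m' by rewrite lt_min m0/=; lra.
have d1 : 1 <= d%:R :> R by rewrite ler1n.
have dk : d%:R + 1 <= (2 * k)%:R :> R by rewrite natr1 ler_nat.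
have half : (2^-1 : C) = (2^-1 : R)%:C by rewrite fmorphV rmorph_nat.
have K20 : 0 <= 2^-1 * K by rewrite mulr_ge0.
have -> : Lam uA k 0 (fun u => u%:C) = Lam uA k 0 (fun u => u%:C * Ec 0 u).
  by congr Lam; apply/funext => u; rewrite Ec0 mulr1.
apply: (fderive_bound m'0 K20 _).2 => h hm.
have h1 : cn h <= m by apply: le_trans hm _; rewrite ge_min lexx.
have h2 : cn h <= 2^-1 by apply: le_trans hm _; rewrite ge_min lexx orbT.
have h3 : - 2^-1 <= complex.Re h <= 2^-1 by rewrite -ler_norml (le_trans (Re_le_cn h)).
rewrite (@Zeta_regular k (0 + h))// ?(@Zeta_regular k 0)// ?add0r; [|lra..].
have -> : forall a b e : C, 2^-1 * a - 2^-1 * b + h * (2^-1 * e) = 2^-1 * (a - b + h * e) by move=> *; ring.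
apply: le_trans (cnM _ _) _; rewrite -mulrA; apply: ler_pM; rewrite ?cn_ge0//.
  by rewrite half /cn/= normr0 addr0 ger0_norm.
by have := hK h h1; rewrite add0r.
Qed.

End Zeta.

(** * The Jellium energy of a lattice *)

Section Energy.
Variables (R : realType) (d : nat) (A : 'M[R]_d).
Hypothesis uA : A \in unitmx.
Local Notation L := (lattice A).
Local Notation Q := (wigner_seitz L).
Local Notation mu := (leb R d).
Local Notation V := 'rV[R]_d.
Hypothesis vQ : mu Q = 1%E.
Local Notation dif := (dif A).
Local Notation avg := (avg A).
Local Notation latpt := (latpt uA).

Lemma lint_shift (h : V -> R) c : integ h ->
  integ (fun x => h (x + c)) /\ lint (fun x => h (x + c)) = lint h.
Proof.
move=> hi; have i1 := integ_affine c ltr01 hi; have e1 := lint_affine c ltr01 hi.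
have e : (fun x : V => h (1 *: x + c)) = fun x => h (x + c) by apply/funext => x; rewrite scale1r.
by rewrite e in i1 e1; split=> //; rewrite e1 expr1n mul1r.
Qed.

Lemma indic_sum (s : seq V) x : uniq s -> \sum_(l <- s) ((x == l)%:R : R) = \1_[set` s] x.
Proof.
move=> us; rewrite indicE; have [xS|xS] := boolP (x \in s).
  rewrite mem_set// (bigD1_seq x)//= eqxx big1 ?addr0// => l; rewrite eq_sym => /negbTE ->//.
rewrite memNset//=; last exact/negP.
by rewrite big_seq big1// => l lS; case: eqP => // xl; move: xS; rewrite xl lS.
Qed.

Section Omega.
Variable r : seq V.
Local Notation S := [set` r].
Hypotheses (ur : uniq r) (SL : S `<=` L).
Local Notation Om := (omegaN Q S).

Lemma omegaN_latpt y : ~ overlaps A y -> Om y <-> S (latpt y).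
Proof.
move=> ny; split=> [[l Sl /(ws_latptE uA ny (SL Sl)) ->]//|Sl].
by exists (latpt y) => //; exact: ws_latpt.
Qed.

Lemma omegaN_sum y : ~ overlaps A y -> \1_Om y = \sum_(l <- r) (\1_Q (y - l) : R).
Proof.
move=> ny; have -> : \1_Om y = \1_S (latpt y) :> R by apply: indic_iff; exact: omegaN_latpt.
rewrite -indic_sum//; apply: eq_big_seq => l Sl.
rewrite indicE; congr (_%:R); congr nat_of_bool; apply/eqP/idP => [e|/set_mem q].
  by apply/mem_set/(ws_latptE uA ny (SL Sl)).
exact/(ws_latptE uA ny (SL Sl)).
Qed.

(** Closed cells may share boundary points, so only an inequality holds everywhere. It suffices for
    integrability, while the values of integrals use the equality [omegaN_sum] almost everywhere. *)
Lemma le_omegaN_sum y : \1_Om y <= \sum_(l <- r) (\1_Q (y - l) : R).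
Proof.
rewrite indicE; have [/set_mem[l Sl Ql]|_] := boolP (y \in Om); last first.
  by apply: sumr_ge0 => l _.
rewrite (bigD1_seq l)//=.
by rewrite indicE mem_set// lerDl sumr_ge0.
Qed.

Lemma measurable_omegaN : measurable Om.
Proof.
have -> : Om = \bigcup_(l in S) [set y | Q (y - l)].
  by apply/seteqP; split=> y [l Sl Ql]; exists l.
by apply: fin_bigcup_measurable => // l _; exact: measurable_wsB.
Qed.

Lemma lint_omegaN (h : V -> R) : measurable_fun setT h ->
  (forall l, integ (fun y => \1_Q (y - l) * h y)) ->
  integ (fun y => \1_Om y * h y) /\
  lint (fun y => \1_Om y * h y) = \sum_(l <- r) lint (fun y => \1_Q (y - l) * h y).
Proof.
move=> mh hi.
have si : integ (fun y => \sum_(l <- r) \1_Q (y - l) * h y).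
  by apply: integ_sum.
have mO : measurable_fun setT (fun y => \1_Om y * h y).
  by apply: measurable_funM => //; apply: measurable_indic; exact: measurable_omegaN.
split.
  have ai : integ (fun y => \sum_(l <- r) `|\1_Q (y - l) * h y|).
    by apply: integ_sum => l; exact: integ_norm.
  apply: (le_integ mO _ ai) => y.
  have -> : \sum_(l <- r) `|\1_Q (y - l) * h y| = (\sum_(l <- r) \1_Q (y - l)) * `|h y|.
    by rewrite mulr_suml; apply: eq_bigr => l _; rewrite normrM ger0_norm.
  rewrite normrM ger0_norm// ler_wpM2r//.
  exact: le_omegaN_sum.
rewrite -lint_sum//; apply: lint_ae_eq => //.
  exact: integ_measurable.
have [B [mB B0 NB]] := overlaps_negligible A; exists B; split => // y /= yB.
apply: NB; apply: contrapT => ny; apply: yB.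
by rewrite omegaN_sum// mulr_suml.
Qed.

Lemma lebint_lint (h : V -> R) : integ h -> lebint (fun x => (h x)%:E) = (lint h)%:E.
Proof. by move=> hi; rewrite lebint_integrable// integ_fin. Qed.

Lemma vol_omegaN : fine (lebvol Om) = \sum_(l <- r) (1 : R).
Proof.
have e l : (fun y => \1_Q (y - l) * 1) = (\1_[set y | Q (y - l)] : V -> R).
  by apply/funext => y; rewrite mulr1; exact: indic_iff.
have [|io eo] := @lint_omegaN (fun=> 1) (measurable_cst _).
  move=> l; rewrite e; apply: integ_indic; first exact: measurable_wsB.
  by rewrite (leb_wsB vQ) ltry.
have -> : lebvol Om = (lint (fun y => \1_Om y * 1))%:E.
  by rewrite -lebint_lint//; congr lebint; apply/funext => y; rewrite mulr1.
rewrite eo; apply: eq_bigr => l _; rewrite e lint_indic; last exact: measurable_wsB.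
by rewrite (leb_wsB vQ).
Qed.

Variable f : V -> R.
Hypotheses (fi : locint f) (f0 : f 0 = 0).

Lemma integ_ws_shift (g : V -> R) l : integ (fun q => \1_Q q * g q) ->
  integ (fun y => \1_Q (y - l) * g (y - l)) /\
  lint (fun y => \1_Q (y - l) * g (y - l)) = lint (fun q => \1_Q q * g q).
Proof. by move=> gi; exact: lint_shift (- l) gi. Qed.

Lemma potential_omegaN x : integ (fun y => \1_Om y * f (x - y)) /\
  lint (fun y => \1_Om y * f (x - y)) = \sum_(l <- r) avg f (x - l).
Proof.
have e l : (fun y => \1_Q (y - l) * f (x - y)) = fun y => \1_Q (y - l) * f ((x - l) - (y - l)).
  by apply/funext => y; rewrite opprB addrA subrK.
have gi l := integ_ws_shift l (avg_integ uA (x - l) fi).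
have mf : measurable_fun setT (fun y : V => f (x - y)).
  exact: (measurableT_comp (locint_measurable fi) (measurable_subc x)).
have [|io ->] := @lint_omegaN (fun y => f (x - y)) mf.
  by move=> l; rewrite e; exact: (gi l).1.
by split=> //; apply: eq_bigr => l _; rewrite e (gi l).2.
Qed.

(** Integrating the potential [avg f] over the cell around a lattice point is a second application
    of [avg], by symmetry of the cell. *)
Lemma potential_energy :
  integ (fun x => \1_Om x * \sum_(l <- r) avg f (x - l)) /\
  lint (fun x => \1_Om x * \sum_(l <- r) avg f (x - l)) =
    \sum_(x <- r) \sum_(y <- r) avg (avg f) (x - y).
Proof.
have ai : locint (avg f) by exact: locint_avg.
pose F x l : V -> R := fun y => \1_Q (y - x) * avg f (y - l).
have Fi x l : integ (F x l) /\ lint (F x l) = avg (avg f) (x - l).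
  have [h1 h2] := integ_ws_shift x (avg_integ_sym uA (x - l) ai).
  have -> : F x l = fun y => \1_Q (y - x) * avg f (x - l + (y - x)).
    by apply/funext => y; rewrite /F [_ - l + _]addrC addrA subrK.
  by split; [exact: h1|rewrite h2; apply/esym; exact: (avg_sym uA (x - l) ai)].
have e x : (fun y => \1_Q (y - x) * \sum_(l <- r) avg f (y - l)) =
    fun y => \sum_(l <- r) F x l y.
  by apply/funext => y; rewrite mulr_sumr.
have [||io ->] := @lint_omegaN (fun x => \sum_(l <- r) avg f (x - l)).
- apply: measurable_sum => l; apply: (measurableT_comp (locint_measurable ai)).
  by apply: measurable_rowD; [exact: measurable_id|exact: measurable_cst].
- by move=> x; rewrite e; apply: integ_sum => l; exact: (Fi x l).1.
split=> //; apply: eq_bigr => x _; rewrite e lint_sum; last by move=> l; exact: (Fi x l).1.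
by apply: eq_bigr => l _; exact: (Fi x l).2.
Qed.

(** The three terms of the energy are sums of [f], [avg f] and [avg (avg f)] over ordered pairs,
    with coefficients 1/2, -1, 1/2: half the square of [1 - T]. *)
Lemma jellium_sum s : (forall x, f x = rieszV s (enorm x)) ->
  jellium_energy s Om S = 2^-1 * \sum_(x <- r) \sum_(y <- r) iter 2 dif f (x - y).
Proof.
move=> fE.
have [pi pe] := potential_energy.
(* The diagonal terms may be added because [f 0 = 0]. *)
have E1 : \sum_(x \in S) \sum_(y \in S `\ x) rieszV s (enorm (x - y)) =
    \sum_(x <- r) \sum_(y <- r) f (x - y).
  rewrite -fsbig_seq//; apply: eq_big_seq => x xr.
  rewrite (fsbig_seq _ _ ur) [RHS](fsbigD1 x)//.
  rewrite /= subrr f0 add0r; apply: eq_fsbigr => y _; exact/esym/fE.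
have E2 : \sum_(x \in S) fine (lebint (fun y => (\1_Om y * rieszV s (enorm (x - y)))%:E)) =
    \sum_(x <- r) \sum_(y <- r) avg f (x - y).
  rewrite -fsbig_seq//; apply: eq_bigr => x _; have [i e] := potential_omegaN x.
  by rewrite -e -[RHS]/(fine (lint _)%:E) -lebint_lint//; congr (fine (lebint _)); apply/funext => y; rewrite fE.
have E3 : fine ((2^-1)%:E * lebint (fun x => lebint (fun y =>
         (\1_Om x * \1_Om y * rieszV s (enorm (x - y)))%:E)))%E =
    2^-1 * \sum_(x <- r) \sum_(y <- r) avg (avg f) (x - y).
  rewrite -pe -[RHS]/(fine (2^-1 * lint _)%:E) EFinM -lebint_lint//.
  congr (fine (_ * lebint _)%E); apply/funext => x.
  have [i e] := potential_omegaN x; rewrite -e -lintZ// -lebint_lint; last exact: integZ.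
  by congr lebint; apply/funext => y; rewrite mulrA fE.
rewrite /jellium_energy E1 E2 E3.
have W x : iter 2 dif f x = f x - 2 * avg f x + avg (avg f) x.
  by rewrite /= {1}/dif (avgB uA)//; [rewrite /dif; ring|exact: locint_avg].
have -> : \sum_(x <- r) \sum_(y <- r) iter 2 dif f (x - y) =
    \sum_(x <- r) \sum_(y <- r) f (x - y) - 2 * (\sum_(x <- r) \sum_(y <- r) avg f (x - y)) +
    \sum_(x <- r) \sum_(y <- r) avg (avg f) (x - y).
  rewrite mulr_sumr -sumrB -big_split/=; apply: eq_bigr => x _.
  rewrite mulr_sumr -sumrB -big_split/=; apply: eq_bigr => y _.
  by rewrite -W.
lra.
Qed.

End Omega.
End Energy.

(** * From double sums over a ball to a lattice sum *)

Section Tannery.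
Variables (R : realType) (d : nat) (A : 'M[R]_d).
Hypothesis uA : A \in unitmx.
Local Notation L := (lattice A).
Local Notation Q := (wigner_seitz L).
Local Notation mu := (leb R d).
Local Notation V := 'rV[R]_d.
Hypothesis vQ : mu Q = 1%E.
Local Notation latpt := (latpt uA).

Lemma lat_seq_subproof (r : R) : exists s : seq V, uniq s /\ lat_ball L r = [set` s].
Proof.
have /finite_seqP[s0 S0] := lat_ball_finite uA r.
exists (undup s0); split; first exact: undup_uniq.
by rewrite S0; apply/seteqP; split => x /=; rewrite mem_undup.
Qed.

Definition lat_seq (r : R) : seq V := sval (cid (lat_seq_subproof r)).

Lemma lat_seq_uniq r : uniq (lat_seq r).
Proof. by rewrite /lat_seq; case: cid => s []. Qed.

Lemma lat_seqE r : lat_ball L r = [set` lat_seq r].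
Proof. by rewrite /lat_seq; case: cid => s []. Qed.

Lemma mem_lat_seq r x : x \in lat_seq r <-> lat_ball L r x.
Proof. by rewrite lat_seqE. Qed.

Lemma lsum_lat_ball r (g : V -> R) : lsummable uA (fun l => \1_(lat_ball L r) l * g l) /\
  lsum uA (fun l => \1_(lat_ball L r) l * g l) = \sum_(x <- lat_seq r) g x.
Proof.
have SL : lat_ball L r `<=` L by move=> l [].
have [h1 ->] := lsum_finite uA vQ g (lat_ball_finite uA r) SL.
by split=> //; rewrite lat_seqE (fsbig_seq _ _ (lat_seq_uniq r)).
Qed.

Definition lat_count (r : R) : R := \sum_(x <- lat_seq r) 1.

Lemma lat_count_lsum r : integ (fun y => \1_(lat_ball L r) (latpt y) : R) /\
  lat_count r = lint (fun y => \1_(lat_ball L r) (latpt y)).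
Proof.
have [h1 h2] := lsum_lat_ball r (fun=> 1).
have e : (fun y => \1_(lat_ball L r) (latpt y) * 1) = fun y => \1_(lat_ball L r) (latpt y) :> R.
  by apply/funext => y; rewrite mulr1.
by rewrite /lat_count -h2 /lsum -e.
Qed.

Lemma lat_count_ge1 r : 0 < r -> 1 <= lat_count r.
Proof.
move=> r0; rewrite /lat_count (bigD1_seq 0)/= ?lat_seq_uniq//.
  by rewrite lerDl sumr_ge0.
by apply/mem_lat_seq; split; [exact: lat0|rewrite enorm0].
Qed.

Lemma lat_count_le r r' : r <= r' -> lat_count r <= lat_count r'.
Proof.
move=> rr; have [i e] := lat_count_lsum r; have [i' e'] := lat_count_lsum r'.
rewrite e e'; apply: le_lint => // y; rewrite !indicE.
have [/set_mem[Ll lr]|_] := boolP (latpt y \in lat_ball L r); last by rewrite ler0n.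
by rewrite mem_set//; split=> //; exact: lt_le_trans rr.
Qed.

(* The cells around the points of [B_r] cover [B_(r - rho)] and lie in [B_(r + rho)]. *)
Lemma lat_count_ball : exists2 rho : R, 0 < rho & forall r, rho < r ->
  (r - rho) ^+ d * bvol R d <= lat_count r <= (r + rho) ^+ d * bvol R d.
Proof.
have [rho r0 hr] := latpt_near uA; exists rho => // r rr.
have ib t : 0 < t -> integ (\1_(eball d t) : V -> R) /\ lint (\1_(eball d t) : V -> R) = t ^+ d * bvol R d.
  move=> t0; split; first by apply: integ_indic; [exact: measurable_eball|exact: leb_eball_lty].
  by rewrite lint_indic ?leb_eball//; exact: measurable_eball.
have [i e] := lat_count_lsum r.
have [|i1 <-] := ib (r - rho); first by lra.
have [|i2 <-] := ib (r + rho); first by lra.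
rewrite e; apply/andP; split; apply: le_lint => // y; rewrite !indicE in_eball.
  case: ltP => yr; last by rewrite ler0n.
  rewrite mem_set//; split; first exact: L_latpt.
  have := enorm_tri (latpt y) y 0; rewrite !subr0 enorm_distC; have := hr y; lra.
have [/set_mem[_ lr]|_] := boolP (latpt y \in lat_ball L r); last by rewrite ler0n.
have -> // : enorm y < r + rho.
have := enorm_tri y (latpt y) 0; rewrite !subr0; have := hr y; lra.
Qed.

(** Boundary effects are negligible: by [lat_count_ball] the ratio is at least
    [((u - a - rho) / (u + rho)) ^ d], which tends to 1. *)
Lemma lat_count_ratio (u : nat -> R) (a : R) : 0 <= a -> u @ \oo --> +oo ->
  (fun n => lat_count (u n - a) / lat_count (u n)) @ \oo --> (1 : R).
Proof.
move=> a0 uoo; have [rho r0 hr] := lat_count_ball.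
have v0 : 0 < bvol R d.
  have /andP[_ h] : (2 * rho - rho) ^+ d * bvol R d <= lat_count (2 * rho) <= (2 * rho + rho) ^+ d * bvol R d.
    by apply: hr; lra.
  have : 0 < (2 * rho + rho) ^+ d * bvol R d.
    by apply: lt_le_trans h; apply: lt_le_trans (lat_count_ge1 _) => //; lra.
  by rewrite pmulr_rgt0// exprn_gt0//; lra.
have uN M : \forall n \near \oo, M < u n by exact: (cvgryPgt _).1 uoo M.
have inv0 : (fun n => (u n + rho)^-1) @ \oo --> (0 : R).
  apply/cvgrPdist_le => e e0; near=> n; rewrite sub0r normrN.
  have h : Num.max 0 e^-1 < u n by near: n; exact: uN.
  move: h; rewrite gt_max => /andP[h1 h2].
  rewrite gtr0_norm ?invr_gt0; last by lra.
  by rewrite invf_ple ?posrE//; lra.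
have q1 : (fun n => (1 - (a + 2 * rho) * (u n + rho)^-1) ^+ d) @ \oo --> (1 : R).
  have h : (fun n => 1 - (a + 2 * rho) * (u n + rho)^-1) @ \oo --> (1 : R).
    have := cvgB (cvg_cst (1 : R)) (cvgM (cvg_cst (a + 2 * rho)) inv0).
    by rewrite mulr0 subr0; apply.
  elim: d => [|k IH]; first by under eq_fun do rewrite expr0; exact: cvg_cst.
  under eq_fun do rewrite exprS.
  by have := cvgM h IH; rewrite mulr1; apply.
apply: (squeeze_cvgr (h := fun=> 1) _ q1); last exact: cvg_cst.
near=> n.
have h : a + 2 * rho < u n by near: n; exact: uN.
have un0 : 0 < u n + rho by lra.
have c1 : 0 < lat_count (u n) by apply: lt_le_trans (lat_count_ge1 _) => //; lra.
apply/andP; split; last first.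
  by rewrite ler_pdivrMr// mul1r; apply: lat_count_le; lra.
have /andP[l1 _] : (u n - a - rho) ^+ d * bvol R d <= lat_count (u n - a) <= (u n - a + rho) ^+ d * bvol R d.
  by apply: hr; lra.
have /andP[_ l2] : (u n - rho) ^+ d * bvol R d <= lat_count (u n) <= (u n + rho) ^+ d * bvol R d.
  by apply: hr; lra.
have -> : 1 - (a + 2 * rho) * (u n + rho)^-1 = (u n - a - rho) / (u n + rho).
  by field; lra.
rewrite ler_pdivlMr//; apply: le_trans _ l1.
rewrite expr_div_n mulrAC ler_pdivrMr ?exprn_gt0// -mulrA ler_wpM2l ?exprn_ge0//; last by rewrite mulrC.
lra.
Unshelve. all: by end_near. Qed.

(** The number of ordered pairs in the ball with difference [l], per point of the ball. *)
Definition overlap_ratio (r : R) (l : V) : R :=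
  (\sum_(x <- lat_seq r) \1_(lat_ball L r) (x - l)) / lat_count r.

Lemma overlap_ratio_ge0 r l : 0 <= overlap_ratio r l.
Proof. by rewrite divr_ge0 ?sumr_ge0// => x _. Qed.

Lemma overlap_ratio_le1 r l : overlap_ratio r l <= 1.
Proof.
have c0 : 0 <= lat_count r by rewrite sumr_ge0.
have h : \sum_(x <- lat_seq r) \1_(lat_ball L r) (x - l) <= lat_count r.
  by apply: ler_sum => x _; rewrite indicE; case: (_ \in _).
have [c|c] := eqVneq (lat_count r) 0; first by rewrite /overlap_ratio c invr0 mulr0.
by rewrite ler_pdivrMr ?mul1r// lt_neqAle eq_sym c.
Qed.

(** Every lattice point of norm below [u n - |l|] is counted, which reduces the claim to
    [lat_count_ratio]. *)
Lemma overlap_ratio_cvg (u : nat -> R) l : L l -> u @ \oo --> +oo ->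
  (fun n => overlap_ratio (u n) l) @ \oo --> (1 : R).
Proof.
move=> Ll uoo; apply: (squeeze_cvgr (h := fun=> 1) _ (lat_count_ratio (enorm_ge0 l) uoo)); last exact: cvg_cst.
apply: nearW => n; rewrite overlap_ratio_le1 andbT ler_wpM2r ?invr_ge0 ?sumr_ge0//.
have [_ <-] := lsum_lat_ball (u n) (fun x => \1_(lat_ball L (u n)) (x - l)).
have [i ->] := lat_count_lsum (u n - enorm l).
apply: le_lint => //; first exact: (lsum_lat_ball (u n) (fun x => \1_(lat_ball L (u n)) (x - l))).1.
move=> y; rewrite !indicE.
have [/set_mem[Lx xr]|_] := boolP (latpt y \in lat_ball L (u n - enorm l)); last by rewrite mulr_ge0 ?ler0n.
rewrite !mem_set ?mul1r//; split=> //.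
- exact: latB.
- have := enormB (latpt y) l; lra.
- have := enorm_ge0 l; lra.
Qed.

(** Group the pairs by their difference: for fixed [x], substitute [l = x - y], then exchange the
    finite sum over [x] with [lsum]. *)
Lemma double_lat_sum r (W : V -> R) : lsummable uA W ->
  (\sum_(x <- lat_seq r) \sum_(y <- lat_seq r) W (x - y)) / lat_count r =
  lsum uA (fun l => overlap_ratio r l * W l).
Proof.
move=> Ws.
have si x : lsummable uA (fun l => \1_(lat_ball L r) (x - l) * W l).
  apply: (le_lsummable (h := fun l => `|W l|) _ (integ_norm Ws)) => l _.
  by rewrite normrM ger0_norm// ler_piMl// indicE; case: (_ \in _).
have e x : x \in lat_seq r -> \sum_(y <- lat_seq r) W (x - y) =
    lsum uA (fun l => \1_(lat_ball L r) (x - l) * W l).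
  move=> /mem_lat_seq[Lx _].
  have us : uniq [seq x - y | y <- lat_seq r].
    by rewrite map_inj_uniq ?lat_seq_uniq// => y y' /addrI /oppr_inj.
  have mE l : l \in [seq x - y | y <- lat_seq r] <-> lat_ball L r (x - l).
    split=> [/mapP[y /mem_lat_seq yr ->]|/mem_lat_seq h]; first by rewrite subKr.
    by apply/mapP; exists (x - l) => //; rewrite subKr.
  have SL : [set` [seq x - y | y <- lat_seq r]] `<=` L.
    by move=> l /= /mE[Lxl _]; rewrite -[l](subKr x); exact: latB.
  have fS : finite_set [set` [seq x - y | y <- lat_seq r]] by apply/finite_seqP; eexists.
  have [_] := lsum_finite uA vQ W fS SL.
  rewrite -(fsbig_seq _ _ us) big_map => <-.
  by congr lsum; apply/funext => l; congr (_ * _); apply: indic_iff; exact: mE.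
rewrite (eq_big_seq _ e) /lsum -lint_sum// mulrC -lintZ; last by apply: integ_sum.
congr lint; apply/funext => y.
by rewrite -mulr_suml /overlap_ratio; ring.
Qed.

(** Dominated convergence with majorant [|W|], since the ratios lie in [[0, 1]] and tend to 1. *)
Lemma double_lat_sum_cvg (W : V -> R) : lsummable uA W ->
  (fun r => (\sum_(x <- lat_seq r) \sum_(y <- lat_seq r) W (x - y)) / lat_count r) @ +oo --> lsum uA W.
Proof.
move=> Ws; under eq_fun do rewrite double_lat_sum//.
apply/cvg_pinftyP => u uoo.
apply: (lsum_dct (b := fun l => `|W l|) (integ_norm Ws) _ _).2 => [k l Ll|l Ll].
  by rewrite normrM ger0_norm ?overlap_ratio_ge0// ler_piMl// overlap_ratio_le1.
have := cvgM (overlap_ratio_cvg Ll uoo) (cvg_cst (W l)).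
by rewrite mul1r; apply.
Qed.

End Tannery.

(** * Riesz potentials as symbols, and the theorem *)

Section Riesz.
Variables (R : realType) (d : nat) (s : R).
Local Notation C := R[i].

(** The potential as a function of [u = ln |x|], complex-valued to share the symbol estimates of
    [Ec]; for [s = 0] the factor [Ec 0] is 1. *)
Definition riesz_log : R -> C :=
  if 0 < s then Ec s%:C
  else if s == 0 then fun u => -1 * (u%:C * Ec s%:C u) else fun u => -1 * Ec s%:C u.

Lemma Ec_real (u : R) : Ec s%:C u = (expR (- s * u))%:C.
Proof. by apply: complex_ext; rewrite /Ec/= mul0r ?cos0 ?mulr1// sin0 mulr0 oppr0. Qed.

(** At the origin both sides are 0, because [ln 0] and nonzero powers of 0 take the value 0. *)
Lemma rieszV_radc (x : 'rV[R]_d) :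
  rieszV s (enorm x) = radc 0 (fun u => complex.Re (riesz_log u)) x.
Proof.
rewrite /radc enorm_ge0 andbT /rieszV /riesz_log.
have [->|x0] := eqVneq x 0; rewrite /=.
  rewrite enorm0; case: ltgtP => // s0; last by rewrite ln0// oppr0.
    by rewrite powR0// oppr_eq0 gt_eqF.
  by rewrite powR0 ?oppr0// oppr_eq0 lt_eqF.
have pE : enorm x `^ (- s) = expR (- s * ln (enorm x)) by rewrite /powR enorm_eq0 (negbTE x0).
case: ltgtP => s0; rewrite !Ec_real ?mulN1r ?ReN ?ReM/= ?pE// -s0 oppr0 mul0r expR0; ring.
Qed.

Lemma riesz_symb k (delta : R) : 0 < delta -> symbC k s delta riesz_log.
Proof.
move=> d0; have E1 : symbC k s delta (Ec s%:C) by exact: (symbC_Ec k s%:C (ltW d0)).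
have E2 : symbC k s delta (fun u => u%:C * Ec s%:C u).
  by have [K2 K20 hK2] := DerC_uEc (2 * k) s%:C d0; exists K2.
by rewrite /riesz_log; case: ifP => _ //; case: ifP => _; exact: symbCZ.
Qed.

End Riesz.

Theorem theorem3p1 (R : realType) (d : nat) (s : R) (A : 'M[R]_d) :
  (0 < d)%N ->
  d%:R - 4 < s -> s < d%:R ->
  A \in unitmx ->
  lebvol (wigner_seitz (lattice A)) = 1%E ->
  exists e : R,
    @cvg_pinfty R R (fun r : R => jellium_per_volume s (lattice A) r) e /\
    exists Z : R[i] -> R[i],
      epstein_continuation (lattice A) Z /\
      (0 < s -> Z s%:C = e%:C) /\
      (s = 0 -> @fderive R[i] Z 0 = e%:C) /\
      (s < 0 -> Z s%:C = (- e)%:C).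
Proof.
move=> d0 s4 sd uA hv.
set L := lattice A; set Q := wigner_seitz L in hv.
have mQ : measurable Q := measurable_ws A.
have vQ : leb R d Q = 1%E.
  rewrite -hv /lebvol lebint_ge0E//; last exact: measurable_EFin_indic.
  by rewrite integral_indic// setIT.
(* Half the distance from [s] to the ends of [(d - 4, d)]: then [s + delta < d] gives local
   integrability, and [s - delta + 4 > d] gives summability after two differences. *)
pose delta := Num.min ((d%:R - s) / 2) ((s + 4 - d%:R) / 2).
have dl0 : 0 < delta by rewrite lt_min; apply/andP; split; lra.
have dl1 : delta <= (d%:R - s) / 2 by rewrite ge_min lexx.
have dl2 : delta <= (s + 4 - d%:R) / 2 by rewrite ge_min lexx orbT.
have hc : (0 : R) = 0 -> s + delta < d%:R by move=> _; lra.
have hk : d%:R < s - delta + (2 * 2)%:R by rewrite -[(2 * 2)%N]/4%N; lra.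
have gC : symbC 2 s delta (riesz_log s) by exact: riesz_symb.
pose g u := complex.Re (riesz_log s u).
have gs : symb 2 s delta g := symb_Re gC.
pose f (x : 'rV[R]_d) := rieszV s (enorm x).
have fE : f = radc 0 g by apply/funext => x; exact: rieszV_radc.
have fi : locint f by rewrite fE; exact: (symb_locint (ltn0Sn 1) (ltW dl0) (lexx 0) hc gs).
have f0 : f 0 = 0 by rewrite fE /radc eqxx.
have Ws : lsummable uA (iter 2 (dif A) f).
  by rewrite fE; exact: (symb_lsummable uA vQ (ltn0Sn 1) (ltW dl0) (lexx 0) hc hk gs).
pose e := 2^-1 * lam uA 2 0 g.
exists e; split.
  rewrite /cvg_pinfty.
  have -> : (fun r => jellium_per_volume s L r) = fun r => 2^-1 *
      ((\sum_(x <- lat_seq uA r) \sum_(y <- lat_seq uA r) iter 2 (dif A) f (x - y)) / lat_count uA r).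
    apply/funext => r; rewrite /jellium_per_volume (lat_seqE uA).
    have SL : [set` lat_seq uA r] `<=` L by rewrite -lat_seqE => x [].
    rewrite (jellium_sum uA vQ (lat_seq_uniq uA r) SL fi f0 (s := s))//.
    by rewrite (vol_omegaN uA vQ (lat_seq_uniq uA r) SL) mulrA.
  have := cvgM (cvg_cst (2^-1 : R)) (double_lat_sum_cvg vQ Ws).
  by rewrite fE; apply.
have [c c0 hcL] := lattice_gap uA.
exists (Zeta uA c); split; first exact: Zeta_epstein.
have lam0 : lam uA 2 0 (fun=> 0) = 0.
  have -> : (fun=> 0) = (fun u : R => 0 * g u) by apply/funext => u; rewrite mul0r.
  by rewrite (lamZ uA vQ (ltn0Sn 1) (ltW dl0) (lexx 0) hc hk 0 gs) mul0r.
have LamR (h : R -> R) : Lam uA 2 0 (fun u => (h u)%:C) = (lam uA 2 0 h)%:C.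
  by apply: complex_ext => /=.
have half : (2^-1 : R[i]) = (2^-1 : R)%:C by rewrite fmorphV rmorph_nat.
have EcR : Ec s%:C = fun u => (expR (- s * u))%:C by apply/funext => u; exact: Ec_real.
have Zs : Zeta uA c s%:C = (2^-1 * lam uA 2 0 (fun u => expR (- s * u)))%:C.
  rewrite (@Zeta_regular R d A uA vQ c c0 hcL 2)//; last by rewrite /= -[(2 * 2)%N]/4%N; lra.
  by rewrite EcR LamR half -rmorphM.
(* For [s <= 0] the potential carries a minus sign: [h] will be the symbol of [|x|^-s] when [s < 0]
   and of [ln |x|] when [s = 0]. *)
have eN (h : R -> R) : g = (fun u => - h u) -> - e = 2^-1 * lam uA 2 0 h.
  move=> gh; have := lamZ uA vQ (ltn0Sn 1) (ltW dl0) (lexx 0) hc hk (-1) gs.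
  rewrite mulN1r /e -mulrN => <-; congr (_ * lam _ _ _ _).
  by apply/funext => u; rewrite gh mulN1r opprK.
split=> [s0|]; last split=> s0.
- by rewrite Zs /e; congr (_ * lam _ _ _ _)%:C; apply/funext => u; rewrite /g /riesz_log s0 Ec_real.
- have d4 : (d < 2 * 2)%N by rewrite -(ltr_nat R) -[(2 * 2)%N]/4%N; lra.
  have LamI : Lam uA 2 0 (fun u : R => u%:C) = (lam uA 2 0 id)%:C := LamR id.
  rewrite (@Zeta_fderive0 R d A uA vQ c c0 hcL 2 isT d0 d4) LamI half.
  have eI : - e = 2^-1 * lam uA 2 0 id.
    apply: eN; apply/funext => u; rewrite /g /riesz_log s0 ltxx eqxx Ec_real oppr0 mul0r expR0 mulr1.
    by rewrite mulN1r ReN.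
  by rewrite -[e]opprK eI; apply: complex_ext => /=; ring.
- rewrite Zs; congr (_%:C); rewrite -(eN (fun u => expR (- s * u)))//.
  apply/funext => u; rewrite /g /riesz_log ltNge (ltW s0)/= lt_eqF// Ec_real.
  by rewrite mulN1r ReN.
Qed.
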